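(* Suppose that conditions (A1), (A2), (A3) and (C2) (stated in the context) are satisfied, and let $c=\lim_{n\to\infty}c_n$ be the limit in (C2). Then, with probability one, the empirical eigenvalue distribution $\mu_n(X_n)$ converges weakly, as $n\to\infty$, to a non-random probability measure $\nu_c$ on $\mathbb{R}$. The limiting measure $\nu_c$ does not depend on the distribution of the random variables $a_n(p,q)$ (that is, it is the same for all arrays satisfying these conditions with the same value of $c$).
   Context: For each $n\in\mathbb{N}$ let $a_n(p,q)$, $1\le p\le q\le n$, be real random variables (all defined on a common probability space), and set $a_n(q,p):=a_n(p,q)$. Let $X_n$ be the random real symmetric $n\times n$ matrix with entries $X_n(p,q)=\frac{1}{\sqrt n}a_n(p,q)$ for $1\le p\le q\le n$ and $X_n(p,q)=X_n(q,p)$ for $1\le q<p\le n$. If $\lambda_1^{(n)}\le\dots\le\lambda_n^{(n)}$ are the eigenvalues of $X_n$, the empirical eigenvalue distribution is $\mu_n(X_n)=\frac1n\sum_{k=1}^n\delta_{\lambda_k^{(n)}}$. Conditions: (A1) $\mathbb{E}(a_n(p,q))=0$ and $\mathbb{E}(a_n(p,q)^2)=1$ for all $1\le p\le q\le n$. (A2) For every $k\in\mathbb{N}$: $m_k:=\sup_{n\in\mathbb{N}}\max_{1\le p\le q\le n}\mathbb{E}(|a_n(p,q)|^k)<\infty$. (A3) For every $n$, the families $\{a_n(p,q): 1\le p\le q\le n,\ p+q=r\}$, $r=2,3,\dots,2n$, are independent (entries within one family may be dependent). (C2) There is a real sequence $(c_n)_{n\in\mathbb{N}}$ such that for all $p,p',q,q'\in\{1,\dots,n\}$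 with $p+q=p'+q'$ and $(p,q)\notin\{(p',q'),(q',p')\}$ one has $\mathrm{Cov}(a_n(p,q),a_n(p',q'))=c_n$; moreover the limit $c:=\lim_{n\to\infty}c_n<\infty$ exists. (Then automatically $0\le c\le1$.) *)

(* Defs.v *)
From HB Require Import structures.
From mathcomp Require Import all_boot all_order all_algebra finmap.
From mathcomp Require Import polyrcf.
From mathcomp Require Import all_classical all_reals all_analysis.

Set Implicit Arguments.
Unset Strict Implicit.
Unset Printing Implicit Defensive.

Import Order.TTheory GRing.Theory Num.Theory.
Import numFieldNormedType.Exports.

Local Open Scope classical_set_scope.
Local Open Scope ring_scope.

(* The eigenvalues of A lying in R, in nondecreasing order and repeated
   according to algebraic multiplicity; when A is symmetric there are n. *)
Definition eigenvalues (R : rcfType) (n : nat) (A : 'M[R]_n) : seq R :=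
  flatten [seq nseq (mup x (char_poly A)) x | x <- rootsR (char_poly A)].

(* For A with n real eigenvalues, e.g. symmetric: otherwise nth pads with 0. *)
Definition empirical_measure (R : realType) (n : nat) (A : 'M[R]_n) :
    {measure set R -> \bar R} :=
  mscale (n%:R^-1)%:nng
    (msum (fun k => \d_((eigenvalues A)`_k)) n).

Definition weak_cvg (R : realType)
    (mu : nat -> {measure set R -> \bar R})
    (nu : {measure set R -> \bar R}) : Prop :=
  forall f : R -> R, continuous f -> bounded_fun f ->
    (\int[mu n]_x (f x)%:E @[n --> \oo] --> \int[nu]_x (f x)%:E)%E.

Definition independent_sigma_algebras (d : measure_display)
    (T : measurableType d) (R : realType) (P : probability T R)
    (K : choiceType) (D : set K) (F : K -> set (set T)) : Prop :=
  forall (J : {fset K}) (E : K -> set T),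
    [set` J] `<=` D ->
    (forall k, k \in J -> F k (E k)) ->
    P (\bigcap_(k in [set` J]) E k) = (\prod_(k <- J) P (E k))%E.

Section RandomMatrix.
Context (d : measure_display) (T : measurableType d) (R : realType).
Context (P : probability T R).

(* Row n of the array is indexed by 'I_n from 0, so that (p, q) stands for
   the pair (p + 1, q + 1) of the usual 1-based indexing. Only the entries
   with p <= q carry information. *)
Definition array := forall n : nat, 'I_n -> 'I_n -> {RV P >-> R}.

Implicit Type a : array.

Definition entry a n (p q : 'I_n) : {RV P >-> R} :=
  if (p <= q)%N then a n p q else a n q p.

Definition random_matrix a n (w : T) : 'M[R]_n :=
  \matrix_(p, q) ((Num.sqrt n%:R)^-1 * entry a p q w).

Definition condA1 a : Prop :=
  forall n (p q : 'I_n), (p <= q)%N ->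
    ('E_P[entry a p q] = 0 /\ 'E_P[fun w => (entry a p q w ^+ 2)%R] = 1)%E.

Definition moment_sup a (k : nat) : \bar R :=
  ereal_sup [set m | exists n (p q : 'I_n),
    (p <= q)%N /\ m = ('E_P[fun w => (`|entry a p q w| ^+ k)%R])%E].

Definition condA2 a : Prop := forall k, (moment_sup a k < +oo)%E.

Definition antidiagonal_sigma_algebra a n (r : nat) : set (set T) :=
  <<s \bigcup_(pq in [set pq : 'I_n * 'I_n |
                       (pq.1 <= pq.2)%N /\ (pq.1.+1 + pq.2.+1 = r)%N])
        g_sigma_algebra_preimage (entry a pq.1 pq.2) >>.

Definition condA3 a : Prop :=
  forall n, independent_sigma_algebras P
    [set r | (2 <= r <= n.*2)%N] (antidiagonal_sigma_algebra a n).

Definition condC2 a (c : R) : Prop :=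
  exists2 cn : nat -> R,
    forall n (p q p' q' : 'I_n), (p + q = p' + q')%N ->
      (p, q) \notin [:: (p', q'); (q', p')] ->
      covariance P (entry a p q) (entry a p' q') = (cn n)%:E
    & cn @ \oo --> c.

End RandomMatrix.

(* Main.v *)
(* Method of moments. Write the trace of X_n^k as a sum over circuits p_0, ..., p_(k-1),
   and group the circuits by the pattern of coincidences between the labels
   p_i + p_(i+1) of their edges; entries with different labels are independent, so
   only patterns pairing the edges contribute in the limit. A circuit is determined by
   its starting point and its labels, hence the circuits of a given pattern are
   asymptotically the lattice points of a polytope, and every pair contributes 1 if its
   two edges are forced to coincide up to reversal, and c_n otherwise. The normalized
   expectations therefore converge to numbers M_k that depend only on c and k, with
   |M_(2j)| <= 2 * 8^j * j^j. The fourth centered moment of the normalized trace is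
   O(n^-2), so the traces converge almost surely.

   The growth of M_k makes the Taylor remainder of cos (t x + phi) negligible on average,
   so spectral averages of trigonometric polynomials converge to limits determined by
   (M_k). Approximating |x - a| by trigonometric polynomials, the same holds for
   piecewise linear ramps, whose limits define the distribution function of nu_c; and
   continuous bounded functions are approximated by combinations of ramps. *)
Require Import Defs.
From HB Require Import structures.
From mathcomp Require Import all_boot all_order all_algebra finmap.
From mathcomp Require Import polyrcf complex.
From mathcomp Require Import zify ring lra.
From mathcomp Require Import all_classical all_reals all_analysis.
From mathcomp Require Import measurable_realfun.
Set Implicit Arguments.
Unset Strict Implicit.
Unset Printing Implicit Defensive.

Import Order.TTheory GRing.Theory Num.Theory.
Import numFieldNormedType.Exports.

Local Open Scope ring_scope.

(** * Lattice points of slabs *)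

(** The measure must be named before the probability space and the array. Hence limits are stated in
    the order [exists v, forall cn B m]: the combinatorial part sees an array only through a
    functional [m] on words, and the lattice densities depend on the pattern alone. Once the traces
    converge almost surely, probability disappears: [nu] is assembled from one deterministic
    sequence of spectra [S0], taken at a sample point of one array, and a function is called
    [limiting] when its averages have the same limit along all sequences of spectra with the moments
    [M].

    The obstacle in this second half is that the spectra are not uniformly bounded, so approximation
    is never uniform but on average: each error is dominated by a function whose own averages are
    under control.

    The fourth moment is taken because two circuits that share a label spare a single one, a gain of
    1/n that is not summable; among four circuits two labels can be spared. *)

Lemma leq_card_bigcupset (I X : finType) (F : I -> {set X}) :
  (#|(\bigcup_i F i)%SET| <= \sum_i #|F i|)%N.
Proof.
elim/big_ind2: _ => [|m A n B lA lB|i _]; rewrite ?cards0//.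
rewrite (leq_trans (leq_card_setU _ _).1)// leq_add//.
Qed.

Lemma leq_card_in_inj (X Y : finType) (A : {set X}) (f : X -> Y) :
  {in A &, injective f} -> (#|A| <= #|Y|)%N.
Proof. by move=> fI; rewrite -(card_in_imset fI) max_card. Qed.

Section LatticeCount.
Variable D : finType.
Implicit Types (l : D -> int).

Definition lform_eval N l (x : {ffun D -> 'I_N}) : int :=
  \sum_d l d * (x d : nat)%:Z.

(** As [l d0] is nonzero, the coordinate [d0] of a solution is determined by the other
    coordinates. *)
Lemma card_lform_eq N l d0 (a : int) : l d0 != 0 ->
  (#|[set x : {ffun D -> 'I_N} | lform_eval l x == a]| <= N ^ #|D|.-1)%N.
Proof.
move=> l0.
have cY : #|{: {ffun {d : D | d != d0} -> 'I_N}}| = (N ^ #|D|.-1)%N.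
  rewrite card_ffun card_ord card_sig; congr (_ ^ _)%N.
  by rewrite -(cardC1 d0); apply: eq_card => d; rewrite !inE.
rewrite -cY.
apply: (@leq_card_in_inj _ _ _
  (fun x : {ffun D -> 'I_N} => [ffun d : {d : D | d != d0} => x (val d)])).
move=> x y; rewrite !inE => /eqP hx /eqP hy /ffunP hxy.
have e d : d != d0 -> x d = y d.
  by move=> dd; have := hxy (exist _ d dd); rewrite !ffunE.
apply/ffunP => d; case: (eqVneq d d0) => [->|/e//].
apply/val_inj => /=; move: hy; rewrite -hx /lform_eval.
rewrite (bigD1 d0)//= [in RHS](bigD1 d0)//= (eq_bigr (fun d => l d * (x d : nat)%:Z)).
  by move=> /addIr /(mulfI l0) [].
by move=> i /e ->.
Qed.

Variable I : finType.
Variable L : I -> D -> int.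
Hypothesis L0 : forall i, exists d, L i d != 0.

(** The coordinates will be labels, sums of two vertices, and so range below [2 * n]; the slabs
    express that the vertices lie below [n]. *)
Definition lattice_box n : {set {ffun D -> 'I_(2 * n)}} :=
  [set x | [forall i, 0 <= lform_eval (L i) x < n%:Z]].

Definition coef_bound : int := \sum_i \sum_d `|L i d|.

Lemma coef_bound_ge0 : 0 <= coef_bound.
Proof. by apply: sumr_ge0 => i _; apply: sumr_ge0. Qed.

Lemma lform_eval_bound (N : nat) (r : {ffun D -> 'I_N.+1}) i :
  `|lform_eval (L i) r| <= coef_bound * N%:Z.
Proof.
apply: (@le_trans _ _ (\sum_d `|L i d| * N%:Z)).
  apply: (le_trans (ler_norm_sum _ _ _)); apply: ler_sum => d _.
  by rewrite normrM ler_wpM2l// ger0_norm// lez_nat -ltnS.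
rewrite -mulr_suml ler_wpM2r// /coef_bound (bigD1 i)//= lerDl.
by apply: sumr_ge0 => j _; apply: sumr_ge0.
Qed.

Let C := `|coef_bound|%N.

(** Points close to a face of some slab. Only there can the boundary of the refined slabs cut
    through a cell. *)
Definition lattice_bdry n : {set {ffun D -> 'I_(2 * n)}} :=
  [set x | [exists i, (- C%:Z <= lform_eval (L i) x < C%:Z) ||
    (n%:Z - C%:Z <= lform_eval (L i) x < n%:Z + C%:Z)]].

Lemma card_lattice_bdry n :
  (#|lattice_bdry n| <= (#|I| * (4 * C)) * (2 * n) ^ #|D|.-1)%N.
Proof.
(* [v] enumerates the [2 * C] values around 0, then the [2 * C] values around [n]; [3 * C] adds the
   offset of the second half to the shift by [C]. *)
pose v (a : 'I_(4 * C)) : int :=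
  if (a < 2 * C)%N then a%:Z - C%:Z else n%:Z + a%:Z - (3 * C)%:Z.
have sub : lattice_bdry n \subset
    (\bigcup_(ia : I * 'I_(4 * C)) [set x | lform_eval (L ia.1) x == v ia.2])%SET.
  apply/fintype.subsetP => x; rewrite inE => /existsP[i1 h]; apply/finset.bigcupP.
  have [a va] : exists a : 'I_(4 * C), v a = lform_eval (L i1) x.
    case/orP: h => /andP[h1 h2].
      have lt : (absz (lform_eval (L i1) x + C%:Z)%R < 4 * C)%N by lia.
      exists (Ordinal lt); rewrite /v /=.
      have -> : (absz (lform_eval (L i1) x + C%:Z)%R < 2 * C)%N by lia.
      lia.
    have lt : (absz (lform_eval (L i1) x - n%:Z + (3 * C)%N%:Z)%R < 4 * C)%N by lia.
    exists (Ordinal lt); rewrite /v /=.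
    have -> : (absz (lform_eval (L i1) x - n%:Z + (3 * C)%N%:Z)%R < 2 * C)%N = false by lia.
    lia.
  by exists (i1, a) => //; rewrite inE va.
apply: (leq_trans (subset_leq_card sub)).
apply: (leq_trans (leq_card_bigcupset _)).
apply: (@leq_trans (\sum_(ia : I * 'I_(4 * C)) (2 * n) ^ #|D|.-1)%N).
  by apply: leq_sum => -[i a] _; have [d0 l0] := L0 i; exact: card_lform_eq l0.
by rewrite sum_nat_const card_prod card_ord.
Qed.

Lemma card_lattice_box_le n : (#|lattice_box n| <= (2 * n) ^ #|D|)%N.
Proof. by rewrite (leq_trans (max_card _))// card_ffun card_ord. Qed.

(* The points of [lattice_box (n * M)] of the form [M * y + r]. *)
Definition lattice_children n M (y : {ffun D -> 'I_(2 * n)}) : nat :=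
  #|[set r : {ffun D -> 'I_M} | [forall i,
     0 <= M%:Z * lform_eval (L i) y + lform_eval (L i) r < (n * M)%:Z]]|.

(** Euclidean division of all coordinates by [M] sorts the points into cells indexed by the
    quotients. *)
Lemma card_lattice_box_mul n M : (0 < M)%N ->
  #|lattice_box (n * M)| = (\sum_y @lattice_children n M y)%N.
Proof.
move=> M0.
have lt1 (x : 'I_(2 * (n * M))) : (x %/ M < 2 * n)%N.
  by rewrite ltn_divLR// -mulnA.
have lt2 (x : 'I_(2 * (n * M))) : (x %% M < M)%N by rewrite ltn_mod.
have lt3 (y : 'I_(2 * n)) (r : 'I_M) : (M * y + r < 2 * (n * M))%N.
  by have := ltn_ord y; have := ltn_ord r; nia.
pose Y (x : {ffun D -> 'I_(2 * (n * M))}) : {ffun D -> 'I_(2 * n)} :=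
  [ffun d => Ordinal (lt1 (x d))].
pose r (x : {ffun D -> 'I_(2 * (n * M))}) : {ffun D -> 'I_M} :=
  [ffun d => Ordinal (lt2 (x d))].
pose X (y : {ffun D -> 'I_(2 * n)}) (r : {ffun D -> 'I_M}) :
  {ffun D -> 'I_(2 * (n * M))} := [ffun d => Ordinal (lt3 (y d) (r d))].
have ev i x : lform_eval (L i) x =
    M%:Z * lform_eval (L i) (Y x) + lform_eval (L i) (r x).
  rewrite /lform_eval mulr_sumr -big_split; apply: eq_bigr => d _ /=.
  rewrite !ffunE /= {1}(divn_eq (x d) M) PoszD PoszM; ring.
rewrite -sum1_card (partition_big Y predT)//=; apply: eq_bigr => y _.
rewrite /lattice_children -sum1_card.
have YK y' r' : Y (X y' r') = y'.
  apply/ffunP => d; apply/val_inj; rewrite !ffunE /= mulnC divnMDl// divn_small ?addn0//.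
have rK y' r' : r (X y' r') = r'.
  by apply/ffunP => d; apply/val_inj; rewrite !ffunE /= mulnC modnMDl modn_small.
rewrite (reindex_onto (X y) r) /=; last first.
  move=> x /andP[_ /eqP <-]; apply/ffunP => d; apply/val_inj.
  by rewrite !ffunE /= mulnC -divn_eq.
apply: eq_bigl => r'; rewrite rK eqxx andbT !inE YK eqxx andbT.
by apply: eq_forallb => i; rewrite ev YK rK.
Qed.

Lemma lattice_children_le n M y : (@lattice_children n M y <= M ^ #|D|)%N.
Proof. by rewrite (leq_trans (max_card _))// card_ffun card_ord. Qed.

(** A remainder changes [L i] by at most [C * (M - 1)], too little to carry [M * y] across a face
    that is at distance about [C] from [y]. So all points of the cell are in the box, or none is. *)
Lemma lattice_children_off_bdry n M y : (0 < M)%N -> (y \notin lattice_bdry n) ->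
  @lattice_children n M y = ((y \in lattice_box n) * M ^ #|D|)%N.
Proof.
case: M => // M _; rewrite inE negb_exists => /fintype.forallP yb.
have cb : C%:Z = coef_bound by rewrite /C gez0_abs// coef_bound_ge0.
have rb (r : {ffun D -> 'I_M.+1}) i : `|lform_eval (L i) r| <= C%:Z * M%:Z.
  by rewrite cb; exact: lform_eval_bound.
case: (boolP (y \in lattice_box n)) => yn.
  rewrite mul1n /lattice_children.
  rewrite (_ : [set r | _] = finset.setT) ?cardsT ?card_ffun ?card_ord//.
  apply/setP => r; rewrite !inE; apply/fintype.forallP => i; move: yn (yb i) (rb r i).
  rewrite inE => /fintype.forallP/(_ i); nia.
rewrite mul0n /lattice_children.
apply/eqP; rewrite cards_eq0; apply/eqP/setP => r; rewrite !inE.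
apply/negbTE; move: yn; rewrite inE !negb_forall => /existsP[i yi].
apply/existsP; exists i; move: yi (yb i) (rb r i); nia.
Qed.

(** Cells off the boundary are counted exactly; a boundary cell costs at most [M ^ #|D|] in either
    direction. *)
Lemma lattice_box_scale n M : (0 < M)%N ->
  (#|lattice_box (n * M)| <= M ^ #|D| * #|lattice_box n| + M ^ #|D| * #|lattice_bdry n|)%N
  /\ (M ^ #|D| * #|lattice_box n| <= #|lattice_box (n * M)| + M ^ #|D| * #|lattice_bdry n|)%N.
Proof.
move=> M0; rewrite card_lattice_box_mul//.
have h (A : {set {ffun D -> 'I_(2 * n)}}) : (M ^ #|D| * #|A| = \sum_y (y \in A) * M ^ #|D|)%N.
  by rewrite mulnC -sum1_card big_distrl/= big_mkcond; apply: eq_bigr => y _; case: ifP.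
have le (y : {ffun D -> 'I_(2 * n)}) := @lattice_children_le n M y.
have off y := @lattice_children_off_bdry n M y M0.
rewrite !h -!big_split/=; split; apply: leq_sum => y _; move: (le y) (off y);
  case: (y \in lattice_bdry n) => /= le1 off1; try rewrite (off1 isT);
  case: (y \in lattice_box n); rewrite ?mul1n ?mul0n ?addn0//=; lia.
Qed.

Variable R : realType.

(** There are O(n^(d-1)) boundary cells, so after division by n^d the error is O(1/n) uniformly in
    [M]. *)
Lemma lattice_ratio n M : (0 < #|D|)%N -> (0 < n)%N -> (0 < M)%N ->
  `| #|lattice_box (n * M)|%:R / (n * M)%:R ^+ #|D| -
     #|lattice_box n|%:R / n%:R ^+ #|D| | <= (#|I| * (4 * C) * 2 ^ #|D|.-1)%:R / n%:R :> R.
Proof.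
move=> D0 n0 M0; have [h1 h2] := lattice_box_scale n M0.
have hb := card_lattice_bdry n.
set d := #|D| in D0 h1 h2 hb *.
have [nR MR] : 0 < n%:R :> R /\ 0 < M%:R :> R by rewrite !ltr0n.
set a := #|lattice_box (n * M)| in h1 h2 *; set b := #|lattice_box n| in h1 h2 *.
set e := #|lattice_bdry n| in h1 h2 hb *.
have -> : a%:R / (n * M)%:R ^+ d - b%:R / n%:R ^+ d =
    (a%:R - M%:R ^+ d * b%:R) / (M%:R ^+ d * n%:R ^+ d) :> R.
  by rewrite natrM exprMn; field; rewrite !expf_neq0 ?gt_eqF.
have nMd : 0 < M%:R ^+ d * n%:R ^+ d :> R by rewrite mulr_gt0// exprn_gt0.
rewrite normrM normfV (gtr0_norm nMd) ler_pdivrMr//.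
apply: (@le_trans _ _ (M%:R ^+ d * e%:R)).
  rewrite ler_norml lerBlDr lerBrDr addrC lerBlDr -!natrX -!natrM -!natrD !ler_nat.
  by rewrite h2 addnC h1.
rewrite mulrCA ler_wpM2l ?exprn_ge0 ?ler0n//.
have -> : n%:R ^+ d = n%:R * n%:R ^+ d.-1 :> R by rewrite -exprS prednK.
rewrite mulrA divfK ?gt_eqF// -natrX -natrM ler_nat.
by rewrite -mulnA -expnMn.
Qed.

(* Off the boundary every cell splits evenly, so by [lattice_ratio] the densities
   form a Cauchy sequence; no volume is needed. *)
Lemma lattice_box_cvg : (0 < #|D|)%N ->
  exists2 v : R, 0 <= v <= 2 ^+ #|D| &
    (#|lattice_box n|%:R / n%:R ^+ #|D| @[n --> \oo] --> v)%classic.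
Proof.
move=> D0; set d := #|D|; pose K : R := (#|I| * (4 * C) * 2 ^ d.-1)%:R.
pose g (n : nat) : R := #|lattice_box n|%:R / n%:R ^+ d.
have gK n m : (0 < n)%N -> (0 < m)%N -> `|g n - g m| <= K / n%:R + K / m%:R.
  move=> n0 m0; have h1 := lattice_ratio D0 n0 m0; have h2 := lattice_ratio D0 m0 n0.
  rewrite (mulnC m) in h2.
  (* Both densities are compared with that of the common refinement [n * m]. *)
  have -> : g n - g m = - (g (n * m)%N - g n) + (g (n * m)%N - g m) by ring.
  by apply: (le_trans (ler_normD _ _)); rewrite normrN; exact: lerD.
have gb n : 0 <= g n <= 2 ^+ d.
  apply/andP; split; first by rewrite divr_ge0// exprn_ge0.
  case: (posnP n) => [->|n0].
    by rewrite /g expr0n gtn_eqF// invr0 mulr0 exprn_ge0.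
  rewrite /g ler_pdivrMr ?exprn_gt0 ?ltr0n// -exprMn -natrM -natrX ler_nat.
  exact: card_lattice_box_le.
have gc : cvgn g.
  apply/cauchy_cvgP; apply: cauchy_exP => e e0.
  have [N N0 HN] : exists2 N : nat, (0 < N)%N & K / N%:R < e / 2.
    pose N := (Num.truncn (K / (e / 2))).+1; exists N => //.
    rewrite ltr_pdivrMr// mulrC -ltr_pdivrMr ?divr_gt0//.
    exact: truncnS_gt.
  have hN n : (N <= n)%N -> K / n%:R < e / 2.
    move=> Nn; apply: le_lt_trans HN; rewrite ler_wpM2l// lef_pV2 ?posrE ?ltr0n ?ler_nat//.
    exact: leq_trans Nn.
  exists (g N); exists N => // n /= Nn.
  rewrite /ball /= (le_lt_trans (gK _ _ _ _))//; first exact: leq_trans Nn.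
  by rewrite [e]splitr ltrD// hN.
exists (limn g) => //; apply/andP; split.
- by apply: limr_ge => //; near=> n; have /andP[] := gb n.
- by apply: limr_le => //; near=> n; have /andP[] := gb n.
Unshelve. all: by end_near.
Qed.

End LatticeCount.

(** * Circuits and their label patterns *)

Section Pattern.
Variable E : finType.

(* Encodes the partition of [E] into level sets of [f] by a choice of representatives. *)
Definition pattern (T : eqType) (f : E -> T) : {ffun E -> E} :=
  [ffun e => odflt e [pick e' | f e' == f e]].

Lemma patternK (T : eqType) (f : E -> T) e : f (pattern f e) = f e.
Proof. by rewrite ffunE; case: pickP => [e' /eqP|]. Qed.

Lemma pattern_eq (T : eqType) (f : E -> T) e e' :
  (pattern f e == pattern f e') = (f e == f e').
Proof.
apply/eqP/eqP => [h|h]; first by rewrite -(patternK f e) h patternK.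
rewrite !ffunE (eq_pick (Q := fun x => f x == f e')) => [|x]; last by rewrite h.
by case: pickP => //= /(_ e'); rewrite eqxx.
Qed.

Lemma eq_pattern (T U : eqType) (f : E -> T) (g : E -> U) :
  (forall e e', (f e == f e') = (g e == g e')) -> pattern f = pattern g.
Proof.
move=> fg; apply/ffunP => e; rewrite !ffunE.
by rewrite (eq_pick (Q := fun x => g x == g e)).
Qed.

(** Hence [pattern kappa = kappa] singles out the maps that encode a partition. *)
Lemma pattern_idem (T : eqType) (f : E -> T) : pattern (pattern f) = pattern f.
Proof. by apply: eq_pattern => e e'; rewrite pattern_eq. Qed.

Lemma patternKK (T : eqType) (f : E -> T) e : pattern f (pattern f e) = pattern f e.
Proof. by apply/eqP; rewrite pattern_eq patternK. Qed.

Implicit Type kappa : {ffun E -> E}.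

Definition reps kappa : {set E} := [set r | kappa r == r].
Definition pclass kappa (r : E) : {set E} := [set e | kappa e == r].

Lemma sum_card_pclass kappa : pattern kappa = kappa ->
  (\sum_(r in reps kappa) #|pclass kappa r|)%N = #|E|.
Proof.
move=> kK; apply: esym; rewrite -sum1_card (partition_big kappa (fun r => r \in reps kappa)) /=; last first.
  by move=> e _; rewrite inE -kK patternKK.
by apply: eq_bigr => r _; rewrite -sum1_card; apply: eq_bigl => e; rewrite !inE.
Qed.
End Pattern.

(** A label and one end of an edge give the other end. Vertices propagate forwards from 0 up to the
    edge [i0] and, the circuit being closed, backwards from 0 down to it; so the labels of the edges
    other than [i0] suffice. *)
Lemma circuit_det k (p q : 'I_k.+1 -> nat) (i0 : 'I_k.+1) :
  p ord0 = q ord0 ->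
  (forall i, i != i0 -> (p i + p (ordS i) = q i + q (ordS i))%N) -> p =1 q.
Proof.
move=> h0 hS.
have fw j : (j <= i0)%N -> p (inord j) = q (inord j).
  elim: j => [|j IH] ji; first by rewrite (_ : inord 0 = ord0)//; apply/val_inj; rewrite /= inordK.
  have jk : (j < k)%N by have := ltn_ord i0; lia.
  have ne : inord j != i0 by apply/eqP => /(congr1 val) /=; rewrite inordK; lia.
  have := hS _ ne; rewrite (IH (ltnW ji)).
  have -> : ordS (inord j) = inord j.+1 :> 'I_k.+1.
    by apply/val_inj; rewrite /= !inordK ?modn_small//; lia.
  by move/addnI.
have bw d : (d < k - i0)%N -> p (inord (k - d)) = q (inord (k - d)).
  elim: d => [|d IH] di.
    have ne : inord k != i0 by apply/eqP => /(congr1 val) /=; rewrite inordK; lia.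
    have := hS _ ne; rewrite (_ : ordS (inord k) = ord0); first by rewrite h0 subn0; lia.
    by apply/val_inj; rewrite /= inordK// modnn.
  have ne : inord (k - d.+1) != i0 by apply/eqP => /(congr1 val) /=; rewrite inordK; lia.
  have := hS _ ne.
  have -> : ordS (inord (k - d.+1)) = inord (k - d) :> 'I_k.+1.
    by apply/val_inj; rewrite /= !inordK ?modn_small; lia.
  by rewrite IH; lia.
move=> i; rewrite -(inord_val i); case: (leqP i i0) => [/fw//|i0i].
have -> : (i = k - (k - i) :> nat)%N by have := ltn_ord i; lia.
by apply: bw; have := ltn_ord i; lia.
Qed.

Section Circuit.
Variables (n k : nat).
Implicit Types (p : {ffun 'I_k.+1 -> 'I_n}).

Definition circuit_edge p (i : 'I_k.+1) : 'I_n * 'I_n := (p i, p (ordS i)).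
Definition edge_label (e : 'I_n * 'I_n) : nat := (e.1 + e.2)%N.
Definition circuit_label p i : nat := edge_label (circuit_edge p i).
Definition circuit_word p := [seq circuit_edge p i | i <- enum 'I_k.+1].

End Circuit.

(** * Moments of words of entries *)

Section MomentFunctional.
Variable R : realType.

(* Abstracts the map sending a word of entries to the expectation of their product. *)
Definition moment_functional n (cn : R) (B : nat -> R) (m : seq ('I_n * 'I_n) -> R) :=
  [/\ forall (w : seq ('I_n * 'I_n)) (J : seq nat), uniq J ->
        all (fun e => edge_label e \in J) w ->
        m w = \prod_(r <- J) m [seq e <- w | edge_label e == r],
      forall e, m [:: e] = 0,
      forall w, `|m w| <= B (size w) &
      forall e e', edge_label e = edge_label e' ->
        m [:: e; e'] = if (e == e') || (e == (e'.2, e'.1)) then 1 else cn].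

Section Fixed.
Variables (n : nat) (cn : R) (B : nat -> R) (m : seq ('I_n * 'I_n) -> R).
Hypothesis mP : moment_functional cn B m.

Lemma moment_nil : m [::] = 1.
Proof. by case: mP => /(_ [::] [::])-> //; rewrite big_nil. Qed.

Lemma moment_cat w1 w2 :
  (forall e1 e2, e1 \in w1 -> e2 \in w2 -> edge_label e1 != edge_label e2) ->
  m (w1 ++ w2) = m w1 * m w2.
Proof.
move=> dis; pose J := undup (map (@edge_label n) (w1 ++ w2)).
have [mF _ _ _] := mP.
have hJ e : e \in w1 ++ w2 -> edge_label e \in J.
  by move=> ew; rewrite mem_undup map_f.
rewrite (mF _ J) ?undup_uniq//; last exact/allP.
rewrite (mF w1 J) ?undup_uniq//; last first.
  by apply/allP => e e1; apply: hJ; rewrite mem_cat e1.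
rewrite (mF w2 J) ?undup_uniq//; last first.
  by apply/allP => e e1; apply: hJ; rewrite mem_cat e1 orbT.
rewrite -big_split /=; apply: eq_bigr => r _; rewrite filter_cat.
case: (boolP (has (fun e => edge_label e == r) w1)) => [/hasP[e1 e1w /eqP h1]|].
  rewrite (_ : [seq e <- w2 | _] = [::]) ?cats0 ?moment_nil ?mulr1//.
  apply/eqP; rewrite -[_ == _]negbK -has_filter; apply/hasP => -[e2 e2w /eqP h2].
  by have := dis _ _ e1w e2w; rewrite h1 h2 eqxx.
by rewrite has_filter negbK => /eqP->; rewrite moment_nil mul1r.
Qed.

(** The factor that belongs to the label [r] is the mean of a single entry. *)
Lemma moment_single w r : count (fun e => edge_label e == r) w = 1%N -> m w = 0.
Proof.
move=> w1; have [mF m0 _ _] := mP.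
pose J := undup (map (@edge_label n) w).
have hJ e : e \in w -> edge_label e \in J by move=> ew; rewrite mem_undup map_f.
rewrite (mF _ J) ?undup_uniq//; last exact/allP.
have rJ : r \in J.
  have /hasP[e ew /eqP<-] : has (fun e => edge_label e == r) w by rewrite has_count w1.
  exact: hJ.
rewrite (big_rem r)//=; move: w1; rewrite -size_filter.
by case: [seq e <- w | _] => [|e []]//; rewrite m0 mul0r.
Qed.

Lemma moment_circuit k (p : {ffun 'I_k.+1 -> 'I_n}) kappa :
  pattern (circuit_label p) = kappa ->
  m (circuit_word p) = \prod_(r in reps kappa)
    m (map (circuit_edge p) [seq i <- enum 'I_k.+1 | kappa i == r]).
Proof.
move=> kE; have [mF _ _ _] := mP.
pose J := [seq circuit_label p r | r <- enum (reps kappa)].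
rewrite (mF _ J).
- rewrite big_map big_enum; apply: eq_bigr => r; rewrite inE => /eqP rr.
  rewrite filter_map; congr (m (map _ _)); apply: eq_filter => i /=.
  by rewrite -/(circuit_label p i) -(pattern_eq (circuit_label p)) kE rr.
- rewrite map_inj_in_uniq ?enum_uniq// => r r'; rewrite !mem_enum !inE.
  move=> /eqP rr /eqP rr' h.
  by apply/eqP; rewrite -rr -rr' -kE pattern_eq h.
- apply/allP => e /mapP[i _ ->]; apply/mapP; exists (kappa i).
    by rewrite mem_enum inE -kE patternKK.
  by rewrite -kE; rewrite patternK.
Qed.

End Fixed.
End MomentFunctional.

(** * Circuits of a given pattern as lattice points *)

Lemma lform_eval_delta (D : finType) N (x : {ffun D -> 'I_N}) d0 :
  lform_eval (fun d => ((d == d0) : nat)%:Z) x = (x d0 : nat)%:Z.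
Proof.
rewrite /lform_eval (bigD1 d0)//= eqxx mul1r big1 ?addr0// => d /negPf->.
exact: mul0r.
Qed.

Lemma lform_evalB (D : finType) N (l1 l2 : D -> int) (x : {ffun D -> 'I_N}) :
  lform_eval (fun d => l1 d - l2 d) x = lform_eval l1 x - lform_eval l2 x.
Proof. by rewrite /lform_eval -sumrB; apply: eq_bigr => d _; rewrite mulrBl. Qed.

Section PatternParam.
Variables (k : nat) (kappa : {ffun 'I_k.+1 -> 'I_k.+1}).

Definition pcoord : finType := option {r : 'I_k.+1 | kappa r == r}.

(* The vertex [p j] of a circuit whose labels have pattern [kappa], as an integral
   form in the starting vertex ([None]) and the labels of the blocks. *)
Fixpoint pform (j : nat) : pcoord -> int :=
  if j is j'.+1 then
    fun d => ((d == insub (kappa (inord j'))) : nat)%:Z - pform j' d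
  else fun d => ((d == None) : nat)%:Z.

(** Each vertex is a label minus the preceding vertex, so the starting vertex enters with
    alternating signs. In particular no [pform j] vanishes, as the lattice count requires. *)
Lemma pform_None j : pattern kappa = kappa -> pform j None = (-1) ^+ j.
Proof.
move=> kK; elim: j => [|j IH] //; rewrite exprS -IH /= insubT.
  by rewrite -kK patternKK.
by move=> h; rewrite /= sub0r mulN1r.
Qed.

Lemma card_pcoord : #|{: pcoord}| = #|reps kappa|.+1.
Proof.
rewrite card_option card_sig; congr _.+1; by apply: eq_card => r; rewrite !inE.
Qed.

Section Fixed.
Variable n : nat.
Implicit Type p : {ffun 'I_k.+1 -> 'I_n}.

Lemma circuit_label_lt p i : (circuit_label p i < 2 * n)%N.
Proof.
rewrite /circuit_label /edge_label /=.
by have := ltn_ord (p i); have := ltn_ord (p (ordS i)); lia.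
Qed.

Lemma circuit_start_lt p : (p ord0 < 2 * n)%N.
Proof. by have := ltn_ord (p ord0); lia. Qed.

Definition pparam p : {ffun pcoord -> 'I_(2 * n)} :=
  [ffun d => if d is Some r then Ordinal (circuit_label_lt p (val r))
             else Ordinal (circuit_start_lt p)].

(** The second equation matters for [i = k]: there [pform k.+1] has to return to the starting
    vertex. *)
Lemma pform_param p : pattern (circuit_label p) = kappa ->
  forall i : 'I_k.+1, lform_eval (pform i) (pparam p) = (p i : nat)%:Z /\
     lform_eval (pform i.+1) (pparam p) = (p (ordS i) : nat)%:Z.
Proof.
move=> pk.
have step (i : 'I_k.+1) : lform_eval (pform i) (pparam p) = (p i : nat)%:Z ->
    lform_eval (pform i.+1) (pparam p) = (p (ordS i) : nat)%:Z.
  move=> h; rewrite /= lform_evalB h lform_eval_delta inord_val insubT.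
    by rewrite -pk patternKK.
  move=> kk; rewrite ffunE /= -pk patternK /circuit_label /edge_label /= PoszD.
  ring.
have base j : (j <= k)%N -> lform_eval (pform j) (pparam p) = (p (inord j) : nat)%:Z.
  elim: j => [|j IH] jk.
    rewrite lform_eval_delta ffunE /=; congr (_ (p _))%:Z.
    by apply/val_inj; rewrite /= inordK.
  have e : (inord j : 'I_k.+1) = j :> nat by rewrite inordK// ltnW// ltnW.
  have := step (inord j); rewrite e => /(_ (IH (ltnW jk))) ->.
  congr (Posz (nat_of_ord (p _))); apply/val_inj; rewrite /= !inordK ?modn_small//; lia.
move=> i; have h := base i; rewrite inord_val -ltnS ltn_ord in h.
by split; [exact: h|apply: step; exact: h].
Qed.

Lemma pparam_inj : {in [pred p | pattern (circuit_label p) == kappa] &, injective pparam}.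
Proof.
move=> p q; rewrite !inE => /eqP hp /eqP hq pq; apply/ffunP => i; apply/val_inj.
have [h1 _] := pform_param hp i; have [h2 _] := pform_param hq i.
by move: h1; rewrite pq h2 => -[].
Qed.

Lemma card_pattern_le :
  (#|[set p : {ffun 'I_k.+1 -> 'I_n} | pattern (circuit_label p) == kappa]| <= (2 * n) ^ #|reps kappa|.+1)%N.
Proof.
rewrite -card_pcoord -[X in (X ^ _)%N]card_ord -card_ffun.
apply: (@leq_card_in_inj _ _ _ pparam) => p q; rewrite !inE => hp hq.
by apply: pparam_inj; rewrite inE.
Qed.

Definition pform_same i j := [forall d, pform i d == pform j d].

(* Parameters for which vertices or labels coincide without being forced to. *)
Definition pbad : {set {ffun pcoord -> 'I_(2 * n)}} :=
  [set x | [exists i : 'I_k.+2, [exists j : 'I_k.+2, ~~ pform_same i j &&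
     (lform_eval (pform i) x == lform_eval (pform j) x)]] ||
     [exists d, [exists d', (d != d') && (x d == x d')]]].

(** Every coincidence is a nontrivial linear equation in the parameters and costs one power of [n];
    the first factor bounds the number of such equations. *)
Lemma card_pbad :
  (#|pbad| <= (k.+2 * k.+2 + #|reps kappa|.+1 * #|reps kappa|.+1) *
    (2 * n) ^ #|reps kappa|)%N.
Proof.
pose A (ij : 'I_k.+2 * 'I_k.+2) : {set {ffun pcoord -> 'I_(2 * n)}} :=
  if pform_same ij.1 ij.2 then finset.set0 else
  [set x | lform_eval (fun d => pform ij.1 d - pform ij.2 d) x == 0].
pose A' (d : pcoord * pcoord) : {set {ffun pcoord -> 'I_(2 * n)}} :=
  if d.1 == d.2 then finset.set0 else
  [set x | lform_eval (fun d' => ((d' == d.1) : nat)%:Z - ((d' == d.2) : nat)%:Z) x == 0].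
have cD : #|{: pcoord}|.-1 = #|reps kappa| by rewrite card_pcoord.
have cA ij : (#|A ij| <= (2 * n) ^ #|reps kappa|)%N.
  rewrite /A; case: ifPn => [_|]; first by rewrite cards0.
  rewrite negb_forall => /existsP[d hd]; rewrite -cD.
  by apply: (@card_lform_eq _ _ _ d); rewrite subr_eq0.
have cA' d : (#|A' d| <= (2 * n) ^ #|reps kappa|)%N.
  rewrite /A'; case: ifPn => [_|hd]; first by rewrite cards0.
  rewrite -cD; apply: (@card_lform_eq _ _ _ d.1).
  by rewrite eqxx (negPf hd).
have sub : pbad \subset ((\bigcup_ij A ij) :|: (\bigcup_d A' d))%SET.
  apply/fintype.subsetP => x; rewrite !inE => /orP[/existsP[i /existsP[j /andP[ij /eqP h]]]|].
    apply/orP; left; apply/finset.bigcupP; exists (i, j) => //.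
    by rewrite /A /= (negPf ij) inE lform_evalB h subrr.
  move=> /existsP[d /existsP[d' /andP[dd /eqP h]]].
  apply/orP; right; apply/finset.bigcupP; exists (d, d') => //.
  by rewrite /A' /= (negPf dd) inE lform_evalB !lform_eval_delta h subrr.
apply: (leq_trans (subset_leq_card sub)); apply: (leq_trans (leq_card_setU _ _).1).
rewrite mulnDl leq_add//; apply: (leq_trans (leq_card_bigcupset _)).
  apply: (@leq_trans (\sum_(ij : 'I_k.+2 * 'I_k.+2) (2 * n) ^ #|reps kappa|)%N).
    by apply: leq_sum => ij _; exact: cA.
  by rewrite sum_nat_const card_prod !card_ord.
apply: (@leq_trans (\sum_(d : pcoord * pcoord) (2 * n) ^ #|reps kappa|)%N).
  by apply: leq_sum => d _; exact: cA'.
by rewrite sum_nat_const card_prod card_pcoord.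
Qed.

Definition pbox := lattice_box (fun i : 'I_k.+1 => pform i) n.

Lemma pparam_box p : pattern (circuit_label p) = kappa -> pparam p \in pbox.
Proof.
move=> hp; rewrite inE; apply/forallP => i; have [-> _] := pform_param hp i.
by rewrite le0z_nat ltz_nat ltn_ord.
Qed.

(** The slabs put the vertices in range, the identity of forms closes the circuit, and outside
    [pbad] distinct blocks have distinct labels, so the pattern is no coarser than [kappa]. *)
Lemma pparam_surj (x : {ffun pcoord -> 'I_(2 * n)}) : pattern kappa = kappa ->
  pform_same k.+1 0 -> x \in pbox -> x \notin pbad ->
  exists2 p, pattern (circuit_label p) = kappa & pparam p = x.
Proof.
move=> kK /forallP clo; rewrite inE => /forallP xb xnb.
have lt (i : 'I_k.+1) : (absz (lform_eval (pform i) x) < n)%N.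
  by have := xb i; lia.
pose p : {ffun 'I_k.+1 -> 'I_n} := [ffun i => Ordinal (lt i)].
have pi (i : 'I_k.+1) : (p i : nat)%:Z = lform_eval (pform i) x.
  by rewrite ffunE /= gez0_abs//; have /andP[] := xb i.
have pS (i : 'I_k.+1) : (p (ordS i) : nat)%:Z = lform_eval (pform i.+1) x.
  rewrite pi; have [ik|ik] : (i < k)%N \/ i = k :> nat by have := ltn_ord i; lia.
    by rewrite (_ : ordS i = i.+1 :> nat)//= modn_small.
  rewrite (_ : ordS i = 0 :> nat)/= ?ik ?modnn//.
  by apply: eq_bigr => d _; have /eqP/= <- := clo d.
have lab i : circuit_label p i = x (insub (kappa i)).
  apply/eqP; rewrite -eqz_nat /circuit_label /edge_label /= PoszD pi pS.
  by rewrite [lform_eval (pform i.+1) x]lform_evalB lform_eval_delta inord_val addrC subrK.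
have hp : pattern (circuit_label p) = kappa.
  rewrite -[RHS]kK; apply: eq_pattern => i j; rewrite !lab.
  have ki l : kappa (kappa l) == kappa l by rewrite -kK patternKK.
  rewrite (insubT (fun r => kappa r == r) (ki i)) (insubT (fun r => kappa r == r) (ki j)).
  apply/eqP/eqP => [/val_inj h|h]; last first.
    by congr (nat_of_ord (x (Some _))); exact/val_inj.
  apply/eqP; apply: contraNT xnb => kij; rewrite inE; apply/orP; right.
  apply/existsP; eexists; apply/existsP; eexists; apply/andP; split; last exact/eqP/h.
  by apply: contra kij => /eqP [->].
exists p => //; apply/ffunP => -[[r rr]|]; apply/val_inj; rewrite ffunE /=.
  by rewrite lab (eqP rr) insubT.
have [h _] := pform_param hp ord0.
by apply/eqP; rewrite -eqz_nat pi; apply/eqP; exact: lform_eval_delta.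
Qed.

End Fixed.
End PatternParam.

(** * The sum over the circuits of one pattern *)

Section PatternSum.
Variables (R : realType) (k : nat) (kappa : {ffun 'I_k.+1 -> 'I_k.+1}).

Definition pattern_sum n (m : seq ('I_n * 'I_n) -> R) : R :=
  \sum_(p : {ffun 'I_k.+1 -> 'I_n} | pattern (circuit_label p) == kappa) m (circuit_word p).

Section Fixed.
Variables (n : nat) (cn : R) (B : nat -> R) (m : seq ('I_n * 'I_n) -> R).
Hypothesis mP : moment_functional cn B m.
Hypothesis B0 : forall j, 0 <= B j.

Lemma circuit_moment_le (p : {ffun 'I_k.+1 -> 'I_n}) : `|m (circuit_word p)| <= B k.+1.
Proof. by have [_ _ /(_ (circuit_word p))] := mP; rewrite size_map size_enum_ord. Qed.

Lemma pattern_sum_le (P : pred {ffun 'I_k.+1 -> 'I_n}) :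
  `|\sum_(p | P p) m (circuit_word p)| <= B k.+1 * #|[set p | P p]|%:R.
Proof.
apply: (le_trans (ler_norm_sum _ _ _)).
apply: (@le_trans _ _ (\sum_(p | P p) B k.+1)).
  by apply: ler_sum => p _; exact: circuit_moment_le.
rewrite (eq_bigl (fun p => p \in [set p | P p])) => [|p]; last by rewrite inE.
by rewrite sumr_const mulr_natr.
Qed.

Lemma size_class_filter r :
  size [seq i <- enum 'I_k.+1 | kappa i == r] = #|pclass kappa r|.
Proof.
rewrite -(card_uniqP (filter_uniq _ (enum_uniq _))).
by apply: eq_card => i; rewrite mem_filter mem_enum andbT inE.
Qed.

Lemma pattern_sum_single r : r \in reps kappa -> #|pclass kappa r| = 1%N ->
  pattern_sum m = 0.
Proof.
move=> rr r1; rewrite /pattern_sum big1// => p /eqP pk.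
rewrite (moment_circuit mP pk) (bigD1 r)//=.
move: r1; rewrite -size_class_filter; case: [seq i <- _ | _] => [|i []]// _.
by have [_ m0 _ _] := mP; rewrite m0 mul0r.
Qed.

(* The edges of the block [r] coincide up to reversal for every parameter. *)
Definition pair_same r := [exists i, [exists j, [&& kappa i == r, kappa j == r, i != j &
  pform_same kappa i j || pform_same kappa i (j : 'I_k.+1).+1]]].

Definition nb_free_pairs := #|[set r in reps kappa | ~~ pair_same r]|.

Hypothesis pairs : forall r, r \in reps kappa -> #|pclass kappa r| = 2%N.

(** Outside [pbad] two vertices agree only if their forms do. Whether the two edges of a block
    coincide up to reversal therefore depends on [kappa] alone, and the moment is the same for all
    such circuits. *)
Lemma pair_moment p : pattern (circuit_label p) = kappa -> pparam kappa p \notin pbad kappa n ->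
  m (circuit_word p) = cn ^+ nb_free_pairs.
Proof.
move=> pk pb; rewrite (moment_circuit mP pk).
transitivity (\prod_(r in reps kappa) if pair_same r then 1 else cn).
  apply: eq_bigr => r rr; have := pairs rr; rewrite -size_class_filter.
  have := filter_uniq (fun i => kappa i == r) (enum_uniq 'I_k.+1).
  have : forall i, i \in [seq i <- enum 'I_k.+1 | kappa i == r] = (kappa i == r).
    by move=> i; rewrite mem_filter mem_enum andbT.
  case: [seq i <- _ | _] => [|i [|j []]]// memij; rewrite /= inE andbT => ij _.
  have [ki kj] : kappa i == r /\ kappa j == r by rewrite -!memij !inE !eqxx ?orbT.
  have [_ _ _ ->] := mP; last first.
    rewrite -/(circuit_label p i) -/(circuit_label p j); apply/eqP.
    by rewrite -(pattern_eq (circuit_label p)) pk (eqP ki) (eqP kj).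
  congr (if _ then _ else _).
  have lab i' j' : kappa i' == r -> kappa j' == r -> (p i' + p (ordS i') = p j' + p (ordS j'))%N.
    move=> ki' kj'; apply/eqP; rewrite -[_ == _]/(circuit_label p i' == circuit_label p j').
    by rewrite -(pattern_eq (circuit_label p)) pk (eqP ki') (eqP kj').
  have same (a b : nat) : (a <= k.+1)%N -> (b <= k.+1)%N ->
     lform_eval (@pform k kappa a) (pparam kappa p) = lform_eval (@pform k kappa b) (pparam kappa p) ->
     pform_same kappa a b.
    move=> ak bk h; apply: contraNT pb => ab; rewrite inE; apply/orP; left.
    apply/existsP; exists (inord a); apply/existsP; exists (inord b).
    by rewrite !inordK// ab h eqxx.
  have ev (a b : nat) (x : {ffun pcoord kappa -> 'I_(2 * n)}) : pform_same kappa a b ->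
     lform_eval (@pform k kappa a) x = lform_eval (@pform k kappa b) x.
    by move=> /forallP h; apply: eq_bigr => d _; rewrite (eqP (h d)).
  apply/idP/idP.
    case/orP => /eqP[]/= h1 h2; apply/existsP; exists i; apply/existsP; exists j;
      rewrite ki kj ij /=; apply/orP; [left|right]; apply: same.
    - by rewrite ltnW.
    - by rewrite ltnW.
    - by rewrite !(pform_param pk _).1 h1.
    - by rewrite ltnW.
    - exact: ltn_ord.
    - by rewrite (pform_param pk _).1 (pform_param pk _).2 h1.
  move=> /existsP[i' /existsP[j' /and4P[ki' kj' ij' /orP s]]].
  have hij : (i' = i /\ j' = j) \/ (i' = j /\ j' = i).
    move: (ki') (kj'); rewrite -!memij !inE.
    move=> /orP[] /eqP e1 /orP[] /eqP e2; move: ij'; rewrite e1 e2 ?eqxx//; tauto.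
  have lij := lab _ _ ki kj.
  case: s => /ev => /(_ (pparam kappa p)); rewrite (pform_param pk _).1.
    rewrite (pform_param pk _).1 => -[h]; rewrite /circuit_edge !xpair_eqE.
    have e1 : p i = p j.
      by apply/val_inj; case: hij h => -[-> ->] /=.
    rewrite e1 eqxx /=; apply/orP; left.
    by apply/eqP/val_inj; move: lij; rewrite e1 => /addnI.
  rewrite (pform_param pk _).2 => -[h]; rewrite /circuit_edge !xpair_eqE; apply/orP; right => /=.
  rewrite -!val_eqE /=.
  by case: hij h => -[-> ->] /= h; lia.
rewrite (bigID pair_same) /= big1 ?mul1r => [|r /andP[_ ->]//].
rewrite /nb_free_pairs -sum1_card expr_sum; apply: eq_big => r; rewrite ?inE//.
by move=> /andP[_ /negPf->]; rewrite expr1.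
Qed.

Hypothesis kK : pattern kappa = kappa.
Hypothesis cn1 : `|cn| <= 1.

(** Outside [pbad], [pparam] is a bijection onto the remaining points of the box and the summand is
    constant. Bad circuits contribute the term [B k.+1], bad points of the box the term 1, since the
    coefficient has modulus at most 1. *)
Lemma pattern_sum_box :
  `|pattern_sum m - (pform_same kappa k.+1 0)%:R * cn ^+ nb_free_pairs * #|pbox kappa n|%:R|
    <= (1 + B k.+1) * #|pbad kappa n|%:R.
Proof.
pose P p := pattern (@circuit_label n k p) == kappa.
pose X := @pparam k kappa n.
pose G := (pbox kappa n :\: pbad kappa n)%SET.
rewrite /pattern_sum (bigID (fun p => X p \in pbad kappa n)) /=.
have Xinj : {in [pred p | P p] &, injective X} by exact: pparam_inj.
set S1 := \sum_(p | _) _; set S2 := \sum_(p | _) _.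
have hS1 : `|S1| <= B k.+1 * #|pbad kappa n|%:R.
  apply: (le_trans (pattern_sum_le _)).
  rewrite ler_wpM2l//.
  rewrite ler_nat -(@card_in_imset _ _ X) => [|p q]; last first.
    by rewrite !finset.in_set => /andP[hp _] /andP[hq _]; apply: Xinj; rewrite inE.
  apply: subset_leq_card; apply/fintype.subsetP => _ /imsetP[p + ->].
  by rewrite finset.in_set => /andP[].
have S2E : S2 = (pform_same kappa k.+1 0)%:R * cn ^+ nb_free_pairs * #|G|%:R.
  (* If the forms do not close up identically, closing up is a nontrivial equation, so all circuits
     of the pattern have bad parameters. *)
  case: (boolP (pform_same kappa k.+1 0)) => clo; last first.
    rewrite !mul0r /S2 big_pred0// => p; apply/negbTE; rewrite negb_and negbK.
    case: (boolP (P p)); rewrite /P => /eqP hp; last by rewrite (introF eqP hp).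
    rewrite hp eqxx /=; rewrite inE; apply/orP; left.
    apply/existsP; exists (inord k.+1); apply/existsP; exists (inord 0).
    rewrite !inordK// clo /=.
    have [_ h] := pform_param hp (ord_max : 'I_k.+1); have [h0 _] := pform_param hp ord0.
    rewrite [lform_eval (@pform k kappa k.+1) _]h [lform_eval (@pform k kappa 0) _]h0.
    rewrite eqz_nat; apply/eqP; congr (nat_of_ord (p _)).
    by apply/val_inj; rewrite /= modnn.
  rewrite mul1r /S2 (eq_bigr (fun=> cn ^+ nb_free_pairs)); last first.
    by move=> p /andP[/eqP hp hX]; apply: pair_moment.
  pose A := [set p | P p && (X p \notin pbad kappa n)].
  rewrite (eq_bigl (fun p => p \in A)) => [|p]; last by rewrite /A [RHS]finset.in_set.
  rewrite sumr_const mulr_natr; congr (_ *+ _).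
  rewrite -(@card_in_imset _ _ X) => [|p q]; last first.
    by rewrite !finset.in_set => /andP[hp _] /andP[hq _]; apply: Xinj; rewrite inE.
  apply: eq_card => x; apply/imsetP/idP.
    move=> [p]; rewrite finset.in_set => /andP[/eqP hp hX] ->.
    by rewrite finset.in_setD hX; exact: pparam_box.
  rewrite finset.in_setD => /andP[xB xb]; have [p hp pX] := pparam_surj kK clo xb xB.
  by exists p => //; rewrite finset.in_set /P hp eqxx /X pX.
rewrite S2E.
have hG : (#|pbox kappa n| <= #|G| + #|pbad kappa n|)%N /\ (#|G| <= #|pbox kappa n|)%N.
  rewrite /G; have := cardsID (pbad kappa n) (pbox kappa n).
  have := subset_leq_card (subsetIr (pbox kappa n) (pbad kappa n)); lia.
set z := _%:R * _; have z1 : `|z| <= 1.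
  rewrite normrM normrX normr_nat mulr_ile1// ?exprn_ile1//; by case: pform_same.
have -> : S1 + z * #|G|%:R - z * #|pbox kappa n|%:R =
   S1 + z * (#|G|%:R - #|pbox kappa n|%:R) by ring.
apply: (le_trans (ler_normD _ _)); rewrite mulrDl mul1r addrC lerD// normrM.
apply: (@le_trans _ _ (1 * #|pbad kappa n|%:R)); last by rewrite mul1r.
rewrite ler_pM// distrC ger0_norm ?subr_ge0 ?ler_nat ?hG.2//.
by rewrite lerBlDl -natrD ler_nat hG.1.
Qed.
End Fixed.
End PatternSum.

(** * Limits of circuit sums *)

Section CircuitSum.
Variable R : realType.

Lemma cvg_seq_sum (I : Type) (r : seq I) (u : I -> nat -> R) (l : I -> R) :
  (forall i, u i n @[n --> \oo] --> l i)%classic ->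
  (\sum_(i <- r) u i n @[n --> \oo] --> \sum_(i <- r) l i)%classic.
Proof.
move=> ul; elim: r => [|i r IH].
  under eq_fun do rewrite big_nil.
  by rewrite big_nil; exact: cvg_cst.
under eq_fun do rewrite big_cons.
by rewrite big_cons; exact: cvgD.
Qed.

Lemma cvg_seq_expr (u : nat -> R) (l : R) j :
  (u n @[n --> \oo] --> l)%classic -> (u n ^+ j @[n --> \oo] --> l ^+ j)%classic.
Proof.
move=> ul; elim: j => [|j IH].
  under eq_fun do rewrite expr0.
  by rewrite expr0; exact: cvg_cst.
under eq_fun do rewrite exprS.
by rewrite exprS; exact: cvgM.
Qed.

(** The rate comes from an odd number of edges, where a pattern may miss the leading order by only
    half a power of [n]. *)
Lemma cvg0_invsqrt (u : nat -> R) (K : R) :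
  (forall n, (0 < n)%N -> `|u n| <= K / Num.sqrt n%:R) -> (u n @[n --> \oo] --> 0)%classic.
Proof.
move=> uK; apply/cvgr0Pnorm_lt => e e0.
have K0 : 0 <= K by have := uK 1%N isT; rewrite sqrtr1 divr1; apply: le_trans.
near=> n.
have n0 : (0 < n)%N by near: n; exists 1%N.
apply: (le_lt_trans (uK n n0)); rewrite ltr_pdivrMr ?sqrtr_gt0 ?ltr0n// mulrC -ltr_pdivrMr//.
have -> : K / e = Num.sqrt ((K / e) ^+ 2) by rewrite sqrtr_sqr ger0_norm// divr_ge0// ltW.
rewrite ltr_sqrt ?ltr0n//.
apply: (@lt_le_trans _ _ (Num.truncn ((K / e) ^+ 2)).+1%:R); first exact: truncnS_gt.
by rewrite ler_nat; near: n; exact: nbhs_infty_ge.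
Unshelve. all: by end_near.
Qed.

Section OnePattern.
Variables (k : nat) (kappa : {ffun 'I_k.+1 -> 'I_k.+1}).
Hypothesis kK : pattern kappa = kappa.

Definition moment_family (cn : nat -> R) (B : nat -> R)
    (m : forall n, seq ('I_n * 'I_n) -> R) :=
  [/\ forall j, 0 <= B j, forall n, `|cn n| <= 1 &
      forall n, moment_functional (cn n) B (m n)].

(** Universality of the limit lies in the choice of [v] before the family [m]. It is the limiting
    density of the box times a power of [c], or 0 when the forms do not close up; its bound is that
    of the density. *)
Lemma pattern_sum_pair_cvg (c : R) : `|c| <= 1 ->
  (forall r, r \in reps kappa -> #|pclass kappa r| = 2%N) ->
  exists2 v : R, `|v| <= 2 ^+ #|reps kappa|.+1 &
    forall cn B m, moment_family cn B m -> (cn n @[n --> \oo] --> c)%classic ->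
    (pattern_sum kappa (m n) / n%:R ^+ #|reps kappa|.+1 @[n --> \oo] --> v)%classic.
Proof.
move=> c1 pairs; set d := #|reps kappa|.+1.
have cD : #|{: pcoord kappa}| = d by exact: card_pcoord.
have [|//|v0 /andP[v00 v02] v0c] := @lattice_box_cvg _ _ (fun i : 'I_k.+1 => @pform k kappa i) _ R.
  by move=> i; exists None; rewrite pform_None// signr_eq0.
  by rewrite cD.
rewrite cD in v02 v0c.
set h := nb_free_pairs kappa.
pose z : R := (pform_same kappa k.+1 0)%:R.
have z1 : `|z| <= 1 by rewrite normr_nat; case: pform_same.
exists (z * c ^+ h * v0).
  rewrite normrM -[leRHS]mul1r ler_pM//; last by rewrite ger0_norm.
  by rewrite normrM normrX mulr_ile1// exprn_ile1.
move=> cn B m [B0 cn1 mP] cc.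
set u := fun n => pattern_sum _ _ / _.
pose b n := z * (cn n) ^+ h * (#|pbox kappa n|%:R / n%:R ^+ d).
have bc : (b n @[n --> \oo] --> z * c ^+ h * v0)%classic.
  apply: cvgM; last exact: v0c.
  apply: cvgM; first exact: cvg_cst.
  exact: cvg_seq_expr.
suff ub : (u n - b n @[n --> \oo] --> 0)%classic.
  have -> : u = (fun n => (u n - b n) + b n) by apply/funext => n; rewrite subrK.
  by rewrite -[X in (_ --> X)%classic]add0r; exact: cvgD.
pose K : R := (k.+2 * k.+2 + #|reps kappa|.+1 * #|reps kappa|.+1)%:R.
apply: (@cvg0_invsqrt _ ((1 + B k.+1) * K * 2 ^+ #|reps kappa|)) => n n0.
have nR : 0 < n%:R :> R by rewrite ltr0n.
have -> : u n - b n =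
    (pattern_sum kappa (m n) - z * cn n ^+ h * #|pbox kappa n|%:R) / n%:R ^+ d.
  by rewrite /u /b mulrBl mulrA.
rewrite normrM normfV (ger0_norm (exprn_ge0 _ (ltW nR))) ler_pdivrMr ?exprn_gt0//.
apply: (le_trans (pattern_sum_box (mP n) B0 pairs kK (cn1 n))).
rewrite -!mulrA ler_wpM2l//; first by rewrite addr_ge0.
apply: (@le_trans _ _ (K * (2 * n%:R) ^+ #|reps kappa|)).
  rewrite /K -natrM -natrX -natrM ler_nat; exact: card_pbad.
rewrite ler_wpM2l// exprMn ler_wpM2l ?exprn_ge0//.
rewrite /d exprS mulrA ler_peMl ?exprn_ge0//.
have -> : (Num.sqrt n%:R)^-1 * n%:R = Num.sqrt n%:R :> R.
  by rewrite -{2}(sqr_sqrtr (ltW nR)) expr2 mulKf// gt_eqF// sqrtr_gt0.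
by rewrite -[leLHS]sqrtr1 ler_sqrt// ler1n.
Qed.

(** With b blocks there are O(n^(b+1)) circuits, against a normalization of order n^(1 +
    (k+1)/2). *)
Lemma pattern_sum_cvg0 cn B m : moment_family cn B m ->
  (#|reps kappa| * 2 < k.+1)%N ->
  (n%:R^-1 * (Num.sqrt n%:R)^-1 ^+ k.+1 * pattern_sum kappa (m n) @[n --> \oo] --> 0)%classic.
Proof.
move=> [B0 cn1 mP]; set b := #|reps kappa| => bk.
apply: (@cvg0_invsqrt _ (B k.+1 * 2 ^+ b.+1)) => n n0.
have nR : 0 < n%:R :> R by rewrite ltr0n.
have s0 : 0 < Num.sqrt n%:R :> R by rewrite sqrtr_gt0.
have s1 : 1 <= Num.sqrt n%:R :> R by rewrite -[leLHS]sqrtr1 ler_sqrt// ler1n.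
have sn : n%:R = Num.sqrt n%:R ^+ 2 :> R by rewrite sqr_sqrtr// ltW.
rewrite normrM ger0_norm ?mulr_ge0 ?invr_ge0 ?exprn_ge0 ?invr_ge0//.
apply: (@le_trans _ _ (n%:R^-1 * (Num.sqrt n%:R)^-1 ^+ k.+1 * (B k.+1 * (2 * n%:R) ^+ b.+1))).
  rewrite ler_wpM2l// ?mulr_ge0 ?invr_ge0 ?exprn_ge0 ?invr_ge0//.
  apply: (le_trans (pattern_sum_le (mP n) (fun p => pattern (circuit_label p) == kappa))).
  rewrite ler_wpM2l//.
  by rewrite -natrM -natrX ler_nat; exact: card_pattern_le.
pose j := (k.+1 - b * 2).-1; have kj : k.+1 = (2 * b + j.+1)%N by rewrite prednK; lia.
set s : R := Num.sqrt n%:R in s0 s1 sn *.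
have -> : n%:R^-1 * s^-1 ^+ k.+1 * (B k.+1 * (2 * n%:R) ^+ b.+1) =
    B k.+1 * 2 ^+ b.+1 * (n%:R^-1 * s^-1 ^+ k.+1 * n%:R ^+ b.+1) by rewrite exprMn; ring.
rewrite ler_wpM2l// ?mulr_ge0 ?exprn_ge0//.
have -> : n%:R^-1 * s^-1 ^+ k.+1 * n%:R ^+ b.+1 = s^-1 * s^-1 ^+ j.
  rewrite kj sn !exprVn exprD [s ^+ j.+1]exprS [(s ^+ 2) ^+ b.+1]exprS exprM.
  by field; rewrite !expf_neq0 ?gt_eqF.
by rewrite ler_piMr ?invr_ge0 ?exprn_ile1 ?invr_ge0 ?invf_le1// ltW.
Qed.
End OnePattern.

Lemma card_pclass_gt0 (E : finType) (kappa : {ffun E -> E}) r :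
  r \in reps kappa -> (0 < #|pclass kappa r|)%N.
Proof. by move=> rr; apply/card_gt0P; exists r; move: rr; rewrite !inE. Qed.

Definition is_pairing (E : finType) (kappa : {ffun E -> E}) :=
  (pattern kappa == kappa) && [forall r in reps kappa, #|pclass kappa r| == 2%N].

Lemma card_pairing (E : finType) (kappa : {ffun E -> E}) :
  is_pairing kappa -> (#|reps kappa| * 2 = #|E|)%N.
Proof.
move=> /andP[/eqP kK /forall_inP h]; rewrite -(sum_card_pclass kK).
by rewrite (eq_bigr (fun=> 2%N)) ?sum_nat_const// => r /h /eqP.
Qed.

(** All blocks have at least two elements and one of them has at least three. *)
Lemma sum_pclass_ge (E : finType) (kappa : {ffun E -> E}) : pattern kappa = kappa ->
  (forall r, r \in reps kappa -> (1 < #|pclass kappa r|)%N) ->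
  ~~ is_pairing kappa -> (#|reps kappa| * 2 < #|E|)%N.
Proof.
move=> kK h; rewrite /is_pairing kK eqxx /= negb_forall_in => /exists_inP[r rr r2].
rewrite -(sum_card_pclass kK) (bigD1 r)//= (cardD1 r) rr mulnDl mul1n.
have := h r rr => hr.
have : (\sum_(i in reps kappa | i != r) 2 <= \sum_(i in reps kappa | i != r) #|pclass kappa i|)%N.
  by apply: leq_sum => i /andP[ir _]; exact: h.
rewrite sum_nat_const.
have -> : #|[pred i in reps kappa | i != r]| = #|[predD1 mem (reps kappa) & r]|.
  by apply: eq_card => i; rewrite !inE andbC.
move=> hs; apply: leq_ltn_trans (leq_add (leqnn 2) hs) _; rewrite ltn_add2r ltn_neqAle eq_sym r2; exact: hr.
Qed.

(** The bound is 0 unless [kappa] is a pairing, so that only pairings enter the growth estimate of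
    the moments. *)
Lemma one_pattern_cvg (c : R) k (kappa : {ffun 'I_k.+1 -> 'I_k.+1}) : `|c| <= 1 ->
  exists v : R, `|v| <= (if is_pairing kappa then 2 ^+ #|reps kappa|.+1 else 0) /\
    forall cn B m, moment_family cn B m -> (cn n @[n --> \oo] --> c)%classic ->
    (n%:R^-1 * (Num.sqrt n%:R)^-1 ^+ k.+1 * pattern_sum kappa (m n) @[n --> \oo] --> v)%classic.
Proof.
move=> c1.
have [kK|kK] := eqVneq (pattern kappa) kappa; last first.
  exists 0; rewrite normr0; split; first by case: ifP => // _; rewrite exprn_ge0.
  move=> cn B m _ _; under eq_fun => n.
    rewrite /pattern_sum big_pred0 ?mulr0; first by over.
    move=> p; apply/negbTE; apply: contra kK => /eqP <-; rewrite pattern_idem//.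
  exact: cvg_cst.
case: (boolP (is_pairing kappa)) => kp.
  have [|v v1 hv] := @pattern_sum_pair_cvg _ kappa kK _ c1.
    by case/andP: kp => _ /forall_inP h r /h /eqP.
  exists v; split=> // cn B m hm hc.
  apply: cvg_trans (hv _ _ _ hm hc); apply: near_eq_cvg; near=> n.
  have n0 : 0 < n%:R :> R by rewrite ltr0n; near: n; exists 1%N.
  rewrite mulrC; congr (_ * _); rewrite exprS invfM exprVn; congr (_ * _^-1).
  have := card_pairing kp; rewrite [X in _ = X]card_ord mulnC => kE.
  rewrite -[RHS](congr1 (fun j => Num.sqrt n%:R ^+ j) kE).
  by rewrite exprM sqr_sqrtr// ltW.
exists 0; rewrite normr0; split=> // cn B m hm hc.
have [/existsP[r /andP[rr /eqP r1]]|] :=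
    boolP [exists r, (r \in reps kappa) && (#|pclass kappa r| == 1%N)].
  have z n : pattern_sum kappa (m n) = 0.
    by have [_ _ mP] := hm; apply: (pattern_sum_single (mP n)) rr r1.
  by under eq_fun do rewrite z mulr0; exact: cvg_cst.
rewrite negb_exists => /forallP h.
apply: (pattern_sum_cvg0 hm); rewrite -[X in (_ < X)%N]card_ord.
apply: sum_pclass_ge => // r rr; have := card_pclass_gt0 rr; have := h r; rewrite rr /=.
by case: #|_| => [|[|]].
Unshelve. all: by end_near.
Qed.

(** A pairing is given by the set of its [j] representatives, one of the [4 ^ j] subsets, and by the
    representative of each of the [j] other points. *)
Lemma card_pairings k j : k = (j * 2)%N ->
  (#|[set kappa : {ffun 'I_k -> 'I_k} | is_pairing kappa]| <= 4 ^ j * j ^ j)%N.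
Proof.
move=> kj; pose F (A : {set 'I_k}) (i : 'I_k) : {pred 'I_k} :=
  if i \in A then pred1 i else mem A.
pose G (A : {set 'I_k}) : {set {ffun 'I_k -> 'I_k}} :=
  if #|A| == j then [set kappa in family (F A)] else finset.set0.
have cG A : (#|G A| <= j ^ j)%N.
  rewrite /G; case: ifPn => [/eqP Aj|]; last by rewrite cards0.
  rewrite cardsE card_family.
  rewrite foldrE big_map big_enum /= (bigID (fun i => i \in A)) /=.
  rewrite big1 => [|i iA]; last by rewrite /F iA card1.
  rewrite mul1n (eq_bigr (fun=> j)) => [|i /negPf iA]; last by rewrite /F iA.
  rewrite prod_nat_const (_ : #|_| = j)//.
  have h1 : (#|A| + #|(~: A)%SET| = k)%N by rewrite cardsC card_ord.
  have h2 : #|fun i => i \notin A| = #|(~: A)%SET|.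
    by apply: eq_card => x; rewrite finset.in_setC.
  by rewrite h2; lia.
have sub : [set kappa : {ffun 'I_k -> 'I_k} | is_pairing kappa] \subset (\bigcup_A G A)%SET.
  apply/fintype.subsetP => kappa; rewrite inE => kp; apply/finset.bigcupP.
  exists (reps kappa) => //; have kr : #|reps kappa| == j.
    have := card_pairing kp; rewrite [X in _ = X]card_ord => h.
    by rewrite -(eqn_pmul2r (isT : 0 < 2)%N) h; apply/eqP.
  rewrite /G kr inE; apply/familyP => i.
  rewrite /F; case: ifPn => ir; first by move: ir; rewrite !inE.
  by rewrite !inE; case/andP: kp => /eqP <- _; rewrite patternKK.
apply: (leq_trans (subset_leq_card sub)); apply: (leq_trans (leq_card_bigcupset _)).
apply: (@leq_trans (\sum_(A : {set 'I_k}) j ^ j)%N).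
  by apply: leq_sum => A _.
rewrite sum_nat_const (_ : #|{: {set 'I_k}}| = 2 ^ k)%N.
  by rewrite kj mulnC [(j * 2)%N]mulnC expnM mulnC.
by rewrite -cardsT -powersetT card_powerset cardsT card_ord.
Qed.

Definition circuit_sum k n (m : seq ('I_n * 'I_n) -> R) : R :=
  \sum_(p : {ffun 'I_k.+1 -> 'I_n}) m (circuit_word p).

(** The bound multiplies the number [4 ^ j * j ^ j] of candidate pairings by the bound [2 ^+ j.+1]
    on each limit. *)
Theorem circuit_sum_cvg (c : R) k : `|c| <= 1 ->
  exists M : R, (forall j, k.+1 = (j * 2)%N -> `|M| <= 2 * 8 ^+ j * j%:R ^+ j) /\
    forall cn B m, moment_family cn B m -> (cn n @[n --> \oo] --> c)%classic ->
    (n%:R^-1 * (Num.sqrt n%:R)^-1 ^+ k.+1 * circuit_sum k (m n) @[n --> \oo] --> M)%classic.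
Proof.
move=> c1; have [v hv] := fin_all_exists (fun kappa => @one_pattern_cvg c k kappa c1).
exists (\sum_kappa v kappa); split.
  move=> j kj; apply: (le_trans (ler_norm_sum _ _ _)).
  apply: (@le_trans _ _ (\sum_(kappa : {ffun 'I_k.+1 -> 'I_k.+1} | is_pairing kappa) 2 ^+ j.+1)).
    rewrite [leRHS]big_mkcond; apply: ler_sum => kappa _.
    have [+ _] := hv kappa; case: ifPn => // kp; suff -> : #|reps kappa| = j by [].
    have := card_pairing kp; rewrite [X in _ = X]card_ord => h.
    by apply/eqP; rewrite -(eqn_pmul2r (isT : 0 < 2)%N) h; apply/eqP.
  rewrite (eq_bigl (fun kappa => kappa \in
      [set kappa : {ffun 'I_k.+1 -> 'I_k.+1} | is_pairing kappa])) => [|kappa]; last first.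
    by rewrite finset.in_set.
  rewrite sumr_const -[X in X <= _]mulr_natl.
  apply: (@le_trans _ _ ((4 ^ j * j ^ j)%:R * 2 ^+ j.+1)).
    by rewrite ler_wpM2r ?exprn_ge0// ler_nat; exact: card_pairings.
  rewrite natrM !natrX exprS (_ : 8 = 4 * 2) ?exprMn; last by rewrite -natrM.
  by rewrite le_eqVlt; apply/orP; left; apply/eqP; ring.
move=> cn B m hm hc.
have E n : circuit_sum k (m n) = \sum_(kappa : {ffun 'I_k.+1 -> 'I_k.+1}) pattern_sum kappa (m n).
  by rewrite /circuit_sum (partition_big (fun p => pattern (circuit_label p)) predT).
under eq_fun => n do rewrite E mulr_sumr.
apply: cvg_seq_sum => kappa; have [_ h] := hv kappa; exact: h hm hc.
Qed.
End CircuitSum.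

(** * The fourth centered moment *)

Section FourCircuits.
Variables (k n : nat).
Notation circuit := {ffun 'I_k.+1 -> 'I_n}.
Implicit Types (u v : {ffun 'I_4 -> circuit}).

Definition label4 u (e : 'I_4 * 'I_k.+1) : nat := circuit_label (u e.1) e.2.

Section OnePattern.
Variable kappa : {ffun 'I_4 * 'I_k.+1 -> 'I_4 * 'I_k.+1}.

Lemma label4_eq u e e' : pattern (label4 u) = kappa ->
  (label4 u e == label4 u e') = (kappa e == kappa e').
Proof. by move=> <-; rewrite pattern_eq. Qed.

Lemma label4K u e : pattern (label4 u) = kappa -> label4 u (kappa e) = label4 u e.
Proof. by move=> <-; rewrite patternK. Qed.

Lemma label4_step u v j i0 : u j ord0 = v j ord0 ->
  (forall i, i != i0 -> label4 u (j, i) = label4 v (j, i)) ->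
  forall i, label4 u (j, i) = label4 v (j, i).
Proof.
move=> h0 h i; have e := @circuit_det k (fun i => u j i : nat) (fun i => v j i : nat) i0 (congr1 val h0) h.
by rewrite /label4 /circuit_label /edge_label /=; congr addn; exact: e.
Qed.

(** Circuits are determined by starting points and labels, so counting them reduces to finding a
    small set [A] of edges whose labels determine all labels. *)
Lemma card_label4_le (A : {set 'I_4 * 'I_k.+1}) :
  (forall u v, pattern (label4 u) = kappa -> pattern (label4 v) = kappa ->
    (forall j, u j ord0 = v j ord0) -> {in A, label4 u =1 label4 v} ->
    label4 u =1 label4 v) ->
  (#|[set u : {ffun 'I_4 -> circuit} | pattern (label4 u) == kappa]|
    <= (2 * n) ^ (4 + #|A|))%N.
Proof.
move=> det.
pose D : finType := ('I_4 + {e | e \in A})%type.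
have cD : #|{: {ffun D -> 'I_(2 * n)}}| = ((2 * n) ^ (4 + #|A|))%N.
  by rewrite card_ffun card_sum !card_ord card_sig.
have lt (u : {ffun 'I_4 -> circuit}) (d : D) :
    ((match d with inl j => u j ord0 : nat | inr e => label4 u (val e) end) < 2 * n)%N.
  case: d => [j|e]; last exact: circuit_label_lt.
  exact: circuit_start_lt.
rewrite -cD.
apply: (@leq_card_in_inj _ _ _ (fun u => [ffun d => Ordinal (lt u d)])).
move=> u v; rewrite !finset.in_set => /eqP hu /eqP hv /ffunP uv.
have st j : u j ord0 = v j ord0.
  by apply/val_inj; have := uv (inl j); rewrite !ffunE => -[].
have lA : {in A, label4 u =1 label4 v}.
  by move=> e eA; have := uv (inr (exist _ e eA)); rewrite !ffunE => -[].
have l := det u v hu hv st lA.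
apply/ffunP => j; apply/ffunP => i; apply/val_inj.
exact: (@circuit_det k (fun i => u j i : nat) (fun i => v j i : nat) ord0
  (congr1 val (st j)) (fun i _ => l (j, i))).
Qed.

Lemma label4_reps u v e : pattern (label4 u) = kappa -> pattern (label4 v) = kappa ->
  label4 u (kappa e) = label4 v (kappa e) -> label4 u e = label4 v e.
Proof. by move=> hu hv; rewrite !label4K. Qed.

Lemma mem_pclass_seq (r : 'I_4 * 'I_k.+1) (s : seq ('I_4 * 'I_k.+1)) :
  uniq s -> all (fun e => kappa e == r) s -> (size s <= #|pclass kappa r|)%N.
Proof.
move=> us /allP h; rewrite -(card_uniqP us); apply: subset_leq_card.
by apply/fintype.subsetP => e /h; rewrite inE.
Qed.

Hypothesis kK : pattern kappa = kappa.
Hypothesis class2 : forall r, r \in reps kappa -> (1 < #|pclass kappa r|)%N.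
Hypothesis shared : forall j, exists i j' i', j' != j /\ kappa (j, i) = kappa (j', i').

Let kappaK e : kappa (kappa e) = kappa e.
Proof. by rewrite -kK patternKK. Qed.

Let kappa_reps e : kappa e \in reps kappa.
Proof. by rewrite inE kappaK. Qed.

Let sum_class : (\sum_(r in reps kappa) #|pclass kappa r| = 4 * k.+1)%N.
Proof. by rewrite sum_card_pclass// card_prod !card_ord. Qed.

Let sum_class_ge (A : {set 'I_4 * 'I_k.+1}) : A \subset reps kappa ->
  (2 * #|A| <= \sum_(r in A) #|pclass kappa r|)%N.
Proof.
move=> /fintype.subsetP sA; rewrite mulnC -sum_nat_const.
by apply: leq_sum => r /sA; exact: class2.
Qed.

(** The other blocks take at least two of the [4 * k.+1] edges each, so a large block leaves room
    for fewer blocks. *)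
Lemma reps4_sum1 r : r \in reps kappa ->
  (2 * #|reps kappa| + #|pclass kappa r| <= 4 * k.+1 + 2)%N.
Proof.
move=> rr; rewrite -sum_class (big_setD1 r)//= (cardsD1 r) rr.
have h := sum_class_ge (subsetDl (reps kappa) [set r]).
have aux a b c : (2 * a <= b -> 2 * (1 + a) + c <= c + b + 2)%N by lia.
exact: aux h.
Qed.

Lemma reps4_sum2 r r' : r \in reps kappa -> r' \in reps kappa -> r != r' ->
  (2 * #|reps kappa| + #|pclass kappa r| + #|pclass kappa r'| <= 4 * k.+1 + 4)%N.
Proof.
move=> rr rr' nr; have rr1 : r' \in (reps kappa :\ r)%SET by rewrite finset.in_setD1 eq_sym nr.
rewrite -sum_class (big_setD1 r)//= (big_setD1 r')//= (cardsD1 r) rr (cardsD1 r') rr1.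
have sub : ((reps kappa :\ r) :\ r')%SET \subset reps kappa.
  by rewrite (fintype.subset_trans (subsetDl _ _))// subsetDl.
have h := sum_class_ge sub.
have aux a b c d : (2 * a <= b -> 2 * (1 + (1 + a)) + c + d <= c + (d + b) + 4)%N by lia.
exact: aux h.
Qed.

Lemma third (j j' : 'I_4) : exists2 j'' : 'I_4, j'' != j & j'' != j'.
Proof.
have : (0 < #|~: [set j; j']|)%N.
  by rewrite cardsCs finset.setCK card_ord cards2; case: (_ != _).
by move=> /card_gt0P[x]; rewrite !inE negb_or => /andP[]; exists x.
Qed.

(* The four starting points and the at most [2 * k.+1] labels determine the circuits.
   Two labels can be spared: going around a circuit determines one of its labels
   from the others. *)
Lemma card_label4_pattern :
  (#|[set u : {ffun 'I_4 -> circuit} | pattern (label4 u) == kappa]|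
    <= (2 * n) ^ (2 * k.+1 + 2))%N.
Proof.
have [/eqP n0|n0] := posnP n.
  rewrite (_ : [set u | _] = finset.set0) ?cards0//; apply/setP => u; rewrite !inE.
  by have := leq_trans (ltn_ord (u ord0 ord0)) (eq_leq (eqP n0)).
suff [A Ale det] : exists2 A : {set 'I_4 * 'I_k.+1}, (#|A| + 2 <= 2 * k.+1)%N &
    forall u v, pattern (label4 u) = kappa -> pattern (label4 v) = kappa ->
    (forall j, u j ord0 = v j ord0) -> {in A, label4 u =1 label4 v} ->
    label4 u =1 label4 v.
  by apply: (leq_trans (card_label4_le det)); rewrite leq_pexp2l ?muln_gt0//; lia.
(* With two blocks fewer than the maximum [2 * k.+1], one edge of each block will do. *)
have [b2|b2] := leqP (#|reps kappa| + 2) (2 * k.+1).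
  exists (reps kappa) => // u v hu hv st lA e.
  by apply: label4_reps => //; exact: lA.
(* The block [r0] joins the circuits [ord0] and [j']; [r2] joins a circuit [j2] different from both
   to some [j3]. *)
have [i0 [j' [i' [j'0 e0]]]] := shared ord0.
have [j2 j20 j2j'] := third ord0 j'.
have [i2 [j3 [i3 [j32 e2]]]] := shared j2.
pose r0 := kappa (ord0, i0); pose r2 := kappa (j2, i2).
have rr0 : r0 \in reps kappa by exact: kappa_reps.
have rr2 : r2 \in reps kappa by exact: kappa_reps.
(* With the maximal number of blocks all blocks are pairs. Then [r0] and [r2] are known completely
   and both can be spared. *)
have [b1|b1] := leqP (2 * k.+1) #|reps kappa|.
  have two r e1 e1' e : r \in reps kappa -> kappa e1 = r -> kappa e1' = r ->
      e1 != e1' -> kappa e = r -> (e == e1) || (e == e1').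
    move=> rr h1 h1' n1 h; apply: contraLR b1 => /norP[ne ne'].
    have : (size [:: e; e1; e1'] <= #|pclass kappa r|)%N.
      apply: mem_pclass_seq; first by rewrite /= !inE negb_or ne ne' n1.
      by rewrite /= h h1 h1' !eqxx.
    by have := reps4_sum1 rr => /=; lia.
  have in0 e : kappa e = r0 -> (e == (ord0, i0)) || (e == (j', i')).
    by apply: two => //; rewrite xpair_eqE eq_sym (negPf j'0).
  have in2 e : kappa e = r2 -> (e == (j2, i2)) || (e == (j3, i3)).
    by apply: two => //; rewrite xpair_eqE eq_sym (negPf j32).
  have r02 : r2 != r0.
    by apply/eqP => /in0; rewrite !xpair_eqE (negPf j20) (negPf j2j').
  exists (reps kappa :\ r0 :\ r2)%SET.
    have := reps4_sum1 rr0; have := class2 rr0.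
    have aux (a b c d e : nat) : (a = 1 + b -> b = 1 + c -> 1 < d -> 2 * a + d <= 4 * e + 2 ->
      c + 2 <= 2 * e)%N by lia.
    have c0 := cardsD1 r0 (reps kappa); rewrite rr0 in c0.
    have c2 := cardsD1 r2 (reps kappa :\ r0)%SET; rewrite finset.in_setD1 r02 rr2 in c2.
    by move=> + +; exact: aux c0 c2.
  move=> u v hu hv st lA.
  have off e : kappa e != r0 -> kappa e != r2 -> label4 u e = label4 v e.
    move=> h0 h2; apply: label4_reps => //; apply: lA.
    by rewrite !finset.in_setD1 h0 h2 kappa_reps.
  (* The order matters: [j2] does not meet [r0], so going around it recovers [r2]; going around
     [ord0] then recovers [r0], even if [ord0] meets [r2]. *)
  have on2 e : kappa e = r2 -> label4 u e = label4 v e.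
    move=> he; have := @label4_step u v j2 i2 (st j2) _ i2.
    move=> H; apply: label4_reps => //; rewrite he !label4K//; apply: H => i ii.
    apply: off; apply/eqP.
      by move=> /in0; rewrite !xpair_eqE (negPf j20) (negPf j2j').
    by move=> /in2; rewrite !xpair_eqE (negPf ii) [j2 == j3]eq_sym (negPf j32) andbF.
  move=> e; case: (eqVneq (kappa e) r2) => [/on2//|he2].
  case: (eqVneq (kappa e) r0) => [he|he]; last exact: off.
  have := @label4_step u v ord0 i0 (st ord0) _ i0.
  move=> H; apply: label4_reps => //; rewrite he !label4K//; apply: H => i ii.
  case: (eqVneq (kappa (ord0, i)) r2) => [/on2//|hi2].
  apply: off => //; apply/eqP => /in0.
  by rewrite !xpair_eqE (negPf ii) [_ == j']eq_sym (negPf j'0) andbF.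
(* One block below the maximum a single label has to be spared. An edge whose label does not recur
   within its own circuit will do. *)
have bE : #|reps kappa|.+1 = (2 * k.+1)%N by lia.
have [/existsP[j /existsP[i /forall_inP h]]|] :=
  boolP [exists j, [exists i, [forall (i1 | i1 != i), kappa (j, i1) != kappa (j, i)]]].
  exists (reps kappa :\ kappa (j, i))%SET.
    have aux (a b e : nat) : (a = 1 + b -> a.+1 = 2 * e -> b + 2 <= 2 * e)%N by lia.
    by have c0 := cardsD1 (kappa (j, i)) (reps kappa); rewrite kappa_reps in c0; exact: aux c0 bE.
  move=> u v hu hv st lA.
  have off e : kappa e != kappa (j, i) -> label4 u e = label4 v e.
    move=> he; apply: label4_reps => //; apply: lA.
    by rewrite finset.in_setD1 he kappa_reps.
  move=> e; case: (eqVneq (kappa e) (kappa (j, i))) => [he|/off//].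
  apply: label4_reps => //; rewrite he !label4K//.
  by apply: (@label4_step u v j i (st j)) => i1 /h; exact: off.
(* Otherwise every label recurs within its circuit. Then [r0] and [r2] have at least four edges
   each, or at least six if they are equal; but the excess over pairs is only two in total. *)
rewrite negb_exists => /forallP h.
have twin j i : exists2 i1, i1 != i & kappa (j, i1) = kappa (j, i).
  have := h j; rewrite negb_exists => /forallP/(_ i).
  by rewrite negb_forall_in => /exists_inP[i1 n1]; rewrite negbK => /eqP; exists i1.
have [t0 nt0 ht0] := twin ord0 i0; have [t' nt' ht'] := twin j' i'.
have [t2 nt2 ht2] := twin j2 i2; have [t3 nt3 ht3] := twin j3 i3.
case: (eqVneq r2 r0) => r20.
  have := reps4_sum1 rr0.
  have : (size [:: (ord0, i0); (ord0, t0); (j', i'); (j', t'); (j2, i2); (j2, t2)]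
     <= #|pclass kappa r0|)%N.
    apply: mem_pclass_seq.
      rewrite /= !inE !xpair_eqE !eqxx /= ![ord0 == _]eq_sym ![j' == j2]eq_sym.
      by rewrite (negPf j'0) (negPf j20) (negPf j2j') /= [i0 == _]eq_sym [i' == _]eq_sym
        [i2 == _]eq_sym (negPf nt0) (negPf nt') (negPf nt2).
    by rewrite /= ht0 ht' ht2 -e0 -/r0 -/r2 r20 !eqxx.
  have aux a c e : (a.+1 = 2 * e -> 6 <= c -> 2 * a + c <= 4 * e + 2 -> False)%N by lia.
  by move=> /= h6 h2; case: (aux _ _ _ bE h6 h2).
have h4 j i j1 i1 t t1 : j1 != j -> kappa (j, i) = kappa (j1, i1) ->
  t != i -> kappa (j, t) = kappa (j, i) -> t1 != i1 -> kappa (j1, t1) = kappa (j1, i1) ->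
  (4 <= #|pclass kappa (kappa (j, i))|)%N.
  move=> nj e nt ht nt1 ht1.
  apply: (@mem_pclass_seq _ [:: (j, i); (j, t); (j1, i1); (j1, t1)]).
    rewrite /= !inE !xpair_eqE !eqxx /= ![j == _]eq_sym (negPf nj).
    by rewrite /= [i == _]eq_sym [i1 == _]eq_sym (negPf nt) (negPf nt1).
  by rewrite /= ht ht1 -e !eqxx.
have := reps4_sum2 rr0 rr2; rewrite eq_sym r20 => /(_ isT).
have := h4 _ _ _ _ _ _ j'0 e0 nt0 ht0 nt' ht'.
have := h4 _ _ _ _ _ _ j32 e2 nt2 ht2 nt3 ht3.
have aux a c d e : (a.+1 = 2 * e -> 4 <= c -> 4 <= d -> 2 * a + d + c <= 4 * e + 4 -> False)%N.
  by lia.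
by move=> h1 h2 h3; case: (aux _ _ _ _ bE h1 h2 h3).
Qed.
End OnePattern.
End FourCircuits.

(** * Cancellation in the fourth centered moment *)

Section CenteredMoment.
Variables (R : realType) (k n : nat) (cn : R) (B : nat -> R).
Variable m : seq ('I_n * 'I_n) -> R.
Hypothesis mP : moment_functional cn B m.
Hypothesis m_perm : forall w w', perm_eq w w' -> m w = m w'.
Hypothesis B0 : forall j, 0 <= B j.
Implicit Types (u : {ffun 'I_4 -> {ffun 'I_k.+1 -> 'I_n}}).

Definition words4 u (S : {set 'I_4}) := flatten [seq circuit_word (u j) | j <- enum S].

Definition centered_term u (S : {set 'I_4}) : R :=
  m (words4 u S) * \prod_(j in ~: S) (- m (circuit_word (u j))).

(* The expectation of [\prod_j (Y_j - E Y_j)], where [Y_j] is the product of the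
   entries along the circuit [u j]. *)
Definition centered_moment u : R := \sum_(S : {set 'I_4}) centered_term u S.

Definition centered_bound : R :=
  \sum_(S : {set 'I_4}) B (#|S| * k.+1)%N * B k.+1 ^+ #|~: S|.

Lemma size_words4 u (S : {set 'I_4}) : size (words4 u S) = (#|S| * k.+1)%N.
Proof.
rewrite size_flatten /shape -map_comp.
rewrite (eq_map (g := fun=> k.+1)) => [|j]; last by rewrite /= size_map size_enum_ord.
by rewrite cardE; elim: (enum S) => //= j s ->; rewrite mulSn.
Qed.

Lemma centered_moment_le u : `|centered_moment u| <= centered_bound.
Proof.
apply: (le_trans (ler_norm_sum _ _ _)); apply: ler_sum => S _.
rewrite normrM ler_pM//; first by rewrite -(size_words4 u); case: mP.
rewrite normr_prod -prodr_const; apply: ler_prod => j _.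
by rewrite normr_ge0 normrN (circuit_moment_le mP).
Qed.

(** Pairs the terms of an expanded product that differ only in the choice made at [j0]. *)
Lemma sum_set_split (I : finType) (j0 : I) (G : {set I} -> R) :
  \sum_(S : {set I}) G S = \sum_(S : {set I} | j0 \notin S) (G S + G (j0 |: S)%SET).
Proof.
rewrite (bigID (fun S : {set I} => j0 \notin S)) /= big_split /=; congr (_ + _).
rewrite (reindex_onto (fun S : {set I} => j0 |: S)%SET (fun S => S :\ j0)%SET) /=; last first.
  by move=> S; rewrite negbK => jS; rewrite finset.setD1K.
apply: eq_bigl => S; rewrite negbK finset.setU11 /=.
apply/eqP/idP => [<-|jS]; first by rewrite finset.setD11.
by rewrite finset.setU1K.
Qed.

Lemma words4_setU1 u j0 (S : {set 'I_4}) : j0 \notin S ->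
  perm_eq (words4 u (j0 |: S)%SET) (circuit_word (u j0) ++ words4 u S).
Proof.
move=> jS; rewrite /words4.
have -> : circuit_word (u j0) ++ flatten [seq circuit_word (u j) | j <- enum S] =
  flatten [seq circuit_word (u j) | j <- j0 :: enum S] by [].
apply: perm_flatten; apply: perm_map; apply: uniq_perm; rewrite ?enum_uniq//=.
  by rewrite mem_enum jS enum_uniq.
by move=> j; rewrite !(mem_enum, inE).
Qed.

Lemma centered_term_setU1 u j0 (S : {set 'I_4}) : j0 \notin S ->
  centered_term u (j0 |: S)%SET =
    m (circuit_word (u j0) ++ words4 u S) *
      \prod_(j in ~: (j0 |: S)%SET) (- m (circuit_word (u j))) /\
  centered_term u S = - m (words4 u S) * m (circuit_word (u j0)) *
      \prod_(j in ~: (j0 |: S)%SET) (- m (circuit_word (u j))).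
Proof.
move=> jS; split; first by rewrite /centered_term (m_perm (words4_setU1 u jS)).
rewrite /centered_term (big_setD1 j0) ?inE//=.
have -> : ((~: S) :\ j0 = ~: (j0 |: S))%SET.
  by apply/setP => j; rewrite !inE negb_or.
by rewrite mulrA mulrN -mulNr.
Qed.

Lemma mem_words4 u (S : {set 'I_4}) e : e \in words4 u S ->
  exists2 j, j \in S & exists i, e = circuit_edge (u j) i.
Proof.
case/flatten_mapP => j; rewrite mem_enum => jS /mapP[i _ ->].
by exists j => //; exists i.
Qed.

(** Paired terms cancel: the word of the circuit [u j0] shares no label with the others, so its
    moment factors out. *)
Lemma centered_moment_isolated u j0 :
  (forall i j i', j != j0 -> label4 u (j0, i) != label4 u (j, i')) ->
  centered_moment u = 0.
Proof.
move=> iso; rewrite /centered_moment (sum_set_split j0) big1// => S jS.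
have [-> ->] := centered_term_setU1 u jS.
rewrite (moment_cat mP); first by rewrite mulNr mulNr [m (words4 _ _) * _]mulrC addNr.
move=> e1 e2 /mapP[i _ ->] /mem_words4[j jS' [i' ->]].
by apply: iso; apply: contraNneq jS => <-.
Qed.

Lemma count_circuit_word (p : {ffun 'I_k.+1 -> 'I_n}) r :
  count (fun e => edge_label e == r) (circuit_word p) =
  #|[set i | circuit_label p i == r]|.
Proof.
rewrite count_map -size_filter -(card_uniqP (filter_uniq _ (enum_uniq _))).
by apply: eq_card => i; rewrite mem_filter mem_enum andbT inE.
Qed.

(** Here both terms of a pair vanish, as each contains the mean of a single entry. *)
Lemma centered_moment_single u j0 i0 :
  (forall j i, (j, i) != (j0, i0) -> label4 u (j, i) != label4 u (j0, i0)) ->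
  centered_moment u = 0.
Proof.
move=> uni; rewrite /centered_moment (sum_set_split j0) big1// => S jS.
have [-> ->] := centered_term_setU1 u jS.
pose r := label4 u (j0, i0).
have c1 : count (fun e => edge_label e == r) (circuit_word (u j0)) = 1%N.
  rewrite count_circuit_word (_ : [set i | _] = [set i0]) ?cards1//.
  apply/setP => i; rewrite !inE; apply/idP/eqP => [|->]; last exact: eqxx.
  by apply: contraTeq => ii; apply: (uni j0 i); rewrite xpair_eqE eqxx.
have c0 : count (fun e => edge_label e == r) (words4 u S) = 0%N.
  apply/eqP; rewrite -[_ == _]negbK -lt0n -has_count; apply/hasPn => e /mem_words4[j jS' [i ->]].
  apply: (uni j i); rewrite xpair_eqE; apply/nandP; left.
  by apply: contraNneq jS => <-.
rewrite (@moment_single _ _ _ _ _ mP (circuit_word (u j0) ++ words4 u S) r) ?count_cat ?c1 ?c0//.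
by rewrite (moment_single mP (r := r) c1) mulr0 !mul0r addr0.
Qed.

(** The patterns that survive the two vanishing lemmas satisfy the hypotheses of
    [card_label4_pattern]. Against the normalization n^(-4 - 2(k+1)) of the fourth power, this
    leaves O(n^(-2)). *)
Lemma centered_sum_le :
  `|\sum_u centered_moment u| <=
     #|{: {ffun 'I_4 * 'I_k.+1 -> 'I_4 * 'I_k.+1}}|%:R *
      (centered_bound * (2 * n)%:R ^+ (2 * k.+1 + 2)).
Proof.
have cb0 : 0 <= centered_bound.
  by apply: sumr_ge0 => S _; rewrite mulr_ge0// exprn_ge0.
rewrite (partition_big (fun u => pattern (label4 u)) predT)//=.
apply: (le_trans (ler_norm_sum _ _ _)).
rewrite mulr_natl -sumr_const; apply: ler_sum => kappa _.
have [kK|kK] := eqVneq (pattern kappa) kappa; last first.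
  rewrite big_pred0 ?normr0 ?mulr_ge0 ?exprn_ge0// => u.
  by apply/negbTE; apply: contra kK => /eqP <-; rewrite pattern_idem.
have [/existsP[[j0 i0] /andP[r rr]]|] :=
    boolP [exists r, (r \in reps kappa) && (#|pclass kappa r| == 1%N)].
  rewrite big1 ?normr0 ?mulr_ge0 ?exprn_ge0// => u /eqP uk.
  apply: (@centered_moment_single _ j0 i0) => j i; apply: contra => h.
  have := label4_eq (j, i) (j0, i0) uk; rewrite h => /esym/eqP.
  move: r; rewrite inE => /eqP kr; rewrite kr => kj.
  move: rr => /cards1P[x /setP px].
  by have := px (j, i); have := px (j0, i0); rewrite !inE kj kr eqxx => /esym/eqP -> /esym.
rewrite negb_exists => /forallP h1.
have [/existsP[j0 /forallP iso]|] := boolP [exists j0, [forall i, [forall j, [forall i',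
    (j != j0) ==> (kappa (j0, i) != kappa (j, i'))]]]].
  rewrite big1 ?normr0 ?mulr_ge0 ?exprn_ge0// => u /eqP uk.
  apply: (@centered_moment_isolated _ j0) => i j i' jj.
  rewrite (label4_eq _ _ uk).
  by have /forallP/(_ j)/forallP/(_ i')/implyP/(_ jj) := iso i.
rewrite negb_exists => /forallP h2.
apply: (@le_trans _ _ (\sum_(u | pattern (label4 u) == kappa) centered_bound)).
  by apply: (le_trans (ler_norm_sum _ _ _)); apply: ler_sum => u _; exact: centered_moment_le.
rewrite (eq_bigl (fun u => u \in
  [set u : {ffun 'I_4 -> {ffun 'I_k.+1 -> 'I_n}} | pattern (label4 u) == kappa])) => [|u].
  rewrite sumr_const -[leLHS]mulr_natr ler_wpM2l// -natrX ler_nat.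
  apply: card_label4_pattern => // [r rr|j].
    have := h1 r; rewrite rr /=; have := card_pclass_gt0 rr.
    by case: #|_| => [|[|]].
  have := h2 j; rewrite negb_forall => /existsP[i1].
  rewrite negb_forall => /existsP[j']; rewrite negb_forall => /existsP[i'].
  by rewrite negb_imply negbK => /andP[jj /eqP e]; exists i1, j', i'.
by rewrite finset.in_set.
Qed.

End CenteredMoment.

(** * Spectra and traces of symmetric matrices *)

Section Similar.
Variables (F : comUnitRingType) (n : nat) (P D : 'M[F]_n).
Hypothesis Pu : P \in unitmx.

Lemma expmx_similar j : (invmx P *m D *m P) ^+ j = invmx P *m D ^+ j *m P.
Proof.
elim: j => [|j IH]; first by rewrite !expr0 mulmx1 mulVmx.
rewrite !exprS IH -!mulmxE !mulmxA; congr (_ *m _ *m _).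
by rewrite -[invmx P *m D *m P *m invmx P]mulmxA mulmxV// mulmx1.
Qed.

Lemma trace_similar j : \tr ((invmx P *m D *m P) ^+ j) = \tr (D ^+ j).
Proof. by rewrite expmx_similar mxtrace_mulC mulmxA mulmxV// mul1mx. Qed.

Lemma char_poly_similar : char_poly (invmx P *m D *m P) = char_poly D.
Proof.
rewrite /char_poly /char_poly_mx.
set Q := map_mx polyC P; set Q' := map_mx polyC (invmx P).
have QQ : Q' *m Q = 1%:M by rewrite -map_mxM mulVmx// map_mx1.
have -> : 'X%:M - map_mx polyC (invmx P *m D *m P) =
    Q' *m ('X%:M - map_mx polyC D) *m Q.
  rewrite mulmxBr mulmxBl !map_mxM; congr (_ - _).
  by rewrite scalar_mxC -mulmxA QQ mulmx1.
by rewrite !det_mulmx mulrAC -det_mulmx QQ det1 mul1r.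
Qed.
End Similar.

Lemma expmx_diag (F : comNzRingType) n (d : 'rV[F]_n) j :
  diag_mx d ^+ j = diag_mx (\row_i d 0 i ^+ j).
Proof.
elim: j => [|j IH].
  by rewrite expr0; apply/matrixP => i k; rewrite !mxE expr0.
rewrite exprS IH -mulmxE mulmx_diag; congr diag_mx.
by apply/rowP => i; rewrite !mxE exprS.
Qed.

Section SymmetricSpectrum.
Variables (R : rcfType) (n : nat) (A : 'M[R]_n).
Hypothesis symA : A^T = A.

(** The spectral theorem is applied to [A] as a complex hermitian matrix. Its eigenvalues are real,
    and both identities descend because the embedding of [R] is injective. *)
Lemma symmetric_spectrum : exists2 s : seq R, size s = n &
  char_poly A = \prod_(x <- s) ('X - x%:P) /\
  forall j, \tr (A ^+ j) = \sum_(x <- s) x ^+ j.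
Proof.
pose iota : {rmorphism R -> complex R} := real_complex R.
pose A' := map_mx iota A.
have hermA : A' \is hermsymmx.
  apply/is_hermitianmxP; rewrite expr0 scale1r; apply/matrixP => i j; rewrite !mxE.
  by rewrite -[A in RHS]symA mxE; apply/esym/CrealP/complex_realP; exists (A i j).
have /orthomx_spectralP AE := hermitian_normalmx hermA.
set P := spectralmx A' in AE; set d := spectral_diag A' in AE.
have Pu : P \in unitmx by exact: spectral_unit.
have dr : forall i, exists x, d 0 i = iota x.
  move=> i; have /mxOverP/(_ 0 i) := hermitian_spectral_diag_real hermA.
  by move/complex_realP.
have [x xE] := fin_all_exists dr.
exists [seq x i | i <- enum 'I_n]; first by rewrite size_map size_enum_ord.
split.
  apply: (map_inj_poly (f := iota)); [exact: fmorph_inj|exact: rmorph0|].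
  rewrite map_char_poly -/A' AE char_poly_similar// char_poly_trig ?diag_mx_is_trig//.
  rewrite big_map big_enum rmorph_prod; apply: eq_bigr => i _ /=.
  by rewrite rmorphB /= map_polyX map_polyC mxE eqxx mulr1n xE.
move=> j; apply: (fmorph_inj iota).
have tr_map (M : 'M[R]_n) : iota (\tr M) = \tr (map_mx iota M).
  by rewrite rmorph_sum; apply: eq_bigr => i _; rewrite mxE.
have map_exp i : map_mx iota (A ^+ i) = A' ^+ i.
  elim: i => [|i IH]; first by rewrite !expr0 map_mx1.
  by rewrite !exprS -!mulmxE map_mxM IH.
rewrite tr_map map_exp AE trace_similar// expmx_diag big_map big_enum rmorph_sum.
by apply: eq_bigr => i _; rewrite !mxE eqxx mulr1n xE -rmorphXn.
Qed.

(** Both sequences list each real number with its multiplicity as a root of the characteristic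
    polynomial. *)
Lemma perm_eigenvalues (s : seq R) : char_poly A = \prod_(x <- s) ('X - x%:P) ->
  perm_eq (eigenvalues A) s.
Proof.
move=> cE; have c0 : char_poly A != 0 by rewrite monic_neq0// char_poly_monic.
apply/allP => x _; apply/eqP; rewrite /eigenvalues.
have mu y : mup y (char_poly A) = count_mem y s by rewrite cE mu_prod_XsubC.
rewrite count_flatten -map_comp.
have rootE : (x \in rootsR (char_poly A)) = root (char_poly A) x.
  by have /roots_onP/(_ x) := roots_on_rootsR c0; rewrite in_itv /= => ->.
have uR : uniq (rootsR (char_poly A)) by exact: uniq_roots.
transitivity (if x \in rootsR (char_poly A) then mup x (char_poly A) else 0%N); last first.
  rewrite mu; case: ifPn => //; rewrite rootE => /mupNroot; rewrite mu => ->//.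
elim: (rootsR _) uR => //= y r IH /andP[yr ur]; rewrite IH// count_nseq in_cons [x == y]eq_sym /=.
case: (eqVneq y x) yr => [->|_] /= yr; last by rewrite mul0n.
by rewrite (negPf yr) mul1n addn0.
Qed.

Lemma size_eigenvalues : size (eigenvalues A) = n.
Proof.
by have [s sn [cE _]] := symmetric_spectrum; rewrite (perm_size (perm_eigenvalues cE)).
Qed.

Lemma trace_eigenvalues j : \tr (A ^+ j) = \sum_(x <- eigenvalues A) x ^+ j.
Proof.
have [s sn [cE tE]] := symmetric_spectrum.
by rewrite tE (perm_big _ (perm_eigenvalues cE)).
Qed.
End SymmetricSpectrum.

(** * Traces of powers as sums over circuits *)

Section TraceCircuit.
Variable R : comNzRingType.

Lemma big_tuple_cons (n k : nat) (F : k.+1.-tuple 'I_n -> R) :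
  \sum_(t : k.+1.-tuple 'I_n) F t = \sum_(x : 'I_n) \sum_(t : k.-tuple 'I_n) F [tuple of x :: t].
Proof.
rewrite pair_big /=.
rewrite (reindex (fun xt : 'I_n * k.-tuple 'I_n => [tuple of xt.1 :: xt.2])) //=.
exists (fun t => (thead t, [tuple of behead t])) => [[x t]|t] _ /=.
  by congr pair; apply/val_inj.
by rewrite -tuple_eta.
Qed.

Definition walk_prod n (A : 'M[R]_n) (x y : 'I_n) (s : seq 'I_n) : R :=
  \prod_(e <- zip (x :: s) (rcons s y)) A e.1 e.2.

Lemma expmx_walk n (A : 'M[R]_n) k x y :
  (A ^+ k.+1) x y = \sum_(t : k.-tuple 'I_n) walk_prod A x y t.
Proof.
elim: k x => [|k IH] x.
  rewrite expr1 (big_pred1 [tuple]) => [|t]; last by apply/esym/eqP; exact: tuple0.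
  by rewrite /walk_prod /= big_cons big_nil mulr1.
rewrite exprS -mulmxE mxE big_tuple_cons; apply: eq_bigr => z _.
rewrite IH mulr_sumr; apply: eq_bigr => t _.
by rewrite /walk_prod /= big_cons.
Qed.

(** Matches the rotation that closes a tuple into a circuit with the cyclic successor [ordS]. *)
Lemma rot1_enum_ord k : rot 1 (enum 'I_k.+1) = map (@ordS k.+1) (enum 'I_k.+1).
Proof.
apply: (inj_map val_inj); rewrite -map_comp map_rot val_enum_ord /=.
rewrite (eq_map (g := (fun j => j.+1 %% k.+1)%N \o val)) // map_comp val_enum_ord.
have -> : map (fun j => j.+1 %% k.+1)%N (iota 0 k.+1) = map (fun j => j.+1 %% k.+1)%N (iota 0 k) ++ [:: 0%N].
  by rewrite -[in LHS](addn1 k) iotaD map_cat /= add0n addn1 modnn.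
rewrite /rot /= drop0 take0; congr (_ ++ _).
rewrite -[1%N]addn0 iotaDl; apply/eq_in_map => j.
by rewrite mem_iota add0n => /andP[_ jk]; rewrite add1n modn_small.
Qed.

Lemma trace_circuit n (A : 'M[R]_n) k :
  \tr (A ^+ k.+1) = \sum_(p : {ffun 'I_k.+1 -> 'I_n}) \prod_(e <- circuit_word p) A e.1 e.2.
Proof.
transitivity (\sum_(t : k.+1.-tuple 'I_n) \prod_(e <- zip t (rot 1 t)) A e.1 e.2).
  rewrite big_tuple_cons; apply: eq_bigr => x _; rewrite expmx_walk.
  by apply: eq_bigr => t _; rewrite /= rot1_cons.
rewrite (reindex (fun p : {ffun 'I_k.+1 -> 'I_n} => [tuple p i | i < k.+1])) /=; last first.
  exists (fun t : k.+1.-tuple 'I_n => [ffun i => tnth t i]) => [p|t] _.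
    by apply/ffunP => i; rewrite ffunE tnth_mktuple.
  by apply: eq_from_tnth => i; rewrite tnth_mktuple ffunE.
apply: eq_bigr => p _; congr (\big[_/_]_(_ <- _) _).
rewrite -map_rot rot1_enum_ord -map_comp /circuit_word.
by elim: (enum _) => //= i s ->.
Qed.
End TraceCircuit.

(** * Expectation and independence *)

Section Expectation.
Local Open Scope classical_set_scope.
Context d (T : measurableType d) (R : realType) (P : probability T R).
Implicit Types f g h : T -> R.

Definition rint f := P.-integrable setT (EFin \o f).
Definition Ex f : R := (\int[P]_x f x)%R.

Lemma rint_meas f : rint f -> measurable_fun setT f.
Proof. by move=> /integrableP[/measurable_EFinP]. Qed.

Lemma rint_le f g : measurable_fun setT f -> rint g -> (forall x, `|f x| <= g x) -> rint f.
Proof.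
move=> mf ig fg; apply: (le_integrable _ _ _ ig) => //.
  exact/measurable_EFinP.
by move=> x _; rewrite /= lee_fin (le_trans (fg x))// ler_norm.
Qed.

Lemma rint_cst (c : R) : rint (fun=> c).
Proof. exact: finite_measure_integrable_cst. Qed.

Lemma rintD f g : rint f -> rint g -> rint (fun x => f x + g x).
Proof. by move=> fi gi; exact: (integrableD measurableT fi gi). Qed.

Lemma rintZ (c : R) f : rint f -> rint (fun x => c * f x).
Proof. by move=> fi; exact: (integrableZl measurableT c fi). Qed.

Lemma rint_abs f : rint f -> rint (fun x => `|f x|).
Proof. by move=> fi; exact: (integrable_abse fi). Qed.

Lemma rint_sum (I : Type) (r : seq I) (Q : pred I) (F : I -> T -> R) :
  (forall i, rint (F i)) -> rint (fun x => \sum_(i <- r | Q i) F i x).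
Proof.
move=> iF; elim: r => [|i r IH].
  by under eq_fun do rewrite big_nil; exact: rint_cst.
under eq_fun do rewrite big_cons.
by case: (Q i) => //; exact: rintD.
Qed.

Lemma Ex_cst (c : R) : Ex (fun=> c) = c.
Proof. by rewrite /Ex /Rintegral integral_cst//= probability_setT mule1. Qed.

Lemma ExD f g : rint f -> rint g -> Ex (fun x => f x + g x) = Ex f + Ex g.
Proof. by move=> fi gi; exact: RintegralD. Qed.

Lemma ExZ (c : R) f : rint f -> Ex (fun x => c * f x) = c * Ex f.
Proof. by move=> fi; exact: RintegralZl. Qed.

Lemma ExB f g : rint f -> rint g -> Ex (fun x => f x - g x) = Ex f - Ex g.
Proof. by move=> fi gi; exact: RintegralB. Qed.

Lemma Ex_sum (I : Type) (r : seq I) (Q : pred I) (F : I -> T -> R) :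
  (forall i, rint (F i)) ->
  Ex (fun x => \sum_(i <- r | Q i) F i x) = \sum_(i <- r | Q i) Ex (F i).
Proof.
move=> iF; elim: r => [|i r IH].
  by under eq_fun do rewrite big_nil; rewrite big_nil Ex_cst.
under eq_fun do rewrite big_cons; rewrite big_cons.
by case: (Q i) => //; rewrite ExD ?IH//; exact: rint_sum.
Qed.

Lemma Ex_le f g : rint f -> rint g -> (forall x, f x <= g x) -> Ex f <= Ex g.
Proof. by move=> fi gi fg; apply: le_Rintegral => // x _. Qed.

Lemma Ex_norm_le f g : rint f -> rint g -> (forall x, `|f x| <= g x) -> `|Ex f| <= Ex g.
Proof.
move=> fi gi fg; apply: (le_trans (le_normr_Rintegral measurableT fi)).
by apply: Ex_le => //; exact: rint_abs.
Qed.

Lemma Ex_indic (A : set T) : measurable A -> Ex \1_A = fine (P A).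
Proof. by move=> mA; rewrite /Ex /Rintegral integral_indic// setIT. Qed.

Lemma rint_indic (A : set T) : measurable A -> rint \1_A.
Proof.
move=> mA; apply: (rint_le _ (rint_cst 1)) => [|x]; first exact: measurable_indic.
by rewrite indicE normr_nat; case: (_ \in _).
Qed.

Lemma ExE f : rint f -> (Ex f)%:E = (\int[P]_x (f x)%:E)%E.
Proof. by move=> fi; rewrite /Ex /Rintegral fineK// integrable_fin_num. Qed.

Lemma Ex_dominated (F : nat -> T -> R) f g : (forall n, measurable_fun setT (F n)) ->
  measurable_fun setT f -> rint g -> (forall n x, `|F n x| <= g x) ->
  (forall x, F n x @[n --> \oo] --> f x) -> Ex (F n) @[n --> \oo] --> Ex f.
Proof.
move=> mF mf gi Fg Ff.
have fi : rint f.
  apply: (rint_le mf gi) => x; have c : `|F n x| @[n --> \oo] --> `|f x| by exact: (cvg_norm (Ff x)).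
  rewrite -(cvg_lim _ c)//; apply: limr_le; first by apply/cvg_ex; exists `|f x|.
  by apply: nearW => n; exact: Fg.
have [|||||_ _ h] := @dominated_convergence _ _ _ P setT measurableT
    (fun n => EFin \o F n) (EFin \o f) (EFin \o g).
- by move=> n; exact/measurable_EFinP.
- exact/measurable_EFinP.
- by apply: nearW => x _; apply: cvg_EFin; [exact: nearW|exact: Ff].
- exact: gi.
- by apply: nearW => x n _; rewrite /= lee_fin.
have Fi n : rint (F n) by apply: (rint_le (mF n) gi).
apply: fine_cvg; rewrite fineK ?integrable_fin_num//.
Qed.

(** Unlike integrability, this property is stable under products. *)
Definition all_moments f := measurable_fun setT f /\ forall k, rint (fun x => f x ^+ k).

Lemma am_meas f : all_moments f -> measurable_fun setT f. Proof. by case. Qed.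

Lemma am_rint f : all_moments f -> rint f.
Proof. by case=> _ /(_ 1%N); under eq_fun do rewrite expr1. Qed.

Lemma am_cst c : all_moments (fun=> c).
Proof. by split=> // k; exact: rint_cst. Qed.

Lemma am_expr_norm f k : all_moments f -> rint (fun x => `|f x| ^+ k).
Proof.
by case=> _ /(_ k) /rint_abs; under eq_fun do rewrite normrX.
Qed.

Lemma am_le f g : measurable_fun setT f -> all_moments g -> (forall x, `|f x| <= `|g x|) ->
  all_moments f.
Proof.
move=> mf gm fg; split=> // k; apply: (rint_le _ (am_expr_norm k gm)).
  exact: measurable_funX.
by move=> x; rewrite normrX lerXn2r ?nnegrE.
Qed.

(** The [k]-th power of the product is dominated by [|f|^(2k) + |g|^(2k)]. *)
Lemma am_mul f g : all_moments f -> all_moments g -> all_moments (fun x => f x * g x).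
Proof.
move=> fm gm; have mfg : measurable_fun setT (fun x => f x * g x).
  by apply: measurable_funM; apply: am_meas.
split=> // k.
apply: (rint_le (measurable_funX k mfg) (rintD (am_expr_norm (k + k) fm) (am_expr_norm (k + k) gm))).
move=> x; rewrite exprMn normrM !normrX !exprD.
have [h|h] := leP (`|f x| ^+ k) (`|g x| ^+ k).
  by rewrite (le_trans (ler_wpM2r _ h)) ?exprn_ge0// lerDr mulr_ge0 ?exprn_ge0.
by rewrite (le_trans (ler_wpM2l _ (ltW h))) ?exprn_ge0// lerDl mulr_ge0 ?exprn_ge0.
Qed.

Lemma am_add f g : all_moments f -> all_moments g -> all_moments (fun x => f x + g x).
Proof.
move=> fm gm; have mfg : measurable_fun setT (fun x => f x + g x).
  by apply: measurable_funD; apply: am_meas.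
split=> // k.
apply: (rint_le (measurable_funX k mfg)
  (rintZ (2 ^+ k) (rintD (am_expr_norm k fm) (am_expr_norm k gm)))).
move=> x; rewrite normrX.
have [h|h] := leP `|f x| `|g x|.
  apply: (@le_trans _ _ ((2 * `|g x|) ^+ k)).
    by rewrite lerXn2r ?nnegrE ?mulr_ge0// (le_trans (ler_normD _ _))// mulr2n mulrDl !mul1r lerD2r.
  by rewrite exprMn ler_wpM2l ?exprn_ge0// lerDr exprn_ge0.
apply: (@le_trans _ _ ((2 * `|f x|) ^+ k)).
  by rewrite lerXn2r ?nnegrE ?mulr_ge0// (le_trans (ler_normD _ _))// mulr2n mulrDl !mul1r lerD2l ltW.
by rewrite exprMn ler_wpM2l ?exprn_ge0// lerDl exprn_ge0.
Qed.

Lemma am_prod (I : Type) (r : seq I) (F : I -> T -> R) : (forall i, all_moments (F i)) ->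
  all_moments (fun x => \prod_(i <- r) F i x).
Proof.
move=> Fm; elim: r => [|i r IH].
  by under eq_fun do rewrite big_nil; exact: am_cst.
by under eq_fun do rewrite big_cons; exact: am_mul.
Qed.

Lemma am_sum (I : Type) (r : seq I) (F : I -> T -> R) : (forall i, all_moments (F i)) ->
  all_moments (fun x => \sum_(i <- r) F i x).
Proof.
move=> Fm; elim: r => [|i r IH].
  by under eq_fun do rewrite big_nil; exact: am_cst.
by under eq_fun do rewrite big_cons; exact: am_add.
Qed.

Lemma am_indic (A : set T) : measurable A -> all_moments \1_A.
Proof.
move=> mA; apply: (am_le (g := fun=> 1)) (am_cst 1) _ => [|x]; first exact: measurable_indic.
by rewrite indicE normr1 normr_nat; case: (_ \in _).
Qed.

End Expectation.

Section Independence.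
Local Open Scope classical_set_scope.
Context d (T : measurableType d) (R : realType) (P : probability T R).
Implicit Types f g h : T -> R.

(** For nonnegative [f] this rounds [f] down to a multiple of 1/(N+1) and truncates it at N+1. As a
    combination of indicators of level sets, it involves only events of the sigma-algebra of [f]. *)
Definition staircase f N (x : T) : R :=
  \sum_(j < N.+1 ^ 2) N.+1%:R^-1 * \1_[set y | j.+1%:R / N.+1%:R <= f y] x.

Lemma staircaseE f N x : 0 <= f x ->
  staircase f N x = N.+1%:R^-1 * (minn (Num.truncn (N.+1%:R * f x)) (N.+1 ^ 2))%:R.
Proof.
move=> f0; rewrite /staircase -mulr_sumr; congr (_ * _).
have y0 : 0 <= N.+1%:R * f x by rewrite mulr_ge0.
elim: (N.+1 ^ 2)%N => [|M IH]; first by rewrite big_ord0 minn0.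
rewrite big_ord_recr /= IH indicE.
have -> : (x \in [set y | M.+1%:R / N.+1%:R <= f y]) = (M < Num.truncn (N.+1%:R * f x))%N.
  rewrite truncn_gt_nat -ler_pdivrMl//.
  by apply/idP/idP; rewrite inE /= mulrC.
case: ltnP => hM.
  by rewrite (minn_idPr hM) -natr1.
by rewrite (minn_idPl (leqW hM)) addr0.
Qed.

Lemma staircase_le f N x : 0 <= f x -> 0 <= staircase f N x <= f x.
Proof.
move=> f0; rewrite staircaseE// mulr_ge0//= ?invr_ge0// ler_pdivrMl//.
apply: (@le_trans _ _ (Num.truncn (N.+1%:R * f x))%:R).
  by rewrite ler_nat geq_minl.
by rewrite truncn_le mulr_ge0.
Qed.

Lemma staircase_cvg f x : 0 <= f x -> staircase f N x @[N --> \oo] --> f x.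
Proof.
move=> f0; apply/cvgrPdist_le => e e0; near=> N.
have NR : 0 < N.+1%:R :> R by [].
have fN : f x <= N.+1%:R.
  apply: (@le_trans _ _ (Num.truncn (f x)).+1%:R); first exact/ltW/truncnS_gt.
  by rewrite ler_nat ltnS; near: N; exact: nbhs_infty_ge.
have eN : N.+1%:R^-1 <= e.
  rewrite invf_ple ?posrE//; apply: (@le_trans _ _ (Num.truncn e^-1).+1%:R).
    exact/ltW/truncnS_gt.
  by rewrite ler_nat ltnS; near: N; exact: nbhs_infty_ge.
have /andP[_ h] := staircase_le N f0.
rewrite ger0_norm ?subr_ge0//; apply: le_trans eN.
rewrite staircaseE// (minn_idPl _); last first.
  have : (Num.truncn (N.+1%:R * f x))%:R <= (N.+1 ^ 2)%:R :> R.
    apply: (@le_trans _ _ (N.+1%:R * f x)); first by rewrite truncn_le mulr_ge0.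
    by rewrite natrX expr2 ler_wpM2l.
  by rewrite ler_nat.
have h2 := ltW (truncnS_gt (N.+1%:R * f x)).
rewrite lerBlDr -[X in X + _]mulr1 -mulrDr ler_pdivlMl// nat1r; exact: h2.
Unshelve. all: by end_near.
Qed.

Variable G : set (set T).
Hypothesis GT : G `<=` measurable.

(** Measurability with respect to a set of events, while [T] keeps its own measurable structure. *)
Definition Gmeas f := forall B : set R, measurable B -> G (f @^-1` B).

Lemma staircase_set f (c : R) : Gmeas f -> G [set y | c <= f y].
Proof.
move=> Gf; rewrite (_ : [set y | _] = f @^-1` `[c, +oo[); first by apply: Gf; exact: measurable_itv.
by apply/seteqP; split=> y /=; rewrite in_itv/= andbT.
Qed.

(** By linearity the identity passes from indicators to staircases, then to [f] by dominated
    convergence. *)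
Lemma Ex_factor_ge0 f g : Gmeas f -> (forall x, 0 <= f x) ->
  all_moments P f -> all_moments P g ->
  (forall A, G A -> Ex P (fun x => \1_A x * g x) = Ex P \1_A * Ex P g) ->
  Ex P (fun x => f x * g x) = Ex P f * Ex P g.
Proof.
move=> Gf f0 fm gm h.
have stm N : all_moments P (staircase f N).
  apply: am_sum => j; apply: am_mul; first exact: am_cst.
  exact/am_indic/GT/staircase_set.
have E N : Ex P (fun x => staircase f N x * g x) = Ex P (staircase f N) * Ex P g.
  rewrite [in RHS]/staircase Ex_sum; last first.
    move=> j; apply/rintZ/rint_indic/GT/staircase_set => //.
  rewrite mulr_suml.
  under [in LHS]eq_fun do rewrite /staircase mulr_suml.
  rewrite Ex_sum; last first.
    move=> j; apply/am_rint/am_mul => //; apply: am_mul; first exact: am_cst.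
    exact/am_indic/GT/staircase_set.
  apply: eq_bigr => j _; rewrite ExZ; last exact/rint_indic/GT/staircase_set.
  under eq_fun do rewrite -mulrA.
  rewrite ExZ; last by apply/am_rint/am_mul => //; exact/am_indic/GT/staircase_set.
  by rewrite h ?mulrA//; exact: staircase_set.
have c1 : Ex P (fun x => staircase f N x * g x) @[N --> \oo] --> Ex P (fun x => f x * g x).
  apply: (Ex_dominated (g := fun x => `|f x * g x|)).
  - by move=> N; exact: (am_meas (am_mul (stm N) gm)).
  - exact: (am_meas (am_mul fm gm)).
  - exact: (rint_abs (am_rint (am_mul fm gm))).
  - move=> N x; rewrite !normrM ler_wpM2r//.
    by have /andP[s0 s1] := staircase_le N (f0 x); rewrite !ger0_norm.
  - by move=> x; apply: cvgMr_tmp; exact: staircase_cvg.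
have c2 : Ex P (staircase f N) @[N --> \oo] --> Ex P f.
  apply: (Ex_dominated (g := f)).
  - by move=> N; exact: (am_meas (stm N)).
  - exact: (am_meas fm).
  - exact: (am_rint fm).
  - by move=> N x; have /andP[s0 s1] := staircase_le N (f0 x); rewrite ger0_norm.
  - by move=> x; exact: staircase_cvg.
have c3 : Ex P (staircase f N) * Ex P g @[N --> \oo] --> Ex P f * Ex P g by exact: cvgMr_tmp.
have c4 : Ex P (fun x => staircase f N x * g x) @[N --> \oo] --> Ex P f * Ex P g.
  by under eq_fun do rewrite E.
exact: (cvg_unique _ c1 c4).
Qed.

Lemma Gmeas_max f : Gmeas f -> Gmeas (fun x => Num.max (f x) 0).
Proof.
move=> Gf B mB; have mm : measurable_fun setT (fun y : R => Num.max y 0).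
  by apply: measurable_maxr.
rewrite (_ : _ @^-1` B = f @^-1` ((fun y : R => Num.max y 0) @^-1` B))//.
by apply: Gf; rewrite -[X in measurable X]setTI; exact: mm.
Qed.

Lemma Gmeas_opp f : Gmeas f -> Gmeas (fun x => - f x).
Proof.
move=> Gf B mB; have mm : measurable_fun setT (fun y : R => - y) by exact: oppr_measurable.
rewrite (_ : _ @^-1` B = f @^-1` ((fun y : R => - y) @^-1` B))//.
by apply: Gf; rewrite -[X in measurable X]setTI; exact: mm.
Qed.

Lemma am_max f : all_moments P f -> all_moments P (fun x => Num.max (f x) 0).
Proof.
move=> fm; apply: (am_le _ fm) => [|x].
  by apply: measurable_maxr => //; exact: am_meas fm.
by case: (leP (f x) 0) => // _; rewrite normr0.
Qed.

Lemma am_opp f : all_moments P f -> all_moments P (fun x => - f x).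
Proof.
by move=> fm; under eq_fun do rewrite -mulN1r; apply: am_mul => //; exact: am_cst.
Qed.

Lemma Ex_factor f g : Gmeas f -> all_moments P f -> all_moments P g ->
  (forall A, G A -> Ex P (fun x => \1_A x * g x) = Ex P \1_A * Ex P g) ->
  Ex P (fun x => f x * g x) = Ex P f * Ex P g.
Proof.
move=> Gf fm gm h.
pose fp x := Num.max (f x) 0; pose fn x := Num.max (- f x) 0.
have fE x : f x = fp x - fn x.
  rewrite /fp /fn; case: (leP (f x) 0) => f0.
    by rewrite max_l ?oppr_ge0// sub0r opprK.
  by rewrite max_r ?subr0// oppr_le0 ltW.
have [pm nm] : all_moments P fp /\ all_moments P fn.
  by split; apply: am_max => //; exact: am_opp.
have hp : Ex P (fun x => fp x * g x) = Ex P fp * Ex P g.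
  apply: Ex_factor_ge0 => //; first exact: Gmeas_max.
  by move=> x; rewrite /fp le_max lexx orbT.
have hn : Ex P (fun x => fn x * g x) = Ex P fn * Ex P g.
  apply: Ex_factor_ge0 => //; first exact/Gmeas_max/Gmeas_opp.
  by move=> x; rewrite /fn le_max lexx orbT.
have -> : Ex P f = Ex P fp - Ex P fn.
  by rewrite -ExB; [congr Ex; apply/funext => x; exact: fE|exact: am_rint|exact: am_rint].
under eq_fun do rewrite fE mulrBl.
by rewrite ExB ?hp ?hn ?mulrBl//; apply/am_rint/am_mul.
Qed.

End Independence.

Section IndependentFamilies.
Local Open Scope classical_set_scope.
Context d (T : measurableType d) (R : realType) (P : probability T R).

Lemma Gmeas_gen (G0 : set (set T)) (f : T -> R) :
  Gmeas <<s G0 >> f <-> measurable_fun setT (f : g_sigma_algebraType G0 -> R).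
Proof.
split=> [Gf _ B mB|mf B mB]; first by rewrite setTI; exact: Gf.
by rewrite -[X in <<s _ >> X]setTI; exact: mf.
Qed.

Lemma Gmeas_mul (G0 : set (set T)) (f g : T -> R) :
  Gmeas <<s G0 >> f -> Gmeas <<s G0 >> g -> Gmeas <<s G0 >> (fun x => f x * g x).
Proof.
move=> /Gmeas_gen mf /Gmeas_gen mg; apply/Gmeas_gen.
exact: measurable_funM.
Qed.

Lemma Gmeas_cst (G0 : set (set T)) (c : R) : Gmeas <<s G0 >> (fun=> c).
Proof. by apply/Gmeas_gen; exact: measurable_cst. Qed.

Lemma Gmeas_prod (G0 : set (set T)) (I : eqType) (s : seq I) (f : I -> T -> R) :
  (forall i, i \in s -> Gmeas <<s G0 >> (f i)) -> Gmeas <<s G0 >> (fun x => \prod_(i <- s) f i x).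
Proof.
elim: s => [|i s IH] h.
  by under eq_fun do rewrite big_nil; exact: Gmeas_cst.
under eq_fun do rewrite big_cons; apply: Gmeas_mul; first by apply: h; rewrite mem_head.
by apply: IH => j js; apply: h; rewrite inE js orbT.
Qed.

Variables (K : choiceType) (D : set K) (F : K -> set (set T)).
Hypothesis FT : forall r, F r `<=` measurable.
Hypothesis indep : independent_sigma_algebras P D F.

Lemma indep_Ex_indic (s : seq K) (E : K -> set T) : uniq s -> [set` s] `<=` D ->
  (forall r, F r (E r)) ->
  Ex P (fun x => \prod_(r <- s) \1_(E r) x) = \prod_(r <- s) Ex P \1_(E r).
Proof.
move=> us sD FE.
have mE r : measurable (E r) by exact/FT/FE.
pose A := \bigcap_(r in [set` s]) E r.
have mA : measurable A by apply: fin_bigcap_measurable => // *; exact: mE.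
have -> : (fun x => \prod_(r <- s) \1_(E r) x) = \1_A :> (T -> R).
  apply/funext => x; rewrite /A !indicE.
  have [xA|xA] := boolP (x \in _).
    move/set_mem in xA; rewrite big_seq big1// => r rs; rewrite indicE mem_set//.
    exact: xA.
  have [r rs xr] : exists2 r, r \in s & ~ E r x.
    apply: contrapT => h; move/negP: xA; apply; apply/mem_set => r /= rs.
    by apply: contrapT => xr; apply: h; exists r.
  by rewrite (big_rem r rs)/= indicE memNset// mul0r.
rewrite Ex_indic//.
pose J := [fset r in s]%fset.
have JE : [set` J] = [set` s] by apply/seteqP; split=> r /=; rewrite !inE.
have := indep (J := J) (E := E); rewrite JE => /(_ sD (fun r _ => FE r)) => h.
rewrite /A h.
rewrite (perm_big s) /=; last first.
  by apply: uniq_perm => // r; rewrite !inE.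
rewrite (eq_bigr (fun r => (Ex P \1_(E r))%:E)) => [|r _]; last first.
  by rewrite Ex_indic// fineK// fin_num_measure.
by rewrite -(big_morph EFin EFinM erefl).
Qed.

(** Events are traded for functions one index at a time. For [r] an arbitrary event [A] of [F r] is
    allowed first, by induction with [E] redefined at [r]; [Ex_factor] then lifts the identity from
    [A] to [f r]. *)
Lemma indep_Ex_mixed (s1 s2 : seq K) (E : K -> set T) (f : K -> T -> R) :
  uniq (s1 ++ s2) -> [set` s1 ++ s2] `<=` D -> (forall r, F r (E r)) ->
  (forall r, Gmeas (F r) (f r)) -> (forall r, all_moments P (f r)) ->
  Ex P (fun x => (\prod_(r <- s1) f r x) * \prod_(r <- s2) \1_(E r) x) =
  (\prod_(r <- s1) Ex P (f r)) * \prod_(r <- s2) Ex P \1_(E r).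
Proof.
move=> + + + Gf fm; elim: s1 s2 E => [|r s1 IH] s2 E us sD FE.
  rewrite big_nil mul1r -indep_Ex_indic//.
  by congr Ex; apply/funext => x; rewrite big_nil mul1r.
have mE k : measurable (E k) by exact/FT/FE.
move: us; rewrite /= mem_cat negb_or => /andP[/andP[rs1 rs2] us].
pose g x := (\prod_(r <- s1) f r x) * \prod_(r <- s2) \1_(E r) x : R.
have gm : all_moments P g.
  by apply: am_mul; apply: am_prod => // k; exact: am_indic.
have Eg : Ex P g = (\prod_(r <- s1) Ex P (f r)) * \prod_(r <- s2) Ex P \1_(E r).
  by apply: IH => // k ks; apply: sD => /=; rewrite inE -[k \in _]/(k \in s1 ++ s2) ks orbT.
rewrite big_cons -mulrA -Eg -(@Ex_factor _ _ _ P (F r) (fun A => @FT r A)) //; last first.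
  move=> A FA; pose E' k := if k == r then A else E k.
  have e2 (h : set T -> R) : \prod_(k <- s2) h (E' k) = \prod_(k <- s2) h (E k).
    rewrite big_seq [RHS]big_seq; apply: eq_bigr => k ks.
    by rewrite /E'; case: eqP ks rs2 => // -> ->.
  have E'r : E' r = A by rewrite /E' eqxx.
  have := IH (r :: s2) E'; rewrite big_cons (e2 (fun A => Ex P \1_A)) E'r => h.
  rewrite Eg mulrCA -h.
  - congr Ex; apply/funext => x; rewrite big_cons E'r /g.
    by rewrite (e2 (fun A => \1_A x)) mulrCA.
  - by rewrite (perm_uniq (_ : perm_eq _ (r :: s1 ++ s2))) /= ?mem_cat ?negb_or ?rs1 ?rs2//
      perm_catC /= perm_cons perm_catC.
  - by move=> k /= ks; apply: sD => /=; move: ks; rewrite !(inE, mem_cat) orbCA.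
  - by move=> k; rewrite /E'; case: eqP => [->|].
by congr Ex; apply/funext => x; rewrite big_cons /g mulrA.
Qed.

Lemma indep_Ex_prod (s : seq K) (f : K -> T -> R) : uniq s -> [set` s] `<=` D ->
  (forall r, Gmeas (F r) (f r)) -> (forall r, all_moments P (f r)) ->
  (forall r, F r set0) ->
  Ex P (fun x => \prod_(r <- s) f r x) = \prod_(r <- s) Ex P (f r).
Proof.
move=> us sD Gf fm F0.
have := @indep_Ex_mixed s [::] (fun=> set0) f; rewrite cats0 big_nil mulr1 => <-//.
by congr Ex; apply/funext => x; rewrite big_nil mulr1.
Qed.

End IndependentFamilies.

(** * Moments of the array *)

Lemma norm_prod_le (R : realDomainType) (s : seq R) (b : R) :
  (forall x, x \in s -> `|x| <= b) -> `|\prod_(x <- s) x| <= b ^+ size s.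
Proof.
elim: s => [|x s IH] h; first by rewrite big_nil normr1 expr0.
rewrite big_cons normrM exprS ler_pM//; first by rewrite h// mem_head.
by apply: IH => y ys; apply: h; rewrite inE ys orbT.
Qed.

Lemma seq_max_norm (R : realDomainType) (s : seq R) : s != [::] ->
  exists2 M, M \in s & forall x, x \in s -> `|x| <= `|M|.
Proof.
elim: s => // x s IH _; have [->|/IH[M Ms h]] := eqVneq s [::].
  by exists x; [exact: mem_head|move=> y; rewrite inE => /eqP->].
have [xM|Mx] := leP `|x| `|M|.
  exists M; first by rewrite inE Ms orbT.
  by move=> y; rewrite inE => /predU1P[->//|]; exact: h.
exists x; first exact: mem_head.
by move=> y; rewrite inE => /predU1P[->//|/h/le_trans]; apply; exact: ltW.
Qed.

(** The factor of largest modulus dominates the product, so moments of order [size s] of the single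
    factors suffice. The summand 1 takes care of the empty product. *)
Lemma norm_prod_le_sum (R : realDomainType) (s : seq R) :
  `|\prod_(x <- s) x| <= 1 + \sum_(x <- s) `|x| ^+ size s.
Proof.
have [->|/seq_max_norm[M Ms h]] := eqVneq s [::].
  by rewrite !big_nil normr1 addr0.
apply: (le_trans (norm_prod_le h)).
rewrite (big_rem M Ms) /=; apply: (@le_trans _ _ (`|M| ^+ size s + \sum_(y <- rem M s) `|y| ^+ size s)).
  by rewrite lerDl; apply: sumr_ge0 => y _; rewrite exprn_ge0.
by rewrite lerDr.
Qed.

Lemma prod_by_key (R : comNzRingType) (I : Type) (K : eqType) (key : I -> K) (w : seq I)
    (J : seq K) (F : I -> R) : uniq J -> all (fun e => key e \in J) w ->
  \prod_(e <- w) F e = \prod_(r <- J) \prod_(e <- [seq e <- w | key e == r]) F e.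
Proof.
move=> uJ wJ; under [RHS]eq_bigr do rewrite big_filter.
elim: w wJ => [|e w IH] /=.
  by move=> _; rewrite big_nil big1// => r _; rewrite big_nil.
move=> /andP[eJ wJ]; rewrite big_cons IH//.
rewrite (bigD1_seq (key e))//= [in RHS](bigD1_seq (key e))//= big_cons eqxx mulrA.
congr (_ * _); apply: eq_bigr => r re.
by rewrite big_cons eq_sym (negPf re).
Qed.

Section ArrayMoments.
Local Open Scope classical_set_scope.
Context d (T : measurableType d) (R : realType) (P : probability T R).
Variable a : array P.

Definition entry_word n (w : seq ('I_n * 'I_n)) (x : T) : R := \prod_(e <- w) entry a e.1 e.2 x.
Definition word_moment n (w : seq ('I_n * 'I_n)) : R := Ex P (entry_word w).

Lemma entryC n (p q : 'I_n) : entry a p q = entry a q p.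
Proof.
rewrite /entry; case: (ltngtP p q) => //= pq.
by have -> : p = q by exact: val_inj.
Qed.

Lemma entry_wlog n (Q : {RV P >-> R} -> Prop) :
  (forall p q : 'I_n, (p <= q)%N -> Q (entry a p q)) -> forall p q : 'I_n, Q (entry a p q).
Proof. by move=> h p q; case: (leqP p q) => [/h//|/ltnW/h]; rewrite entryC. Qed.

Hypothesis a2 : condA2 a.

Definition entry_bound k : R := `|fine (moment_sup a k)|.

Lemma entry_moment_le n k (p q : 'I_n) :
  rint P (fun x => `|entry a p q x| ^+ k) /\ Ex P (fun x => `|entry a p q x| ^+ k) <= entry_bound k.
Proof.
move: p q; apply: (@entry_wlog n (fun e => rint P (fun x => `|e x| ^+ k) /\
  Ex P (fun x => `|e x| ^+ k) <= entry_bound k)) => p q pq.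
have mf : measurable_fun setT (fun x => `|entry a p q x| ^+ k).
  by apply/measurable_funX/measurableT_comp => //; exact: measurable_funP.
have hle : (\int[P]_x (`|entry a p q x| ^+ k)%:E <= moment_sup a k)%E.
  by apply: ereal_sup_ubound; exists n, p, q; rewrite pq unlock.
have ir : rint P (fun x => `|entry a p q x| ^+ k).
  apply/integrableP; split; first exact/measurable_EFinP.
  apply: le_lt_trans (a2 k); apply: le_trans hle; rewrite le_eqVlt; apply/orP; left; apply/eqP.
  by apply: eq_integral => x _ /=; rewrite ger0_norm// exprn_ge0.
split=> //; rewrite -lee_fin ExE//; apply: (le_trans hle).
have fm : moment_sup a k \is a fin_num.
  rewrite fin_numElt a2 andbT; apply: lt_le_trans hle.
  by apply: (@lt_le_trans _ _ 0%E) => //; apply: integral_ge0 => x _; rewrite lee_fin exprn_ge0.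
by rewrite -[leLHS]fineK// lee_fin ler_norm.
Qed.

Lemma entry_am n (p q : 'I_n) : all_moments P (entry a p q).
Proof.
split=> [|k]; first exact: measurable_funP.
have [h _] := entry_moment_le k p q.
apply: (rint_le _ h) => [|x]; first exact/measurable_funX/measurable_funP.
by rewrite normrX.
Qed.

Lemma entry_word_am n (w : seq ('I_n * 'I_n)) : all_moments P (entry_word w).
Proof. by apply: am_prod => e; exact: entry_am. Qed.

Definition word_bound k : R := 1 + k%:R * entry_bound k.

Lemma word_bound_ge0 k : 0 <= word_bound k.
Proof. by rewrite addr_ge0// mulr_ge0// normr_ge0. Qed.

Lemma word_moment_le n (w : seq ('I_n * 'I_n)) : `|word_moment w| <= word_bound (size w).
Proof.
pose g x := 1 + \sum_(e <- w) `|entry a e.1 e.2 x| ^+ size w.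
have gi : rint P (fun x => \sum_(e <- w) `|entry a e.1 e.2 x| ^+ size w).
  by apply: rint_sum => e; exact: (entry_moment_le _ _ _).1.
apply: (le_trans (Ex_norm_le (g := g) _ _ _)).
- exact/am_rint/entry_word_am.
- by apply: rintD => //; exact: rint_cst.
- move=> x; rewrite /entry_word -(big_map (fun e => entry a e.1 e.2 x) xpredT id).
  by apply: (le_trans (norm_prod_le_sum _)); rewrite size_map big_map.
rewrite ExD//; last exact: rint_cst.
rewrite Ex_cst lerD2l Ex_sum; last by move=> e; exact: (entry_moment_le _ _ _).1.
rewrite -sum1_size natr_sum mulr_suml [leRHS]big_seq [leLHS]big_seq.
by apply: ler_sum => e _; rewrite mul1r sum1_size; exact: (entry_moment_le _ _ _).2.
Qed.

Lemma word_moment_perm n (w w' : seq ('I_n * 'I_n)) : perm_eq w w' ->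
  word_moment w = word_moment w'.
Proof. by move=> ww; congr Ex; apply/funext => x; exact: perm_big. Qed.

Hypothesis a3 : condA3 a.

(** The shift by 2 turns the 0-based label [p + q] into the index of its antidiagonal in (A3). *)
Lemma entry_Gmeas n (p q : 'I_n) :
  Gmeas (antidiagonal_sigma_algebra a n (p + q).+2) (entry a p q).
Proof.
move: p q; suff h (p q : 'I_n) : (p <= q)%N ->
    Gmeas (antidiagonal_sigma_algebra a n (p + q).+2) (entry a p q).
  by move=> p q; case: (leqP p q) => [/h//|/ltnW/h]; rewrite addnC entryC.
move=> pq B mB; apply: sub_gen_smallest; exists (p, q) => /=.
  by rewrite pq addSn addnS.
by exists B => //; rewrite setTI.
Qed.

Lemma word_moment_factor n (w : seq ('I_n * 'I_n)) (J : seq nat) : uniq J ->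
  all (fun e => edge_label e \in J) w ->
  word_moment w = \prod_(r <- J) word_moment [seq e <- w | edge_label e == r].
Proof.
move=> uJ /allP wJ.
(* (A3) speaks of indices up to [n.*2] only. Larger members of [J] label no edge and contribute the
   factor 1. *)
pose J' := [seq r <- J | (r.+2 <= n.*2)%N].
have lab_lt (e : 'I_n * 'I_n) : ((edge_label e).+2 <= n.*2)%N.
  by rewrite /edge_label -addnn; have := ltn_ord e.1; have := ltn_ord e.2; lia.
have -> : \prod_(r <- J) word_moment [seq e <- w | edge_label e == r] =
    \prod_(r <- J') word_moment [seq e <- w | edge_label e == r].
  rewrite big_filter [RHS]big_mkcond; apply: eq_bigr => r _; case: ifPn => // rn.
  rewrite (_ : [seq e <- w | _] = [::]) /word_moment /entry_word.
    by under eq_fun do rewrite big_nil; rewrite Ex_cst.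
  apply/eqP; rewrite -[_ == _]negbK -has_filter; apply/hasPn => e _.
  by apply: contra rn => /eqP <-.
pose f r x := entry_word [seq e <- w | (edge_label e).+2 == r] x.
pose F := antidiagonal_sigma_algebra a n.
have FT r : F r `<=` measurable.
  apply: smallest_sub; first exact: sigma_algebra_measurable.
  move=> A [[p q] /= _ [B mB <-]]; apply: measurableI => //.
  by rewrite -[X in measurable X]setTI; exact: measurable_funP.
have F0 r : F r set0.
  rewrite /F /antidiagonal_sigma_algebra; set G := (X in <<s X >>).
  by case: (smallest_sigma_algebra setT G).
have us : uniq [seq r.+2 | r <- J'].
  by rewrite map_inj_uniq ?filter_uniq// => ? ? [].
have sD : [set` [seq r.+2 | r <- J']] `<=` [set r | (2 <= r <= n.*2)%N].
  by move=> r /= /mapP[r']; rewrite mem_filter => /andP[rn _] ->.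
have Gf r : Gmeas (F r) (f r).
  apply: Gmeas_prod => e; rewrite mem_filter => /andP[/eqP <- _].
  exact: entry_Gmeas.
have fm r : all_moments P (f r) by exact: entry_word_am.
have := indep_Ex_prod FT (@a3 n) us sD Gf fm F0.
rewrite big_map => <-; congr Ex; apply/funext => x; rewrite big_map /entry_word.
rewrite (@prod_by_key _ _ _ (@edge_label n) w J' _ (filter_uniq _ uJ))//.
by apply/allP => e ew; rewrite mem_filter lab_lt wJ.
Qed.

Hypothesis a1 : condA1 a.

Lemma word_moment1 n (e : 'I_n * 'I_n) : word_moment [:: e] = 0.
Proof.
have h (p q : 'I_n) : Ex P (entry a p q) = 0.
  move: p q; apply: (@entry_wlog n (fun e => Ex P e = 0)) => p q pq.
  by have [h _] := a1 pq; move: h; rewrite unlock /Ex /Rintegral => ->.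
rewrite -[RHS](h e.1 e.2); congr Ex; apply/funext => x.
by rewrite /entry_word big_seq1.
Qed.

Lemma entry_var n (p q : 'I_n) : Ex P (fun x => entry a p q x * entry a p q x) = 1.
Proof.
move: p q; apply: (@entry_wlog n (fun e => Ex P (fun x => e x * e x) = 1)) => p q pq.
by have [_ h] := a1 pq; move: h; rewrite unlock /Ex /Rintegral => ->.
Qed.

Lemma entry_word2 n (e e' : 'I_n * 'I_n) :
  entry_word [:: e; e'] = (fun x => entry a e.1 e.2 x * entry a e'.1 e'.2 x).
Proof. by apply/funext => x; rewrite /entry_word big_cons big_seq1. Qed.

Lemma entry_cov n (p q p' q' : 'I_n) :
  covariance P (entry a p q) (entry a p' q') =
  (Ex P (fun x => entry a p q x * entry a p' q' x))%:E.
Proof.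
have h (e : 'I_n * 'I_n) : fine ('E_P[entry a e.1 e.2]) = 0.
  have := word_moment1 e; rewrite /word_moment /Ex /Rintegral unlock => <-.
  by congr fine; apply: eq_integral => x _; rewrite /entry_word big_seq1.
rewrite unlock /covariance (h (p, q)) (h (p', q')) unlock ExE; last first.
  by apply/am_rint/am_mul; exact: entry_am.
by apply: eq_integral => x _; rewrite !fctE /= !subr0.
Qed.

Variable c : R.
Hypothesis c2 : condC2 a c.

Lemma array_moment_family : exists cn : nat -> R,
  moment_family cn word_bound word_moment /\ cn n @[n --> \oo] --> c.
Proof.
have [cn hcn cnc] := c2.
(* For [n <= 2] (C2) does not constrain [cn n], which may exceed 1. *)
exists (fun n => if (2 < n)%N then cn n else 0); split; last first.
  apply: cvg_trans cnc; apply: near_eq_cvg; near=> n.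
  have -> // : (2 < n)%N by near: n; exact: nbhs_infty_ge.
split; first exact: word_bound_ge0.
  move=> n; case: ifPn => n2; last by rewrite normr0.
  case: n n2 => [|[|[|n]]]// _.
  (* For three or more rows the positions (0, 2) and (1, 1) have equal labels and realize [cn] as a
     covariance; |X Y| <= (X^2 + Y^2)/2 then bounds it by 1. *)
  pose i0 : 'I_n.+3 := inord 0; pose i1 : 'I_n.+3 := inord 1; pose i2 : 'I_n.+3 := inord 2.
  have ie : (i0 + i2 = i1 + i1)%N by rewrite !inordK.
  have ne : (i0, i2) \notin [:: (i1, i1); (i1, i1)].
    by rewrite !inE !xpair_eqE -!val_eqE /= !inordK.
  have := hcn _ _ _ _ _ ie ne; rewrite entry_cov => h.
  have {h} <- : Ex P (fun x => entry a i0 i2 x * entry a i1 i1 x) = cn n.+3.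
    by apply: EFin_inj; rewrite h.
  set X := entry a _ _; set Y := entry a _ _.
  have [Xm Ym] : all_moments P X /\ all_moments P Y by split; exact: entry_am.
  have XX : rint P (fun x => X x * X x) by exact/am_rint/am_mul.
  have YY : rint P (fun x => Y x * Y x) by exact/am_rint/am_mul.
  have -> : 1 = Ex P (fun x => 2^-1 * (X x * X x + Y x * Y x)).
    rewrite ExZ; last exact: rintD.
    by rewrite ExD// !entry_var; field.
  apply: Ex_norm_le; first exact/am_rint/am_mul.
    by apply: rintZ; exact: rintD.
  have sq (y : R) : y * y = `|y| ^+ 2 by rewrite real_normK ?num_real// expr2.
  move=> x; rewrite normrM !sq.
  move: (sqr_ge0 (`|X x| - `|Y x|)); rewrite sqrrB.
  by move: (`|X x|) (`|Y x|) => u v; lra.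
move=> n; split.
- exact: word_moment_factor.
- exact: word_moment1.
- exact: word_moment_le.
- move=> e e' ee'; case: ifPn => [/orP[|]/eqP h|].
  + by rewrite /word_moment entry_word2 h entry_var.
  + by rewrite /word_moment entry_word2 h /= entryC entry_var.
  move=> /norP[h1 h2]; case: ifPn => n2.
    have := @hcn n e.1 e.2 e'.1 e'.2 ee'.
    rewrite entry_cov -!surjective_pairing !inE negb_or h1 h2 => /(_ isT) [<-].
    by rewrite /word_moment entry_word2.
  (* For at most two rows, edges with equal labels coincide up to reversal. *)
  exfalso; move: h1 h2 ee'; case: e => p q; case: e' => p' q'.
  rewrite /edge_label !xpair_eqE -!val_eqE /=.
  have := ltn_ord p; have := ltn_ord q; have := ltn_ord p'; have := ltn_ord q'.
  by lia.
Unshelve. all: by end_near.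
Qed.

End ArrayMoments.

(** * Almost sure convergence of the normalized traces *)

Section AlmostSure.
Local Open Scope classical_set_scope.
Context d (T : measurableType d) (R : realType) (P : probability T R).

Lemma ae_forall_nat (Q : nat -> T -> Prop) :
  (forall k, {ae P, forall x, Q k x}) -> {ae P, forall x, forall k, Q k x}.
Proof.
move=> h; apply: (@negligibleS _ _ _ P (\bigcup_k (~` [set x | Q k x]))).
  by move=> x /= /existsNP[k nQ]; exists k.
by apply: negligible_bigcup => k; exact: h.
Qed.

(** The series of the [W n] has a finite integral, hence is finite almost everywhere, and there its
    terms tend to 0. *)
Lemma ae_cvg0 (W : nat -> T -> R) (K : R) : (forall n, rint P (W n)) ->
  (forall n x, 0 <= W n x) -> (forall N, \sum_(n < N) Ex P (W n) <= K) ->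
  {ae P, forall x, W n x @[n --> \oo] --> 0}.
Proof.
move=> Wi W0 WK.
pose F x := (\sum_(n <oo) (W n x)%:E)%E.
have mW n : measurable_fun setT (fun x => (W n x)%:E).
  exact/measurable_EFinP/(rint_meas (Wi n)).
have F0 x : (0 <= F x)%E by apply: nneseries_ge0 => n _ _; rewrite lee_fin.
have Fi : P.-integrable setT F.
  apply/integrableP; split.
    by apply: ge0_emeasurable_sum => // n x _ _; rewrite lee_fin.
  under eq_integral do rewrite gee0_abs//.
  rewrite integral_nneseries//; last by move=> n x _; rewrite lee_fin.
  apply: (@le_lt_trans _ _ K%:E); last exact: ltry.
  apply: lime_le; first by apply: is_cvg_nneseries => n _ _; apply: integral_ge0 => x _; rewrite lee_fin.
  apply: nearW => N; rewrite big_mkord.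
  by under eq_bigr do rewrite -ExE//; rewrite sumEFin lee_fin.
have := integrable_ae measurableT Fi; apply: filterS => x /(_ I) Fx.
apply: cvg_series_cvg_0; apply: nondecreasing_is_cvgn.
  by apply: nondecreasing_series => n _ _.
exists (fine (F x)) => _ [N _ <-].
rewrite -lee_fin fineK// /series /= -sumEFin.
by apply: nneseries_lim_ge => n _ _; rewrite lee_fin.
Qed.

(** Telescopes through 1/(u+1)^2 <= 1/u - 1/(u+1). The term of index 0 is 0, the inverse of 0 being
    0. *)
Lemma sum_invsq N : \sum_(n < N) (n%:R ^+ 2)^-1 <= 2 :> R.
Proof.
suff h M : \sum_(n < M.+2) (n%:R ^+ 2)^-1 <= 2 - M.+1%:R^-1 :> R.
  apply: (@le_trans _ _ (\sum_(n < N.+2) (n%:R ^+ 2)^-1)).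
    by rewrite !big_ord_recr /= -addrA lerDl addr_ge0// invr_ge0 exprn_ge0.
  by apply: (le_trans (h N)); rewrite gerBl invr_ge0.
elim: M => [|M IH].
  rewrite !big_ord_recr big_ord0 /= expr0n invr0 expr1n invr1; lra.
rewrite big_ord_recr /=; apply: (le_trans (lerD IH (lexx _))).
rewrite -addrA lerD2l lerNr opprD opprK.
have M1 : 0 < M.+1%:R :> R by [].
have M2 : M.+2%:R = M.+1%:R + 1 :> R by rewrite natr1.
rewrite M2; move: (M.+1%:R) M1 => u u0.
rewrite -subr_ge0.
have -> : u^-1 - ((u + 1) ^+ 2)^-1 - (u + 1)^-1 = (u * (u + 1) ^+ 2)^-1.
  by field; rewrite !gt_eqF//; lra.
by rewrite invr_ge0 mulr_ge0 ?exprn_ge0//; lra.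
Qed.

Variable a : array P.
Hypotheses (a1 : condA1 a) (a2 : condA2 a) (a3 : condA3 a).
Variable c : R.
Hypothesis c2 : condC2 a c.

Definition circuit_stat k n x : R :=
  \sum_(p : {ffun 'I_k.+1 -> 'I_n}) entry_word a (circuit_word p) x.

Lemma circuit_stat_am k n : all_moments P (circuit_stat k n).
Proof. by apply: am_sum => p; exact: entry_word_am. Qed.

Lemma Ex_circuit_stat k n : Ex P (circuit_stat k n) = circuit_sum k (@word_moment _ _ _ _ a n).
Proof. by rewrite /circuit_stat Ex_sum// => p; exact/am_rint/entry_word_am. Qed.

Lemma entry_word4 k n (u : {ffun 'I_4 -> {ffun 'I_k.+1 -> 'I_n}}) (S : {set 'I_4}) x :
  entry_word a (words4 u S) x = \prod_(j in S) entry_word a (circuit_word (u j)) x.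
Proof. by rewrite /entry_word big_flatten big_map big_enum. Qed.

Lemma centered_fourth k n :
  Ex P (fun x => (circuit_stat k n x - Ex P (circuit_stat k n)) ^+ 4) =
  \sum_(u : {ffun 'I_4 -> {ffun 'I_k.+1 -> 'I_n}}) centered_moment (@word_moment _ _ _ _ a n) u.
Proof.
pose m := @word_moment _ _ _ _ a n.
have E x : (circuit_stat k n x - Ex P (circuit_stat k n)) ^+ 4 =
    \sum_(u : {ffun 'I_4 -> {ffun 'I_k.+1 -> 'I_n}}) \sum_(S : {set 'I_4})
      (\prod_(j in ~: S) - m (circuit_word (u j))) * entry_word a (words4 u S) x.
  rewrite Ex_circuit_stat /circuit_stat /circuit_sum -sumrB.
  have pow4 (y : R) : y ^+ 4 = \prod_(j < 4) y by rewrite prodr_const card_ord.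
  rewrite pow4 bigA_distr_bigA.
  apply: eq_bigr => u _; rewrite bigA_distr; apply: eq_big => [S|S _]; first by rewrite inE.
  rewrite entry_word4 mulrC (bigID (fun j => j \in S)) /=; congr (_ * _).
    by apply: eq_bigr => j ->.
  by apply: eq_big => [j|j /negPf->]; rewrite ?inE.
under eq_fun do rewrite E.
rewrite Ex_sum; last first.
  by move=> u; apply: rint_sum => S; apply/rintZ/am_rint/entry_word_am.
apply: eq_bigr => u _; rewrite Ex_sum; last first.
  by move=> S; apply/rintZ/am_rint/entry_word_am.
apply: eq_bigr => S _; rewrite ExZ; last exact/am_rint/entry_word_am.
by rewrite mulrC.
Qed.

Lemma random_matrix_trace k n x : \tr (random_matrix a n x ^+ k.+1) =
  (Num.sqrt n%:R)^-1 ^+ k.+1 * circuit_stat k n x.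
Proof.
rewrite trace_circuit mulr_sumr; apply: eq_bigr => p _; rewrite /entry_word.
under eq_bigr do rewrite mxE.
rewrite big_split /=; congr (_ * _).
by rewrite big_const_seq count_predT iter_mulr_1 size_map size_enum_ord.
Qed.

Lemma ae_moment_cvg k (M : R) :
  (n%:R^-1 * (Num.sqrt n%:R)^-1 ^+ k.+1 * circuit_sum k (@word_moment _ _ _ _ a n)
     @[n --> \oo] --> M) ->
  {ae P, forall x, n%:R^-1 * \tr (random_matrix a n x ^+ k.+1) @[n --> \oo] --> M}.
Proof.
move=> hM.
pose v n : R := n%:R^-1 * (Num.sqrt n%:R)^-1 ^+ k.+1.
pose Z n x := v n * (circuit_stat k n x - Ex P (circuit_stat k n)).
pose W n x := v n ^+ 4 * (circuit_stat k n x - Ex P (circuit_stat k n)) ^+ 4.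
have WZ n x : W n x = Z n x ^+ 4 by rewrite /W /Z [RHS]exprMn.
have cm n : all_moments P (fun x => circuit_stat k n x - Ex P (circuit_stat k n)).
  by apply: am_add; [exact: circuit_stat_am|exact: am_cst].
have [cn [mf _]] := array_moment_family a2 a3 a1 c2.
have [B0 cn1 mP] := mf.
pose C : R := #|{: {ffun 'I_4 * 'I_k.+1 -> 'I_4 * 'I_k.+1}}|%:R *
  centered_bound k (word_bound a) * 2 ^+ (2 * k.+1 + 2).
have C0 : 0 <= C.
  rewrite !mulr_ge0 ?exprn_ge0//; apply: sumr_ge0 => S _.
  by rewrite mulr_ge0 ?exprn_ge0.
have ae4 : {ae P, forall x, W n x @[n --> \oo] --> 0}.
  apply: (@ae_cvg0 W (C * 2)).
  - by move=> n; apply: rintZ; exact: (cm n).2.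
  - by move=> n x; rewrite WZ exprn_even_ge0.
  move=> N; apply: (@le_trans _ _ (\sum_(n < N) C * (n%:R ^+ 2)^-1)); last first.
    by rewrite -mulr_sumr ler_wpM2l// sum_invsq.
  apply: ler_sum => -[n _] _ /=.
  rewrite /W ExZ; last exact: (cm n).2.
  have [->|n0] := posnP n.
    by rewrite /v invr0 mul0r expr0n mul0r mulr_ge0// expr0n invr0.
  have nR : 0 < n%:R :> R by rewrite ltr0n.
  rewrite centered_fourth.
  apply: (@le_trans _ _ (v n ^+ 4 * (C * n%:R ^+ (2 * k.+1 + 2)))).
    rewrite ler_wpM2l ?exprn_even_ge0//; apply: (le_trans (ler_norm _)).
    have := @centered_sum_le R k n _ _ _ (mP n) (@word_moment_perm _ _ _ _ a n) B0.
    by rewrite natrM exprMn /C !mulrA.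
  rewrite mulrCA ler_wpM2l// /v exprMn -exprM.
  have -> : (Num.sqrt n%:R)^-1 ^+ (k.+1 * 4) = n%:R^-1 ^+ (2 * k.+1) :> R.
    rewrite !exprVn; congr (_^-1); rewrite -{2}(sqr_sqrtr (ltW nR)) -exprM; congr (_ ^+ _); lia.
  rewrite exprD !exprVn le_eqVlt; apply/orP; left; apply/eqP.
  by field; rewrite expf_neq0 ?gt_eqF.
apply: filterS ae4 => x Wx.
have Z0 : Z n x @[n --> \oo] --> 0.
  apply/cvgr0Pnorm_lt => e e0.
  have e4 : 0 < e ^+ 4 by rewrite exprn_gt0.
  have /cvgr0Pnorm_lt/(_ _ e4) := Wx; apply: filterS => n.
  by rewrite WZ normrX ltr_pXn2r ?nnegrE ?(ltW e0).
have E n : n%:R^-1 * \tr (random_matrix a n x ^+ k.+1) =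
    Z n x + v n * circuit_sum k (@word_moment _ _ _ _ a n).
  by rewrite random_matrix_trace /Z -Ex_circuit_stat mulrBr subrK mulrA.
under eq_fun do rewrite E.
by rewrite -[M]add0r; exact: cvgD.
Qed.

End AlmostSure.

(** * Averages determined by moments *)

Section CosineTaylor.
Local Open Scope classical_set_scope.
Variable R : realType.

Definition cos_taylor N (phi : R) : {poly R} :=
  \poly_(i < N) (cos (phi + i%:R * (pi / 2)) / i`!%:R).

Lemma cos_taylor_deriv N phi : deriv (cos_taylor N.+1 phi) = cos_taylor N (phi + pi / 2).
Proof.
apply/polyP => i; rewrite coef_deriv !coef_poly ltnS; case: ifPn => // _; last by rewrite mul0rn.
have i0 : i.+1%:R != 0 :> R by rewrite pnatr_eq0.
have f0 : i`!%:R != 0 :> R by rewrite pnatr_eq0 -lt0n fact_gt0.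
have -> : phi + i.+1%:R * (pi / 2) = phi + pi / 2 + i%:R * (pi / 2) by rewrite -natr1; ring.
by rewrite -mulr_natr factS natrM; field; rewrite ?natr1 ?nat1r ?i0 ?f0.
Qed.

(** The difference of the two sides vanishes at 0 and has a nonnegative derivative on the positive
    half-line. *)
Lemma le_of_derive_le (g dg : R -> R) (C : R) N :
  (forall x : R, is_derive x (1 : R) g (dg x)) -> g 0 = 0 ->
  (forall x, `|dg x| <= C * `|x| ^+ N) -> forall x, 0 <= x -> g x <= C / N.+1%:R * x ^+ N.+1.
Proof.
move=> dgP g0 dgC x x0.
pose p : {poly R} := (C / N.+1%:R) *: 'X^(N.+1).
pose h y := p.[y] - g y.
have dh y : is_derive y (1 : R) h ((deriv p).[y] - dg y) by apply: is_deriveB.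
have p' y : (deriv p).[y] = C * y ^+ N.
  rewrite derivZ derivXn hornerZ hornerMn hornerXn -[_ *+ _]mulr_natr.
  by rewrite /=; field; rewrite ?nat1r ?natr1 pnatr_eq0.
have : h 0 <= h x.
  apply: (@ger0_derive1_le_cc _ h 0 x).
  - by move=> y _; case: (dh y).
  - move=> y; rewrite in_itv /= => /andP[y0 _].
    rewrite derive1E (@derive_val _ _ _ _ _ _ _ (dh y)) p' subr_ge0.
    by apply: (le_trans (ler_norm _)); rewrite (le_trans (dgC y))// (ger0_norm (ltW y0)).
  - apply: continuous_subspaceT => y; apply: differentiable_continuous.
    by apply/derivable1_diffP; case: (dh y).
  - by rewrite in_itv /= lexx.
  - by rewrite in_itv /= lexx x0.
  - by [].
by rewrite /h /p !hornerZ !hornerXn expr0n mulr0 g0 subrr subr_ge0.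
Qed.

Lemma norm_le_of_derive_le (g dg : R -> R) (C : R) N :
  (forall x : R, is_derive x (1 : R) g (dg x)) -> g 0 = 0 ->
  (forall x, `|dg x| <= C * `|x| ^+ N) -> forall x, `|g x| <= C / N.+1%:R * `|x| ^+ N.+1.
Proof.
move=> dgP g0 dgC.
have pos (f df : R -> R) : (forall x : R, is_derive x (1 : R) f (df x)) -> f 0 = 0 ->
    (forall x, `|df x| <= C * `|x| ^+ N) ->
    forall x, 0 <= x -> `|f x| <= C / N.+1%:R * `|x| ^+ N.+1.
  move=> dfP f0 dfC x x0; rewrite (ger0_norm x0) ler_norml; apply/andP; split.
    rewrite lerNl; apply: (@le_of_derive_le (fun x => - f x) (fun x => - df x)) => //.
    - by rewrite f0 oppr0.
    - by move=> y; rewrite normrN.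
  exact: le_of_derive_le dfC _ x0.
move=> x; have [x0|x0] := leP 0 x; first exact: pos dgC _ x0.
have := @pos (fun y => g (- y)) (fun y => - dg (- y)).
rewrite oppr0 => /(_ _ g0 _ (- x)); rewrite opprK normrN; apply.
- move=> y; have h := is_derive1_comp (dgP (- y)) (is_deriveN (is_derive_id y 1)).
  by rewrite mulrN1 in h.
- by move=> y; rewrite normrN -[in leRHS]normrN.
- by rewrite oppr_ge0 ltW.
Qed.

Lemma cos_taylor_le N phi x : `|cos (x + phi) - (cos_taylor N phi).[x]| <= `|x| ^+ N / N`!%:R.
Proof.
elim: N phi x => [|N IH] phi x.
  rewrite expr0 divr1 (_ : cos_taylor 0 phi = 0) ?horner0 ?subr0; first exact: cos_max.
  by apply/polyP => i; rewrite coef_poly coef0.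
pose g y := cos (y + phi) - (cos_taylor N.+1 phi).[y].
pose dg y := cos (y + (phi + pi / 2)) - (cos_taylor N (phi + pi / 2)).[y].
have := @norm_le_of_derive_le g dg N`!%:R^-1 N.
rewrite factS natrM invfM mulrA mulrAC [_ / _ * _]mulrC mulrA => h.
apply: (le_trans (h _ _ _ x)).
- move=> y; rewrite /g /dg -cos_taylor_deriv; apply: is_deriveB.
  rewrite addrA cosDpihalf -[X in is_derive _ _ _ X]mulr1.
  apply: (@is_derive1_comp _ cos (fun y => y + phi) y (- sin (y + phi)) 1).
  by rewrite -[X in is_derive _ _ _ X]addr0; apply: is_deriveD.
- rewrite /g add0r horner_coef0 coef_poly /= mul0r addr0 divr1 subrr//.
- by move=> y; apply: (le_trans (IH _ _)); rewrite mulrC.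
- by rewrite mulrC mulrA mulrAC.
Qed.

End CosineTaylor.

(** * Averages along sequences with prescribed moments *)

Section LimitAverages.
Local Open Scope classical_set_scope.
Variable R : realType.
Implicit Types f g h : R -> R.

Definition avg (s : seq R) f : R := (size s)%:R^-1 * \sum_(x <- s) f x.

Lemma avgD s f g : avg s (fun x => f x + g x) = avg s f + avg s g.
Proof. by rewrite /avg big_split mulrDr. Qed.

Lemma avgZ s (a : R) f : avg s (fun x => a * f x) = a * avg s f.
Proof. by rewrite /avg -mulr_sumr mulrCA. Qed.

Lemma avg_le s f g : (forall x, f x <= g x) -> avg s f <= avg s g.
Proof. by move=> fg; rewrite /avg ler_wpM2l ?invr_ge0//; apply: ler_sum => x _. Qed.

Lemma avgB s f g : avg s (fun x => f x - g x) = avg s f - avg s g.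
Proof. by rewrite /avg sumrB mulrBr. Qed.

Lemma avg_norm_le s f g : (forall x, `|f x| <= g x) -> `|avg s f| <= avg s g.
Proof.
move=> fg; rewrite /avg normrM ger0_norm ?invr_ge0// ler_wpM2l ?invr_ge0//.
by apply: (le_trans (ler_norm_sum _ _ _)); apply: ler_sum => x _.
Qed.

Variable M : nat -> R.

(** From here on a sample point matters only through its sequence of spectra. *)
Definition moment_seq (S : nat -> seq R) := (forall n, size (S n) = n) /\
  forall k, avg (S n) (fun x => x ^+ k) @[n --> \oo] --> M k.

Variable S0 : nat -> seq R.
Hypothesis S0M : moment_seq S0.

Definition lim_avg f : R := limn (fun n => avg (S0 n) f).
(** The limit is named through [S0] but is common to all [S]; for such [f] it therefore depends on
    [M] only. *)
Definition limiting f := forall S, moment_seq S -> avg (S n) f @[n --> \oo] --> lim_avg f.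

Lemma limitingI f (l : R) : (forall S, moment_seq S -> avg (S n) f @[n --> \oo] --> l) ->
  limiting f /\ lim_avg f = l.
Proof.
move=> h; have e : lim_avg f = l by apply: cvg_lim => //; exact: h.
by split=> // S hS; rewrite e; exact: h.
Qed.

Lemma limiting_pow k : limiting (fun x => x ^+ k) /\ lim_avg (fun x => x ^+ k) = M k.
Proof. by apply: limitingI => S [_]. Qed.

Lemma limitingD f g : limiting f -> limiting g ->
  limiting (fun x => f x + g x) /\ lim_avg (fun x => f x + g x) = lim_avg f + lim_avg g.
Proof.
move=> lf lg; apply: limitingI => S hS; under eq_fun do rewrite avgD.
by apply: cvgD; [exact: lf|exact: lg].
Qed.

Lemma limitingZ (a : R) f : limiting f ->
  limiting (fun x => a * f x) /\ lim_avg (fun x => a * f x) = a * lim_avg f.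
Proof.
move=> lf; apply: limitingI => S hS; under eq_fun do rewrite avgZ.
by apply: cvgMl_tmp; exact: lf.
Qed.

Lemma limiting_cst (c : R) : limiting (fun=> c) /\ lim_avg (fun=> c) = c.
Proof.
apply: limitingI => S [sS _]; apply: (@cvg_trans _ (c @[n --> \oo])); last exact: cvg_cst.
apply: near_eq_cvg; near=> n.
have n0 : n%:R != 0 :> R by rewrite pnatr_eq0 -lt0n; near: n; exact: nbhs_infty_ge.
by rewrite /avg big_const_seq count_predT iter_addr_0 sS -[c *+ _]mulr_natl mulKf.
Unshelve. all: by end_near.
Qed.

Lemma lim_avg_le f g : limiting f -> limiting g -> (forall x, f x <= g x) ->
  lim_avg f <= lim_avg g.
Proof.
move=> lf lg fg; apply: (ler_cvg_to (lf _ S0M) (lg _ S0M)).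
by apply: nearW => n; exact: avg_le.
Qed.

Lemma limiting_sum (I : Type) (r : seq I) (F : I -> R -> R) : (forall i, limiting (F i)) ->
  limiting (fun x => \sum_(i <- r) F i x).
Proof.
move=> lF; elim: r => [|i r IH].
  by under eq_fun do rewrite big_nil; exact: (limiting_cst 0).1.
by under eq_fun do rewrite big_cons; exact: (limitingD (lF i) IH).1.
Qed.

(** The error is only required to be small on average, since neither Taylor polynomials nor periodic
    functions approximate uniformly on the whole line. *)
Lemma limiting_approx f : (forall e : R, 0 < e -> exists g h, [/\ limiting g, limiting h,
    forall x, `|f x - g x| <= h x & lim_avg h <= e]) -> limiting f.
Proof.
move=> app.
(* The same [v] serves every [S]; this is what makes the limits agree. *)
have key (e : R) : 0 < e -> exists v, forall S, moment_seq S ->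
    \forall n \near \oo, `|v - avg (S n) f| < e.
  move=> e0; have e4 : 0 < e / 4 by rewrite divr_gt0.
  have [g [h [lg lh fgh he]]] := app _ e4.
  exists (lim_avg g) => S hS; near=> n.
  have hg : `|lim_avg g - avg (S n) g| < e / 4.
    by near: n; have /cvgrPdist_lt/(_ _ e4) := lg _ hS.
  have hh : `|lim_avg h - avg (S n) h| < e / 4.
    by near: n; have /cvgrPdist_lt/(_ _ e4) := lh _ hS.
  have hf : `|avg (S n) f - avg (S n) g| <= avg (S n) h by rewrite -avgB; exact: avg_norm_le.
  move: hg hh hf; rewrite !ltr_norml !ler_norml => /andP[? ?] /andP[? ?] /andP[? ?].
  apply/andP; split; lra.
have c0 : cvgn (fun n => avg (S0 n) f).
  apply/cauchy_cvgP; apply: cauchy_exP => e e0; have [v hv] := key e e0.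
  by exists v; exact: hv.
move=> S hS; apply/cvgrPdist_lt => e e0.
have e2 : 0 < e / 3 by rewrite divr_gt0.
have [v hv] := key _ e2.
have hl : `|v - lim_avg f| <= e / 3.
  have c1 : `|v - avg (S0 n) f| @[n --> \oo] --> `|v - lim_avg f|.
    by apply: cvg_norm; apply: cvgB; [exact: cvg_cst|exact: c0].
  rewrite -(cvg_lim _ c1)//; apply: limr_le; first by apply/cvg_ex; eexists; exact: c1.
  by have := hv _ S0M; apply: filterS => n /ltW.
have := hv _ hS; apply: filterS => n; move: hl.
rewrite !ltr_norml ler_norml => /andP[? ?] /andP[? ?]; apply/andP; split; lra.
Unshelve. all: by end_near.
Qed.

Hypothesis growth : forall t : R, t ^+ (2 * m) * M (2 * m) / (2 * m)`!%:R @[m --> \oo] --> (0 : R).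

(** At an even order the bound on the Taylor remainder is itself a monomial, whose averages converge
    to a term of [growth]. *)
Lemma limiting_cos (t phi : R) : limiting (fun x => cos (t * x + phi)).
Proof.
apply: limiting_approx => e e0.
have /cvgrPdist_lt/(_ _ e0)[m _ /(_ m (leqnn m))] := growth t.
rewrite sub0r normrN => hm.
exists (fun x => (cos_taylor (2 * m) phi).[t * x]).
exists (fun x => (t ^+ (2 * m) / (2 * m)`!%:R) * x ^+ (2 * m)).
have [l1 l2] := limiting_pow (2 * m).
have [l3 l4] := limitingZ (t ^+ (2 * m) / (2 * m)`!%:R) l1.
split=> //.
- rewrite (_ : (fun x => _) = fun x =>
      \sum_(i < 2 * m) ((cos_taylor (2 * m) phi)`_i * t ^+ i) * x ^+ i).
    apply: limiting_sum => i.
    by have [] := limitingZ ((cos_taylor (2 * m) phi)`_i * t ^+ i) (limiting_pow i).1.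
  apply/funext => x; rewrite (@horner_coef_wide _ (2 * m)); last exact: size_poly.
  by apply: eq_bigr => i _; rewrite exprMn mulrA.
- move=> x; apply: (le_trans (cos_taylor_le (2 * m) phi (t * x))).
  by rewrite -normrX ger0_norm ?exprn_even_ge0 ?oddM// exprMn mulrAC.
- by rewrite l4 l2 mulrAC; apply: (le_trans (ler_norm _)); exact: ltW.
Qed.

Definition trigpoly f := exists s : seq (R * R * R), forall x,
  f x = \sum_(q <- s) q.1.1 * cos (q.1.2 * x + q.2).

Lemma limiting_trigpoly f : trigpoly f -> limiting f.
Proof.
move=> [s fs]; rewrite (_ : f = fun x => \sum_(q <- s) q.1.1 * cos (q.1.2 * x + q.2)).
  by apply: limiting_sum => q; have [h _] := limitingZ q.1.1 (@limiting_cos q.1.2 q.2); exact: h.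
exact/funext.
Qed.

Lemma trigpoly_cos t phi : trigpoly (fun x => cos (t * x + phi)).
Proof. by exists [:: (1, t, phi)] => x; rewrite big_seq1 mul1r. Qed.

Lemma trigpoly_cst c : trigpoly (fun=> c).
Proof. by exists [:: (c, 0, 0)] => x; rewrite big_seq1 /= mul0r addr0 cos0 mulr1. Qed.

Lemma trigpolyD f g : trigpoly f -> trigpoly g -> trigpoly (fun x => f x + g x).
Proof. by move=> [s hs] [s' hs']; exists (s ++ s') => x; rewrite big_cat hs hs'. Qed.

Lemma trigpolyZ (c : R) f : trigpoly f -> trigpoly (fun x => c * f x).
Proof.
move=> [s hs]; exists [seq (c * q.1.1, q.1.2, q.2) | q <- s] => x.
by rewrite hs mulr_sumr big_map; apply: eq_bigr => q _ /=; rewrite mulrA.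
Qed.

Lemma trigpoly_ext f g : (forall x, f x = g x) -> trigpoly f -> trigpoly g.
Proof. by move=> fg [s hs]; exists s => x; rewrite -fg. Qed.

Lemma trigpoly_mul_cos f t phi : trigpoly f -> trigpoly (fun x => f x * cos (t * x + phi)).
Proof.
move=> [s hs]; exists ([seq (q.1.1 / 2, q.1.2 + t, q.2 + phi) | q <- s] ++
   [seq (q.1.1 / 2, q.1.2 - t, q.2 - phi) | q <- s]) => x.
rewrite hs mulr_suml big_cat !big_map /= -big_split /=; apply: eq_bigr => q _.
have -> : (q.1.2 + t) * x + (q.2 + phi) = (q.1.2 * x + q.2) + (t * x + phi) by ring.
have -> : (q.1.2 - t) * x + (q.2 - phi) = (q.1.2 * x + q.2) - (t * x + phi) by ring.
move: (q.1.2 * x + q.2) (t * x + phi) => A B; by rewrite cosB cosD; field.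
Qed.

Lemma trigpolyM f g : trigpoly f -> trigpoly g -> trigpoly (fun x => f x * g x).
Proof.
move=> tf [s hs]; apply: (@trigpoly_ext (fun x => \sum_(q <- s) q.1.1 * (f x * cos (q.1.2 * x + q.2)))).
  by move=> x; rewrite hs mulr_sumr; apply: eq_bigr => q _; rewrite mulrCA.
elim: s {hs} => [|q s IH].
  by under eq_fun do rewrite big_nil; exact: trigpoly_cst.
under eq_fun do rewrite big_cons; apply: trigpolyD => //.
by apply: trigpolyZ; exact: trigpoly_mul_cos.
Qed.

(* Through [|s| = sqrt (s ^+ 2)] with [s = sin (x / L)], these polynomials yield
   trigonometric approximations of [|x|]. *)
Fixpoint sqrt_approx n (t : R) : R :=
  if n is n'.+1 then sqrt_approx n' t + (t - sqrt_approx n' t ^+ 2) / 2 else 0.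

(** A step multiplies the error by 1 - (u + p)/2 <= 1 - u/2, and (1 - u/2)(1 + (n+1)u/2) <= 1 +
    nu/2. The third inequality says that the error is at most 2u/(2 + nu), which is at most 2/n
    uniformly in [u]. *)
Lemma sqrt_approx_le n (u : R) : 0 <= u <= 1 ->
  [/\ 0 <= sqrt_approx n (u ^+ 2), sqrt_approx n (u ^+ 2) <= u &
      (u - sqrt_approx n (u ^+ 2)) * (1 + n%:R * u / 2) <= u].
Proof.
move=> /andP[u0 u1]; elim: n => [|n [h1 h2 h3]] /=.
  by split=> //; rewrite subr0 mul0r mul0r addr0 mulr1.
move: h1 h2 h3; set p := sqrt_approx n _ => h1 h2 h3.
have e : u - (p + (u ^+ 2 - p ^+ 2) / 2) = (u - p) * (1 - (u + p) / 2) by field.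
have p0 : 0 <= (u ^+ 2 - p ^+ 2) / 2.
  by rewrite divr_ge0// subr_ge0 lerXn2r ?nnegrE.
have up : 0 <= 1 - (u + p) / 2 by lra.
split; first by rewrite addr_ge0.
  by rewrite -subr_ge0 e; apply: mulr_ge0 => //; rewrite subr_ge0.
rewrite e; apply: le_trans h3; rewrite -mulrA ler_wpM2l ?subr_ge0//.
have n0 : 0 <= n%:R :> R by [].
have nu0 : 0 <= n%:R * u / 2 by rewrite divr_ge0// mulr_ge0.
have e2 : n.+1%:R * u / 2 = n%:R * u / 2 + u / 2 by rewrite -natr1; ring.
rewrite e2; move: (n%:R * u / 2) nu0 => v v0; nra.
Qed.

Lemma sqrt_approx_err n (u : R) : 0 <= u <= 1 -> (0 < n)%N ->
  `|u - sqrt_approx n (u ^+ 2)| <= 2 / n%:R.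
Proof.
move=> u01 n0; have [h1 h2 h3] := sqrt_approx_le n u01.
have nR : 0 < n%:R :> R by rewrite ltr0n.
have /andP[u0 u1] := u01.
rewrite ger0_norm ?subr_ge0// ler_pdivlMr//.
move: h1 h2 h3; set p := sqrt_approx _ _ => h1 h2 h3.
have [->|u_neq] := eqVneq u p; first by rewrite subrr mul0r.
have u_gt : 0 < u.
  rewrite lt_def u0 andbT; apply: contra_neq u_neq => u00.
  by apply/le_anti/andP; split; lra.
rewrite -(ler_pM2r u_gt); nra.
Qed.

Lemma trigpoly_sqrt n f : trigpoly f -> trigpoly (fun x => sqrt_approx n (f x)).
Proof.
move=> tf; elim: n => [|n IH] /=; first exact: trigpoly_cst.
apply: trigpolyD => //.
apply: (@trigpoly_ext (fun x => 2^-1 * (f x + (-1) * (sqrt_approx n (f x) * sqrt_approx n (f x))))).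
  by move=> x; rewrite mulrC mulN1r expr2.
apply: trigpolyZ; apply: trigpolyD => //; apply: trigpolyZ; exact: trigpolyM.
Qed.

Lemma sin_err (x : R) : `|sin x - x| <= x ^+ 2 / 2.
Proof.
have := cos_taylor_le 2 (- (pi / 2)) x; rewrite cosBpihalf real_normK ?num_real//.
rewrite (_ : (cos_taylor 2 (- (pi / 2))).[x] = x)//.
rewrite (@horner_coef_wide _ 2); last exact: size_poly.
rewrite !big_ord_recr big_ord0 /= !coef_poly /= mul0r addr0 mul1r addNr cosN cos_pihalf cos0.
by rewrite expr0 expr1 !mul0r !add0r divr1 mul1r.
Qed.

(** With y = x - a, |y| differs from L |sin (y/L)| by at most y^2/(2L), which the second moment
    makes small on average for large L; as the sine is bounded, its modulus has uniform
    trigonometric approximations. *)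
Lemma limiting_dist (a : R) : limiting (fun x => `|x - a|).
Proof.
apply: limiting_approx => e e0.
(* [K] is the limit average of (x - a)^2. The choice of [L] makes K/(2L) at most e/2, and that of
   [n] makes 2L/n at most e/2. *)
pose K := M 2 - 2 * a * M 1 + a ^+ 2.
pose L := (`|K| + 1) / e; pose n := (Num.truncn (4 * L / e)).+1.
have L0 : 0 < L by rewrite divr_gt0// ltr_wpDl.
have nR : 0 < n%:R :> R by [].
exists (fun x => L * sqrt_approx n (sin ((x - a) / L) ^+ 2)).
exists (fun x => (2 * L)^-1 * (x ^+ 2 + ((- 2 * a) * x ^+ 1 + a ^+ 2)) + L * (2 / n%:R)).
have [l2 v2] := limiting_pow 2; have [l1 v1] := limiting_pow 1.
have [l1' v1'] := limitingZ (- 2 * a) l1; have [lc vc] := limiting_cst (a ^+ 2).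
have [lA vA] := limitingD l1' lc; have [lB vB] := limitingD l2 lA.
have [lC vC] := limitingZ (2 * L)^-1 lB; have [lD vD] := limiting_cst (L * (2 / n%:R)).
have [lE vE] := limitingD lC lD.
split.
- apply: limiting_trigpoly; apply: trigpolyZ; apply: trigpoly_sqrt.
  apply: (@trigpoly_ext (fun x => cos (L^-1 * x + (- (a / L) - pi / 2)) *
     cos (L^-1 * x + (- (a / L) - pi / 2)))); last by apply: trigpolyM; exact: trigpoly_cos.
  move=> x; have -> : (x - a) / L = L^-1 * x + - (a / L) by ring.
  by rewrite addrA cosBpihalf expr2.
- exact: lE.
- move=> x; set y := x - a; set s := sin (y / L).
  have s1 : 0 <= `|s| <= 1 by rewrite normr_ge0 /= /s -cosBpihalf cos_max.
  have h1 : `| `|y| - L * `|s| | <= (2 * L)^-1 * y ^+ 2.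
    have -> : `|y| = L * `|y / L|.
      by rewrite normrM normfV (gtr0_norm L0) mulrCA mulfV ?mulr1// gt_eqF.
    rewrite -mulrBr normrM (gtr0_norm L0).
    apply: (@le_trans _ _ (L * ((y / L) ^+ 2 / 2))).
      rewrite (ler_wpM2l (ltW L0))//; apply: (le_trans (ler_dist_dist _ _)).
      by rewrite distrC; exact: sin_err.
    by rewrite le_eqVlt; apply/orP; left; apply/eqP; field; rewrite gt_eqF.
  have h2 : `| L * `|s| - L * sqrt_approx n (s ^+ 2)| <= L * (2 / n%:R).
    rewrite -mulrBr normrM (gtr0_norm L0) (ler_wpM2l (ltW L0))//.
    by rewrite -(real_normK (num_real s)); exact: sqrt_approx_err.
  have -> : x ^+ 2 + ((- 2 * a) * x ^+ 1 + a ^+ 2) = y ^+ 2 by rewrite /y; ring.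
  rewrite (_ : `|y| - _ = (`|y| - L * `|s|) + (L * `|s| - L * sqrt_approx n (s ^+ 2))); last ring.
  by apply: (le_trans (ler_normD _ _)); exact: lerD.
- rewrite vE vC vB vA v1' v1 v2 vc vD.
  have -> : M 2 + (- 2 * a * M 1 + a ^+ 2) = K by rewrite /K; ring.
  have h1 : (2 * L)^-1 * K <= e / 2.
    have L20 : 0 < 2 * L by apply: mulr_gt0.
    rewrite mulrC ler_pdivrMr// /L.
    have -> : e / 2 * (2 * ((`|K| + 1) / e)) = `|K| + 1 by field; rewrite gt_eqF.
    by apply: (le_trans (ler_norm _)); rewrite lerDl.
  have h2 : L * (2 / n%:R) <= e / 2.
    rewrite mulrA ler_pdivrMr//.
    have : 4 * L / e <= n%:R by exact/ltW/truncnS_gt.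
    by rewrite ler_pdivrMr//; nra.
  lra.
Qed.

End LimitAverages.

(** * The limit measure *)

Section LimitMeasure.
Local Open Scope classical_set_scope.
Variables (R : realType) (M : nat -> R) (S0 : nat -> seq R).
Hypothesis S0M : moment_seq M S0.
Hypothesis growth : forall t : R, t ^+ (2 * m) * M (2 * m) / (2 * m)`!%:R @[m --> \oo] --> (0 : R).

(** For a < b it is 1 up to a, 0 from b on and linear in between: a continuous substitute for the
    indicator of a left half-line. Absolute values make [limiting_dist] applicable. *)
Definition ramp (a b x : R) : R := 2^-1 + (`|x - b| - `|x - a|) / (2 * (b - a)).

Lemma rampl a b x : a < b -> x <= a -> ramp a b x = 1.
Proof.
move=> ab xa; rewrite /ramp !ler0_norm ?subr_le0//; last exact: le_trans (ltW ab).
by field; rewrite subr_eq0 gt_eqF.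
Qed.

Lemma rampr a b x : a < b -> b <= x -> ramp a b x = 0.
Proof.
move=> ab bx; rewrite /ramp !ger0_norm ?subr_ge0//; last exact: le_trans (ltW ab) _.
by field; rewrite subr_eq0 gt_eqF.
Qed.

Lemma rampm a b x : a < b -> a <= x <= b -> ramp a b x = (b - x) / (b - a).
Proof.
move=> ab /andP[ax xb]; rewrite /ramp (ler0_norm (_ : x - b <= 0)) ?subr_le0//.
by rewrite ger0_norm ?subr_ge0//; field; rewrite subr_eq0 gt_eqF.
Qed.

Lemma ramp01 a b x : a < b -> 0 <= ramp a b x <= 1.
Proof.
move=> ab; have [xa|ax] := leP x a; first by rewrite rampl// ler01 lexx.
have [bx|xb] := leP b x; first by rewrite rampr// ler01 lexx.
have ba : 0 < b - a by rewrite subr_gt0.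
have axb : a <= x <= b by rewrite (ltW ax) (ltW xb).
rewrite (rampm ab axb) divr_ge0 ?subr_ge0 ?(ltW xb) ?(ltW ab)//=.
by rewrite ler_pdivrMr// mul1r lerD2l lerN2 ltW.
Qed.

Lemma ramp_ge0 a b x : a < b -> 0 <= ramp a b x. Proof. by move=> /(ramp01 x)/andP[]. Qed.
Lemma ramp_le1 a b x : a < b -> ramp a b x <= 1. Proof. by move=> /(ramp01 x)/andP[]. Qed.

Lemma limiting_ramp a b : limiting M S0 (ramp a b).
Proof.
have [l1 _] := limitingZ S0M (-1) (@limiting_dist _ _ _ S0M growth a).
have [l2 _] := limitingD S0M (@limiting_dist _ _ _ S0M growth b) l1.
have [l3 _] := limitingZ S0M (2 * (b - a))^-1 l2.
have [l4 _] := limitingD S0M (limiting_cst S0M 2^-1).1 l3.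
rewrite (_ : ramp a b = fun x => 2^-1 + (2 * (b - a))^-1 * (`|x - b| + -1 * `|x - a|))//.
by apply/funext => x; rewrite /ramp mulN1r mulrC.
Qed.

Definition lam a b := lim_avg S0 (ramp a b).

Lemma lam_ge0 a b : a < b -> 0 <= lam a b.
Proof.
move=> ab; rewrite -[X in X <= _](limiting_cst S0M 0).2.
by apply: (lim_avg_le S0M (limiting_cst S0M _).1 (@limiting_ramp a b)) => x; exact: ramp_ge0.
Qed.

Lemma lam_le1 a b : a < b -> lam a b <= 1.
Proof.
move=> ab; rewrite -[X in _ <= X](limiting_cst S0M 1).2.
by apply: (lim_avg_le S0M (@limiting_ramp a b) (limiting_cst S0M _).1) => x; exact: ramp_le1.
Qed.

Lemma lam_disjoint a b a' b' : a < b -> b <= a' -> a' < b' -> lam a b <= lam a' b'.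
Proof.
move=> ab ba ab'; apply: (lim_avg_le S0M (@limiting_ramp a b) (@limiting_ramp a' b')) => x.
have [xa|ax] := leP x a'; first by rewrite (rampl ab' xa) ramp_le1.
by rewrite (rampr ab) ?ramp_ge0//; exact/ltW/(le_lt_trans ba).
Qed.

(** Chebyshev's inequality: where the ramp is nonzero, x^2/b^2 is at least 1. With [lam_right] it
    prevents mass from escaping to infinity. *)
Lemma lam_left a b : a < b -> b < 0 -> lam a b <= M 2 / b ^+ 2.
Proof.
move=> ab b0; have [l1 v1] := limiting_pow S0M 2.
have [l2 v2] := limitingZ S0M (b ^+ 2)^-1 l1.
rewrite mulrC -v1 -v2; apply: (lim_avg_le S0M (@limiting_ramp a b) l2) => x.
have b2 : 0 < b ^+ 2 by rewrite exprn_even_gt0//= lt_eqF.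
have [bx|xb] := leP b x.
  by rewrite (rampr ab bx) mulr_ge0 ?invr_ge0 ?sqr_ge0.
apply: (le_trans (ramp_le1 _ ab)); rewrite mulrC ler_pdivlMr// mul1r.
by nra.
Qed.

Lemma lam_right a b : a < b -> 0 < a -> 1 - lam a b <= M 2 / a ^+ 2.
Proof.
move=> ab a0; have [l1 v1] := limiting_pow S0M 2.
have [l2 v2] := limitingZ S0M (a ^+ 2)^-1 l1.
have [l3 v3] := limitingD S0M l2 (@limiting_ramp a b).
rewrite lerBlDr mulrC -v1 -v2 -v3 -[X in X <= _](limiting_cst S0M 1).2.
apply: (lim_avg_le S0M (limiting_cst S0M _).1 l3) => x.
have a2 : 0 < a ^+ 2 by rewrite exprn_gt0.
have [xa|ax] := leP x a.
  by rewrite (rampl ab xa) lerDr mulr_ge0 ?invr_ge0 ?sqr_ge0.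
apply: (@le_trans _ _ ((a ^+ 2)^-1 * x ^+ 2)); last by rewrite lerDl ramp_ge0.
rewrite mulrC ler_pdivlMr// mul1r; nra.
Qed.

Definition cdf_set x := [set l | exists a b, [/\ x < a, a < b & l = lam a b]].
Definition lim_cdf x := inf (cdf_set x).

Lemma cdf_set_has_inf x : has_inf (cdf_set x).
Proof.
split; first by exists (lam (x + 1) (x + 2)), (x + 1), (x + 2); split=> //; lra.
by exists 0 => _ [a [b [_ ab ->]]]; exact: lam_ge0.
Qed.

Lemma lim_cdf_le x a b : x < a -> a < b -> lim_cdf x <= lam a b.
Proof.
by move=> xa ab; apply: ge_inf; [exact: (cdf_set_has_inf x).2|exists a, b].
Qed.

Lemma le_lim_cdf x (y : R) : (forall a b, x < a -> a < b -> y <= lam a b) -> y <= lim_cdf x.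
Proof.
move=> h; apply: lb_le_inf; first exact: (cdf_set_has_inf x).1.
by move=> _ [a [b [xa ab ->]]]; exact: h.
Qed.

Lemma lam_le_cdf a b : a < b -> lam a b <= lim_cdf b.
Proof.
by move=> ab; apply: le_lim_cdf => a' b' ba ab'; apply: lam_disjoint => //; exact: ltW.
Qed.

Lemma lim_cdf_nd : nondecreasing lim_cdf.
Proof.
move=> x y xy; apply: le_lim_cdf => a b ya ab; apply: lim_cdf_le => //.
exact: le_lt_trans ya.
Qed.

Lemma lim_cdf_ge0 x : 0 <= lim_cdf x.
Proof. by apply: le_lim_cdf => a b _ ab; exact: lam_ge0. Qed.

Lemma lim_cdf_le1 x : lim_cdf x <= 1.
Proof.
by apply: (@le_trans _ _ (lam (x + 1) (x + 2))); [apply: lim_cdf_le|apply: lam_le1]; lra.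
Qed.

Lemma lim_cdf_rc : right_continuous lim_cdf.
Proof.
move=> x; apply/cvgrPdist_lt => e e0.
have [_ [a [b [xa ab ->]]] lt] := inf_adherent e0 (cdf_set_has_inf x).
near=> y.
have xy : x < y by near: y; exact: nbhs_right_gt.
have ya : y < a by near: y; exact: nbhs_right_lt.
have h1 := lim_cdf_nd (ltW xy); have h2 := lim_cdf_le ya ab.
rewrite distrC ger0_norm ?subr_ge0// ltrBlDr addrC.
exact: le_lt_trans lt.
Unshelve. all: by end_near.
Qed.

Lemma M2_ge0 : 0 <= M 2.
Proof.
have [l1 v1] := limiting_pow S0M 2.
rewrite -v1 -[X in X <= _](limiting_cst S0M 0).2.
by apply: (lim_avg_le S0M (limiting_cst S0M _).1 l1) => x; exact: sqr_ge0.
Qed.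

Lemma sq_small (e : R) : 0 < e -> exists2 A : R, 1 < A & forall x, A <= `|x| -> M 2 / x ^+ 2 < e.
Proof.
move=> e0; exists (M 2 / e + 2); first by have := M2_ge0; have := divr_ge0 M2_ge0 (ltW e0); lra.
move=> x xA; have k0 := divr_ge0 M2_ge0 (ltW e0).
have x2 : 0 < x ^+ 2 by rewrite -(real_normK (num_real x)) exprn_gt0//; lra.
rewrite ltr_pdivrMr// mulrC -ltr_pdivrMr// -(real_normK (num_real x)).
move: (`|x|) xA => u uA; nra.
Qed.

Lemma lim_cdfNy : lim_cdf @ -oo --> (0 : R).
Proof.
apply/cvgrPdist_lt => e e0; have [A A1 hA] := sq_small e0.
near=> x; have xA : x <= - A - 2 by near: x; apply: nbhs_ninfty_le; exact: num_real.
rewrite sub0r normrN ger0_norm ?lim_cdf_ge0//.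
apply: (@le_lt_trans _ _ (lam (x + 1) (x + 2))); first by apply: lim_cdf_le; lra.
apply: (@le_lt_trans _ _ (M 2 / (x + 2) ^+ 2)); first by apply: lam_left; lra.
by apply: hA; rewrite ltr0_norm; lra.
Unshelve. all: by end_near.
Qed.

Lemma lim_cdfy : lim_cdf @ +oo --> (1 : R).
Proof.
apply/cvgrPdist_lt => e e0; have [A A1 hA] := sq_small e0.
near=> x; have xA : A + 2 <= x by near: x; apply: nbhs_pinfty_ge; exact: num_real.
rewrite ger0_norm ?subr_ge0 ?lim_cdf_le1//.
apply: (@le_lt_trans _ _ (1 - lam (x - 1) x)).
  by rewrite lerD2l lerN2; apply: lam_le_cdf; lra.
apply: (@le_lt_trans _ _ (M 2 / (x - 1) ^+ 2)); first by apply: lam_right; lra.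
by apply: hA; rewrite gtr0_norm; lra.
Unshelve. all: by end_near.
Qed.

HB.instance Definition _ := isCumulative.Build R _ R lim_cdf lim_cdf_nd lim_cdf_rc.
HB.instance Definition _ := isCumulativeBounded.Build R 0 1 lim_cdf lim_cdfNy lim_cdfy.

Let idTR : measurableTypeR R -> R := idfun.
#[local] HB.instance Definition _ :=
  @isMeasurableFun.Build _ _ _ _ idTR (@measurable_id _ _ setT).

(* The identity only changes the measurable structure on R, from the one
   generated by half-open intervals to the default one. *)
Definition limit_law : probability R R :=
  distribution (lebesgue_stieltjes_measure lim_cdf)
    (idTR : {RV lebesgue_stieltjes_measure lim_cdf >-> R}).

Lemma limit_law_itv x : limit_law `]-oo, x] = (lim_cdf x)%:E.
Proof. exact: (@cdf_lebesgue_stieltjes_id R lim_cdf x). Qed.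

End LimitMeasure.

(** * Weak convergence to the limit law *)

Section LimitIdentification.
Local Open Scope classical_set_scope.
Variables (R : realType) (M : nat -> R) (S0 : nat -> seq R).
Hypothesis S0M : moment_seq M S0.
Hypothesis growth : forall t : R, t ^+ (2 * m) * M (2 * m) / (2 * m)`!%:R @[m --> \oo] --> (0 : R).

Local Notation law := (limit_law S0M growth).
Local Notation F := (lim_cdf S0).
Local Notation rampL := (limiting_ramp S0M growth).

(** Short ramps are differences of consecutive absolute values, so their sum telescopes. *)
Lemma ramp_split N (a h x : R) : h != 0 -> (0 < N)%N ->
  ramp a (a + N%:R * h) x =
  N%:R^-1 * \sum_(j < N) ramp (a + j%:R * h) (a + j.+1%:R * h) x.
Proof.
move=> h0 N0; have NR : N%:R != 0 :> R by rewrite pnatr_eq0 -lt0n.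
pose g j := `|x - (a + j%:R * h)|.
have -> : \sum_(j < N) ramp (a + j%:R * h) (a + j.+1%:R * h) x =
    N%:R / 2 + (g N - g 0%N) / (2 * h).
  rewrite -(telescope_sumr _ (leq0n N)) big_mkord mulr_suml.
  rewrite (_ : N%:R / 2 = \sum_(j < N) 2^-1); last first.
    by rewrite sumr_const card_ord -[RHS]mulr_natl.
  rewrite -big_split /=; apply: eq_bigr => j _; rewrite /ramp.
  have -> // : a + j.+1%:R * h - (a + j%:R * h) = h by rewrite -natr1; ring.
by rewrite /ramp /g mul0r addr0 [a + N%:R * h - a]addrC addKr; field; rewrite h0 NR.
Qed.

Lemma continuous_rint (f : R -> R) (B : R) : continuous f -> (forall x, `|f x| <= B) -> rint law f.
Proof.
move=> cf fB; apply: (@rint_le _ _ _ _ f (fun=> B)) => //.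
- exact: continuous_measurable_fun.
- exact: rint_cst.
Qed.

Lemma ramp_continuous (a b : R) : continuous (ramp a b).
Proof.
move=> x; apply: cvgD; first exact: cvg_cst.
apply: cvgMr_tmp; apply: cvgB.
- by apply: cvg_norm; apply: cvgB; [exact: cvg_id|exact: cvg_cst].
- by apply: cvg_norm; apply: cvgB; [exact: cvg_id|exact: cvg_cst].
Qed.

Lemma ramp_rint (a b : R) : a < b -> rint law (ramp a b).
Proof.
move=> ab; apply: (@continuous_rint _ 1); first exact: ramp_continuous.
by move=> x; rewrite ger0_norm ?ramp_ge0 ?ramp_le1.
Qed.

Lemma Ex_ramp_bounds (a b : R) : a < b -> F a <= Ex law (ramp a b) <= F b.
Proof.
move=> ab.
have m x : measurable (`]-oo, x]%classic : set R) by exact: measurable_itv.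
have e x : Ex law \1_(`]-oo, x]) = F x by rewrite Ex_indic// limit_law_itv.
rewrite -(e a) -(e b); apply/andP; split.
- apply: Ex_le; [exact: rint_indic|exact: ramp_rint|] => x.
  rewrite indicE; case: (boolP (x \in _)) => [|_]; last exact: ramp_ge0.
  by rewrite inE /= in_itv /= => xa; rewrite rampl.
- apply: Ex_le; [exact: ramp_rint|exact: rint_indic|] => x.
  rewrite indicE; case: (boolP (x \in _)) => [_|]; first exact: ramp_le1.
  by rewrite notin_setE /= in_itv /= => /negP; rewrite -ltNge => bx; rewrite rampr// ltW.
Qed.

(** For one ramp both sides are only known to lie between two values of [F]. For [N] adjacent short
    ramps these gaps telescope to at most 2 in total, so their average is at most 2/N. *)
Lemma Ex_rampE (a b : R) : a < b -> Ex law (ramp a b) = lam S0 a b.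
Proof.
move=> ab; apply/eqP; rewrite -subr_eq0 -normr_eq0 eq_le normr_ge0 andbT.
apply/ler_addgt0Pl => e e0; rewrite addr0.
pose N := (Num.truncn (2 / e)).+1.
have NR : 0 < N%:R :> R by [].
have Ne : 2 / N%:R <= e.
  by rewrite ler_pdivrMr// mulrC -ler_pdivrMr//; exact/ltW/truncnS_gt.
apply: le_trans Ne.
pose h := (b - a) / N%:R.
have h0 : 0 < h by rewrite divr_gt0// subr_gt0.
have bE : b = a + N%:R * h by rewrite /h mulrC divfK ?gt_eqF// addrC subrK.
(* [u] starts one step to the left of [a], because [lim_cdf_le] bounds a ramp from below by [F] only
   at points strictly to its left. *)
pose u j := a + (j%:R - 1) * h.
have uS j : u j.+1 = a + j%:R * h by rewrite /u -natr1 addrK.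
have ult j : u j < u j.+1 by rewrite uS /u ltrD2l ltr_pM2r//; lra.
have re x : ramp a b x = N%:R^-1 * \sum_(j < N) ramp (u j.+1) (u j.+2) x.
  by rewrite bE ramp_split ?gt_eqF//; congr (_ * _); apply: eq_bigr => j _; rewrite !uS.
pose Ej j := Ex law (ramp (u j.+1) (u j.+2)).
pose Lj j := lam S0 (u j.+1) (u j.+2).
have EE : Ex law (ramp a b) = N%:R^-1 * \sum_(j < N) Ej j.
  rewrite (_ : ramp a b = fun x => N%:R^-1 * \sum_(j < N) ramp (u j.+1) (u j.+2) x).
    by rewrite ExZ ?Ex_sum// => *; do ?[apply: rint_sum => *]; exact: ramp_rint.
  exact/funext.
have EL : lam S0 a b = N%:R^-1 * \sum_(j < N) Lj j.
  rewrite /lam (_ : ramp a b = fun x => N%:R^-1 * \sum_(j < N) ramp (u j.+1) (u j.+2) x); last exact/funext.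
  have /(_ N)[ls vs] : forall n, limiting M S0 (fun x => \sum_(j < n) ramp (u j.+1) (u j.+2) x) /\
      lim_avg S0 (fun x => \sum_(j < n) ramp (u j.+1) (u j.+2) x) = \sum_(j < n) Lj j.
    elim=> [|n [IH1 IH2]].
      by under eq_fun do rewrite big_ord0; rewrite big_ord0; exact: (limiting_cst S0M).
    under eq_fun do rewrite big_ord_recr /=.
    rewrite big_ord_recr /=; have [l v] := limitingD S0M IH1 (@rampL (u n.+1) (u n.+2)).
    by split=> //; rewrite v IH2.
  by have [_ ->] := limitingZ S0M N%:R^-1 ls; rewrite vs.
have b1 j : `|Ej j - Lj j| <= F (u j.+2) - F (u j).
  have /andP[h1 h2] := Ex_ramp_bounds (ult j.+1).
  have h3 := lam_le_cdf S0M growth (ult j.+1).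
  have h4 := lim_cdf_le S0M growth (ult j) (ult j.+1).
  have h5 := lim_cdf_nd S0M growth (ltW (ult j)).
  rewrite ler_norml /Ej /Lj; apply/andP; split; lra.
rewrite EE EL -mulrBr -sumrB normrM ger0_norm ?invr_ge0// mulrC ler_pdivrMr// divfK ?gt_eqF//.
apply: (le_trans (ler_norm_sum _ _ _)).
apply: (@le_trans _ _ (\sum_(j < N) (F (u j.+2) - F (u j)))); first by apply: ler_sum.
have -> : \sum_(j < N) (F (u j.+2) - F (u j)) =
    (F (u N.+1) - F (u 1%N)) + (F (u N) - F (u 0%N)).
  have t (g : nat -> R) : \sum_(j < N) (g j.+1 - g j) = g N - g 0%N.
    by rewrite -(telescope_sumr _ (leq0n N)) big_mkord.
  rewrite -(t (fun j => F (u j.+1))) -(t (fun j => F (u j))) -big_split /=.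
  by apply: eq_bigr => j _; ring.
have := lim_cdf_ge0 S0M growth (u 0%N); have := lim_cdf_ge0 S0M growth (u 1%N).
have := lim_cdf_le1 S0M growth (u N); have := lim_cdf_le1 S0M growth (u N.+1); lra.
Qed.

Definition determined f := [/\ limiting M S0 f, rint law f & Ex law f = lim_avg S0 f].

Lemma determined_cst (k : R) : determined (fun=> k).
Proof.
have [l v] := limiting_cst S0M k; split=> //; first exact: rint_cst.
by rewrite v Ex_cst.
Qed.

Lemma determined_ramp (a b : R) : a < b -> determined (ramp a b).
Proof. by move=> ab; split; [exact: rampL|exact: ramp_rint|rewrite Ex_rampE]. Qed.

Lemma determinedD f g : determined f -> determined g -> determined (fun x => f x + g x).
Proof.
move=> [lf rf ef] [lg rg eg]; have [l v] := limitingD S0M lf lg.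
by split=> //; [exact: rintD|rewrite v ExD// ef eg].
Qed.

Lemma determinedZ (k : R) f : determined f -> determined (fun x => k * f x).
Proof.
move=> [lf rf ef]; have [l v] := limitingZ S0M k lf.
by split=> //; [exact: rintZ|rewrite v ExZ// ef].
Qed.

(** [h] is constant on either side of the interval, so that a further ramp can be attached at its
    right end. *)
Definition approximable (f : R -> R) (e a b : R) := exists h, [/\ determined h,
  forall y, y <= a -> h y = f a, forall y, a <= y <= b -> `|f y - h y| <= e &
  forall y, b <= y -> h y = f b].

Lemma approximable_step f e a b b' : approximable f e a b -> b < b' -> a <= b ->
  (forall y, b <= y <= b' -> `|f y - f b| <= e / 2) -> approximable f e a b'.
Proof.
move=> [h [dh ha hm hb]] bb' ab osc.
exists (fun y => h y + (f b' - f b) * (1 + -1 * ramp b b' y)); split.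
- apply: determinedD => //; apply: determinedZ; apply: determinedD; first exact: determined_cst.
  by apply: determinedZ; exact: determined_ramp.
- by move=> y ya; rewrite (rampl bb') ?(le_trans ya)// mulr1 subrr mulr0 addr0 ha.
- move=> y /andP[ay yb']; have [yb|by_] := leP y b.
    by rewrite (rampl bb' yb) mulr1 subrr mulr0 addr0 hm// ay.
  rewrite (hb _ (ltW by_)).
  have /andP[r0 r1] := ramp01 y bb'; move: (ramp b b' y) r0 r1 => t t0 t1.
  have h1 : `|f y - f b| <= e / 2 by rewrite osc// (ltW by_).
  have h2 : `|f b' - f b| <= e / 2 by rewrite osc// lexx (ltW bb').
  have h3 : `|(f b' - f b) * (1 + -1 * t)| <= e / 2.
    rewrite normrM (le_trans _ h2)// ler_piMr//.
    by rewrite ler_norml; apply/andP; split; lra.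
  rewrite opprD addrA; apply: (le_trans (ler_normB _ _)); lra.
- by move=> y yb; rewrite (rampr bb' yb) mulr0 addr0 mulr1 hb ?(le_trans (ltW bb'))// addrC subrK.
Qed.

(** Let s be the supremum of the right ends that can be reached. By continuity at s, one more ramp
    starting just before s would pass beyond s, unless [b] is reached. *)
Lemma approximable_continuous f e a b : continuous f -> 0 < e -> a <= b -> approximable f e a b.
Proof.
move=> cf e0 ab; pose E := [set x | a <= x <= b /\ approximable f e a x].
have Ea : E a.
  split; first by rewrite lexx.
  exists (fun=> f a); split=> //; first exact: determined_cst.
  by move=> y; rewrite -eq_le => /eqP ->; rewrite subrr normr0 ltW.
have Es : has_sup E by split; [exists a|exists b => x [/andP[]]].
have as_ : a <= sup E by exact: (ub_le_sup Es.2).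
have e4 : 0 < e / 4 by rewrite divr_gt0.
have /cvgrPdist_lt/(_ _ e4)/nbhs_ballP[r /= r0 hr] := cf (sup E).
have [x Ex sx] := sup_adherent r0 Es.
have xs : x <= sup E by exact: (ub_le_sup Es.2).
have [/andP[ax xb] Ax] := Ex.
pose d := Num.min b (sup E + r / 2).
have db : d <= b by rewrite ge_min lexx.
have ds : d <= sup E + r / 2 by rewrite ge_min lexx orbT.
have dE : (d = b) \/ (d = sup E + r / 2) by rewrite /d minEle; case: ifP; [left|right].
have [xd|dx] := ltP x d.
  have Ad : approximable f e a d.
    apply: (approximable_step Ax xd ax) => y /andP[xy yd].
    have h1 : `|f (sup E) - f y| < e / 4.
      by apply: hr; rewrite /ball /= ltr_norml; apply/andP; split; lra.
    have h2 : `|f (sup E) - f x| < e / 4.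
      by apply: hr; rewrite /ball /= ltr_norml; apply/andP; split; lra.
    move: h1 h2; rewrite !ltr_norml ler_norml => /andP[? ?] /andP[? ?]; apply/andP; split; lra.
  have [<-//|dE'] := dE.
  have : d <= sup E by apply: (ub_le_sup Es.2); split=> //; rewrite db (le_trans ax (ltW xd)).
  lra.
have [dE'|dE'] := dE; last lra.
have -> // : b = x by apply/eqP; rewrite eq_le xb andbT; lra.
Qed.

(** On a large interval [f] is within e/8 of a combination [h] of ramps; outside, the error is at
    most 2B and is weighted by [q], which is 1 there and small on average. *)
Lemma determined_weak_cvg f (B : R) S : continuous f -> (forall x, `|f x| <= B) ->
  moment_seq M S -> avg (S n) f @[n --> \oo] --> Ex law f.
Proof.
move=> cf fB hS; apply/cvgrPdist_le => e e0.
have B0 : 0 <= B by apply: le_trans (fB 0).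
(* The limit average of [q] is at most 2k, so the tails cost at most 4Bk <= e/8. *)
pose k := e / (32 * (B + 1)).
have k0 : 0 < k by rewrite divr_gt0// mulr_gt0// ltr_wpDl.
have [A A1 hA] := sq_small S0M k0.
pose q x := ramp (- A - 1) (- A) x + (1 + -1 * ramp A (A + 1) x).
have lt1 : - A - 1 < - A by lra.
have lt2 : A < A + 1 by lra.
have dq : determined q.
  apply: determinedD; first exact: determined_ramp.
  by apply: determinedD; [exact: determined_cst|apply: determinedZ; exact: determined_ramp].
have qle : lim_avg S0 q <= 2 * k.
  have [l1 v1] := limitingZ S0M (-1) (@rampL A (A + 1)).
  have [l0 v0] := limiting_cst S0M 1.
  have [l2 v2] := limitingD S0M l0 l1.
  have [_ ->] := limitingD S0M (@rampL (- A - 1) (- A)) l2.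
  rewrite v2 v0 v1 -/(lam _ _ _) -/(lam _ _ _).
  have A0 : 0 < A by lra.
  have nA : - A < 0 by lra.
  have h1 := lam_left S0M growth lt1 nA.
  have h2 := lam_right S0M growth lt2 A0.
  have h3 : M 2 / (- A) ^+ 2 < k by apply: hA; rewrite normrN ler_norm.
  have h4 : M 2 / A ^+ 2 < k by apply: hA; rewrite ler_norm.
  lra.
have e4 : 0 < e / 8 by rewrite divr_gt0.
have AA : - A - 1 <= A + 1 by lra.
have [h [dh ha hm hb]] := @approximable_continuous f (e / 8) (- A - 1) (A + 1) cf e4 AA.
have q0 x : 0 <= q x.
  by rewrite addr_ge0 ?ramp_ge0// mulN1r subr_ge0 ramp_le1.
have fh x : `|f x - h x| <= e / 8 + 2 * B * q x.
  have [xa|ax] := leP x (- A - 1).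
    have -> : q x = 1.
      by rewrite /q (rampl lt1 xa) (rampl lt2); [rewrite mulr1 subrr addr0|lra].
    rewrite mulr1 (ha _ xa); apply: (le_trans (ler_normB _ _)).
    by have := fB x; have := fB (- A - 1); lra.
  have [bx|xb] := leP (A + 1) x.
    have -> : q x = 1.
      by rewrite /q (rampr lt2 bx) (rampr lt1); [rewrite mulr0 addr0 add0r|lra].
    rewrite mulr1 (hb _ bx); apply: (le_trans (ler_normB _ _)).
    by have := fB x; have := fB (A + 1); lra.
  have /le_trans -> // : `|f x - h x| <= e / 8 by rewrite hm// (ltW ax) (ltW xb).
  by rewrite lerDl; apply: mulr_ge0; rewrite ?mulr_ge0.
have db : determined (fun x => e / 8 + 2 * B * q x).
  by apply: determinedD; [exact: determined_cst|exact: determinedZ].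
have bound : lim_avg S0 (fun x => e / 8 + 2 * B * q x) <= e / 4.
  have [lq _ _] := dq; have [l1 v1] := limitingZ S0M (2 * B) lq.
  have [_ ->] := limitingD S0M (limiting_cst S0M (e / 8)).1 l1.
  rewrite v1 (limiting_cst S0M _).2.
  have : 2 * B * lim_avg S0 q <= 2 * B * (2 * k) by rewrite ler_wpM2l// mulr_ge0.
  have : k * (32 * (B + 1)) = e by rewrite /k divfK// gt_eqF// mulr_gt0// ltr_wpDl.
  by nra.
have [lh rh eh] := dh; have [lb rb eb] := db.
have rf := continuous_rint cf fB.
have hE : `|Ex law f - Ex law h| <= e / 4.
  apply: le_trans bound; rewrite -eb -ExB//; apply: Ex_norm_le => //.
  by apply: (rintD rf); rewrite (_ : (fun x => - h x) = fun x => -1 * h x);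
    [exact: rintZ|apply/funext => x; rewrite mulN1r].
near=> n.
have h1 : `|lim_avg S0 h - avg (S n) h| < e / 8.
  by near: n; have /cvgrPdist_lt/(_ _ e4) := lh _ hS.
have h2 : `|lim_avg S0 (fun x => e / 8 + 2 * B * q x) - avg (S n) (fun x => e / 8 + 2 * B * q x)| < e / 8.
  by near: n; have /cvgrPdist_lt/(_ _ e4) := lb _ hS.
have h3 : `|avg (S n) f - avg (S n) h| <= avg (S n) (fun x => e / 8 + 2 * B * q x).
  by rewrite -avgB; exact: avg_norm_le.
move: h1 h2 h3 hE; rewrite -eh; move: (Ex law f) (Ex law h) (avg _ f) (avg _ h) => x1 x2 x3 x4.
move: (lim_avg _ _) bound (avg _ _) => x5 bound x6.
rewrite !ltr_norml !ler_norml => /andP[? ?] /andP[? ?] /andP[? ?] /andP[? ?]; apply/andP; split; lra.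
Unshelve. all: by end_near.
Qed.

End LimitIdentification.

(** * Integrals against the empirical measure *)

Section EmpiricalMeasure.
Variables (R : realType) (n : nat) (A : 'M[R]_n).
Hypothesis AT : A^T = A.

Lemma ge0_integral_empirical (f : R -> R) : measurable_fun setT f -> (forall x, 0 <= f x) ->
  (\int[empirical_measure A]_x (f x)%:E)%E = (avg (eigenvalues A) f)%:E.
Proof.
move=> mf f0; have mF : measurable_fun setT (EFin \o f) by exact/measurable_EFinP.
have F0 x : setT x -> (0 <= (f x)%:E)%E by rewrite lee_fin.
rewrite ge0_integral_mscale// ge0_integral_measure_sum//.
rewrite /avg size_eigenvalues// EFinM; congr (_ * _)%E.
rewrite (big_nth 0) size_eigenvalues// big_mkord -sumEFin; apply: eq_bigr => k _.
by rewrite integral_dirac// diracT mul1e.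
Qed.

Lemma integral_empirical (f : R -> R) : measurable_fun setT f ->
  (\int[empirical_measure A]_x (f x)%:E)%E = (avg (eigenvalues A) f)%:E.
Proof.
move=> mf; rewrite integralE.
have ep : (fun x => (f x)%:E)^\+%E = fun x => (Num.max (f x) 0)%:E.
  by apply/funext => x; rewrite funeposE EFin_max.
have en : (fun x => (f x)%:E)^\-%E = fun x => (Num.max (- f x) 0)%:E.
  by apply/funext => x; rewrite funenegE EFin_max.
have m1 : measurable_fun setT (fun x => Num.max (f x) 0) by exact: measurable_funrpos.
have m2 : measurable_fun setT (fun x => Num.max (- f x) 0) by exact: measurable_funrneg.
have p0 (u : R) : 0 <= Num.max u 0 by rewrite le_max lexx orbT.
rewrite ep en (ge0_integral_empirical m1)// (ge0_integral_empirical m2)//.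
rewrite -EFinB -avgB; congr (avg _ _)%:E; apply/funext => x.
by rewrite !maxEle; case: leP => ?; case: leP => ?; lra.
Qed.
End EmpiricalMeasure.

(** * The universal moment sequence and its growth *)

Section Main.
Local Open Scope classical_set_scope.
Variable R : realType.

(** Since (2m)! >= m! m^m, the terms are bounded by 2 (8 t^2)^m / m!, twice a term of an exponential
    series. *)
Lemma moment_growth (M : nat -> R) :
  (forall m, (0 < m)%N -> `|M (2 * m)%N| <= 2 * 8 ^+ m * m%:R ^+ m) ->
  forall t : R, t ^+ (2 * m) * M (2 * m) / (2 * m)`!%:R @[m --> \oo] --> (0 : R).
Proof.
move=> hM t.
have c0 : 2 * exp_coeff (8 * t ^+ 2) m @[m --> \oo] --> (0 : R).
  rewrite -[X in _ --> X](mulr0 2); apply: cvgMl_tmp.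
  exact/cvg_series_cvg_0/is_cvg_series_exp_coeff.
apply/cvgrPdist_lt => e e0.
have /cvgrPdist_lt/(_ _ e0) := c0; apply: filterS2 (nbhs_infty_ge 1) => m m0.
rewrite !sub0r !normrN; apply: le_lt_trans.
have fac : (m`! * m ^ m <= (2 * m)`!)%N.
  rewrite mul2n -addnn; have : forall j, (m`! * m ^ j <= (m + j)`!)%N; last exact.
  elim=> [|j IH]; first by rewrite expn0 muln1 addn0.
  rewrite expnS mulnCA addnS factS; apply: leq_mul => //; lia.
have f0 : 0 < (2 * m)`!%:R :> R by rewrite ltr0n fact_gt0.
have g0 : 0 < m`!%:R :> R by rewrite ltr0n fact_gt0.
have e2 : 0 <= exp_coeff (8 * t ^+ 2) m.
  by apply: divr_ge0; [apply: exprn_ge0; rewrite mulr_ge0 ?sqr_ge0|exact: ltW].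
rewrite [leRHS]ger0_norm; last exact: mulr_ge0.
rewrite !normrM normfV !(ger0_norm (ltW f0)) ler_pdivrMr// normrX exprM real_normK ?num_real//.
apply: (@le_trans _ _ ((t ^+ 2) ^+ m * (2 * 8 ^+ m * m%:R ^+ m))).
  by rewrite ler_wpM2l ?hM// exprn_ge0// sqr_ge0.
apply: (@le_trans _ _ (2 * exp_coeff (8 * t ^+ 2) m * (m`! * m ^ m)%:R)); last first.
  by apply: ler_wpM2l; [exact: mulr_ge0|rewrite ler_nat].
rewrite /exp_coeff /= natrM natrX !exprMn le_eqVlt; apply/orP; left; apply/eqP.
by field; rewrite gt_eqF.
Qed.

Lemma moment_sequence (c : R) : `|c| <= 1 -> exists M : nat -> R,
  (forall m, (0 < m)%N -> `|M (2 * m)%N| <= 2 * 8 ^+ m * m%:R ^+ m) /\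
  forall d (T : measurableType d) (P : probability T R) (a : array P),
    condA1 a -> condA2 a -> condA3 a -> condC2 a c ->
    {ae P, forall w, moment_seq M (fun n => eigenvalues (random_matrix a n w))}.
Proof.
move=> c1; have [v hv] := choice (fun k => @circuit_sum_cvg R c k c1).
(* Circuits have at least one edge, so [v k'] is the moment of order [k'.+1]; the moment of order 0
   is set to 1. *)
exists (fun k => if k is k'.+1 then v k' else 1); split.
  by move=> [//|m] _; rewrite mulnS; have [+ _] := hv (2 * m).+1; apply; lia.
move=> d T P a a1 a2 a3 a4.
have sym n w : (random_matrix a n w)^T = random_matrix a n w.
  by apply/matrixP => p q; rewrite !mxE entryC.
have [cn [mf cnc]] := array_moment_family a2 a3 a1 a4.
have h := ae_forall_nat (fun k => ae_moment_cvg a1 a2 a3 a4 ((hv k).2 _ _ _ mf cnc)).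
apply: filterS h => w hw; split=> [n|k]; first by rewrite size_eigenvalues.
case: k => [|k].
  apply: (@cvg_trans _ (1 @[n --> \oo])); last exact: cvg_cst.
  apply: near_eq_cvg; near=> n.
  have n0 : n%:R != 0 :> R by rewrite pnatr_eq0 -lt0n; near: n; exact: nbhs_infty_ge.
  rewrite /avg size_eigenvalues//; under eq_bigr do rewrite expr0.
  by rewrite big_const_seq count_predT iter_addr_0 size_eigenvalues// mulVf.
apply: cvg_trans (hw k); apply: near_eq_cvg; apply: nearW => n.
by rewrite trace_eigenvalues// /avg size_eigenvalues.
Unshelve. all: by end_near.
Qed.

Lemma correlation_bound d (T : measurableType d) (P : probability T R) (a : array P) (c : R) :
  condA1 a -> condA2 a -> condA3 a -> condC2 a c -> `|c| <= 1.
Proof.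
move=> a1 a2 a3 a4; have [cn [[_ cn1 _] cnc]] := array_moment_family a2 a3 a1 a4.
by apply: (ler_cvg_to (cvg_norm cnc) (cvg_cst (1 : R))); exact: nearW.
Qed.
End Main.
Local Open Scope classical_set_scope.
Local Open Scope ring_scope.

Theorem theorem2p3 (R : realType) (c : R) :
  exists nu : probability R R,
    forall (d : measure_display) (T : measurableType d) (P : probability T R)
           (a : array P),
      condA1 a -> condA2 a -> condA3 a -> condC2 a c ->
      {ae P, forall w : T,
        weak_cvg (fun n => empirical_measure (random_matrix a n w)) nu}.
Proof.
(* A first array provides the moment sequence of reference; without any, there is
   nothing to prove. *)
have [[d [T [P [a [a1 a2 a3 a4]]]]]|none] := pselect (exists (d : measure_display)
    (T : measurableType d) (P : probability T R) (a : array P),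
    [/\ condA1 a, condA2 a, condA3 a & condC2 a c]); last first.
  exists [the probability R R of \d_(0 : R)] => d T P a a1 a2 a3 a4.
  by exfalso; apply: none; exists d, T, P, a.
have [M [hM aeM]] := moment_sequence (correlation_bound a1 a2 a3 a4).
have growth := moment_growth hM.
(* An event of probability one is nonempty; any of its points provides the reference spectra. *)
have [w0 h0] : exists w0, moment_seq M (fun n => eigenvalues (random_matrix a n w0)).
  have pf : ProperFilter (nbhs (almost_everywhere P)).
    have P0 : (0 < P setT)%E by rewrite probability_setT.
    exact: ae_properfilter_algebraOfSetsType P0.
  exact: (@filter_ex _ _ pf _ (aeM _ _ _ _ a1 a2 a3 a4)).
exists (limit_law h0 growth) => d' T' P' a' a1' a2' a3' a4'.
apply: filterS (aeM _ _ _ _ a1' a2' a3' a4') => w hw f cf bf.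
have [B fB] : exists B, forall x, `|f x| <= B.
  have [B [_ hB]] := bf; exists (B + 1) => x; apply: hB => //; lra.
have mf : measurable_fun setT f by exact: continuous_measurable_fun.
have sym n : (random_matrix a' n w)^T = random_matrix a' n w.
  by apply/matrixP => p q; rewrite !mxE entryC.
under eq_fun do rewrite integral_empirical//.
rewrite -ExE; last exact: continuous_rint cf fB.
apply/cvg_EFin; first exact: nearW.
exact: (determined_weak_cvg cf fB hw).
Qed.
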